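(* Let $A\subset\mathbb Z^n$ be a circuit in special orthogonal form. Then, for each $f\in\mathbb C_*^A$, the set of critical arguments $\mathcal I=\operatorname{Arg}(C(f))\subset\mathbf T^n$ is an index set of the complement of the closed coamoeba $\overline{\mathcal C}_f$.
   Context: Circuits. A circuit is a set $A\subset\mathbb Z^n$ of $n+2$ points whose convex hull $\mathcal N_A$ is $n$-dimensional; $A$ is identified with the $(1+n)\times(n+2)$ matrix with columns $(1,\mathbf a)^t$, $\mathbf a\in A$. $\operatorname{Vol}(A)$ is the volume of $\mathcal N_A$ normalized so that the standard simplex has volume $1$. A Gale dual of $A$ is an integer column vector $B$ generating $\{b\in\mathbb Z^{n+2}:Ab=0\}$. Special orthogonal form. The elements of $A$ are ordered so that $A$ has a Gale dual $B=(B_1,B_2)^t$ where $B_1$ has $m_1+1$ entries, all (strictly) positive, and $B_2$ has $m_2+1$ entries, all (strictly) negative; $m_1+m_2=n$. $A$ is in orthogonal form if $$A=\begin{pmatrix}1&1\\ \tilde A_1&0\\ 0&\tilde A_2\end{pmatrix}$$ in the corresponding block decomposition of columns (the first row being all ones), where $\tilde A_k$ is an $m_k\times(m_k+1)$ matrix, $k=1,2$. It is in special orthogonal form if moreover, for $k=1,2$, $\tilde A_k=(-p_1\mathbf e_1,\dots,-p_{m_k}\mathbf e_{m_k},\mathbf a_{m_k+1})$ with positive integers $p_1,\dots,p_{m_k}$ (depending on $k$); hence the last column $\mathbf a_{m_k+1}$ has only positive coordinates. Polynomials. $\mathbb C_*=\mathbb C\setminus\{0\}$; $\mathbb C_*^A$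 is the set of Laurent polynomials $f(z)=\sum_{\mathbf a\in A}f_{\mathbf a}z^{\mathbf a}$ with all $f_{\mathbf a}\in\mathbb C_*$. $C(f)=\{z\in\mathbb C_*^n:\partial_1f(z)=\dots=\partial_nf(z)=0\}$ is the set of critical points. $\operatorname{Arg}:\mathbb C_*^n\to\mathbf T^n=(\mathbb R/2\pi\mathbb Z)^n$ is the componentwise argument map, and $\mathcal C_f=\operatorname{Arg}(\{z\in\mathbb C_*^n:f(z)=0\})$. Index set. A finite set $\mathcal I\subset\mathbf T^n$ in bijective correspondence, by inclusion, with the set of connected components of $\mathbf T^n\setminus\overline{\mathcal C}_f$ is called an index set of the coamoeba complement. By convention, a set $\mathcal I\subset\mathbf T^n$ of cardinality $\operatorname{Vol}(A)$ is also called an index set if each connected component of $\mathbf T^n\setminus\overline{\mathcal C}_f$ contains exactly one element of $\mathcal I$ (so elements of $\mathcal I$ are allowed to lie in $\overline{\mathcal C}_f$). *)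

(* Defs.v *)
From HB Require Import structures.
From mathcomp Require Export all_boot all_order all_algebra.
From mathcomp Require Export all_classical all_reals all_analysis.
From mathcomp Require Export complex.

Set Implicit Arguments.
Unset Strict Implicit.
Unset Printing Implicit Defensive.

Import Order.TTheory GRing.Theory Num.Theory.
Import numFieldNormedType.Exports.

Local Open Scope classical_set_scope.
Local Open Scope ring_scope.

Section Circle.
Local Open Scope quotient_scope.
Variable R : realType.

Definition congr2pi (x y : R) : bool :=
  `[< exists k : int, x - y = k%:~R * (2 * pi) >].

Fact congr2pi_refl : reflexive congr2pi.
Proof. by move=> x; apply/asboolP; exists 0; rewrite subrr mul0r. Qed.

Fact congr2pi_sym : symmetric congr2pi.
Proof.
have imp x y : congr2pi x y -> congr2pi y x.
  move=> /asboolP[k kE]; apply/asboolP; exists (- k).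
  by rewrite mulrNz mulNr -kE opprB.
by move=> x y; apply/idP/idP; exact: imp.
Qed.

Fact congr2pi_trans : transitive congr2pi.
Proof.
move=> y x z /asboolP[k kE] /asboolP[l lE]; apply/asboolP; exists (k + l).
by rewrite intrD mulrDl -kE -lE addrA subrK.
Qed.

Canonical congr2pi_equiv :=
  EquivRel congr2pi congr2pi_refl congr2pi_sym congr2pi_trans.

Definition circle : Type := quotient_topology {eq_quot congr2pi_equiv}.

HB.instance Definition _ := Topological.copy circle
  (quotient_topology {eq_quot congr2pi_equiv}).

Definition angle (theta : R) : circle :=
  \pi_{eq_quot congr2pi_equiv} theta.

(* The choice of theta is irrelevant modulo 2 pi when z != 0; [arg 0] is a
   junk value. *)
Definition arg (z : R[i]) : circle :=
  angle (xget 0 [set theta : R |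
    z = `|z| * Complex (cos theta) (sin theta)]).

End Circle.

(* Points of the torus are column vectors; matrices over a topological space
   carry the product topology. *)
Definition torus (R : realType) (n : nat) : Type := 'cV[circle R]_n.

HB.instance Definition _ (R : realType) (n : nat) :=
  Topological.copy (torus R n) 'cV[circle R]_n.

Definition Arg (R : realType) (n : nat) (z : 'cV[R[i]]_n) : torus R n :=
  map_mx (@arg R) z.

(* A point configuration in Z^n is the matrix whose columns are its points;
   a polynomial supported on it is its vector of coefficients. *)
Section Laurent.
Variables (R : realType) (n N : nat).
Implicit Types (A : 'M[int]_(n, N)) (f : 'I_N -> R[i]) (z : 'cV[R[i]]_n).

Definition algebraic_torus : set 'cV[R[i]]_n :=
  [set z | forall j, z j 0 != 0].

Definition monomial (a : 'cV[int]_n) z : R[i] := \prod_j z j 0 ^ a j 0.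

Definition laurent A f z : R[i] := \sum_i f i * monomial (col i A) z.

Definition partial (j : 'I_n) A f z : R[i] :=
  \sum_i f i * (A j i)%:~R * monomial (col i A - delta_mx j 0) z.

Definition critical_points A f : set 'cV[R[i]]_n :=
  [set z | algebraic_torus z /\ forall j, partial j A f z = 0].

Definition coamoeba A f : set (torus R n) :=
  [set Arg z | z in [set z | algebraic_torus z /\ laurent A f z = 0]].

End Laurent.

Definition newton_polytope (R : realType) (n N : nat) (A : 'M[int]_(n, N)) :
    set 'cV[R]_n :=
  [set x | exists l : 'cV[R]_N,
    [/\ forall i, 0 <= l i 0, \sum_i l i 0 = 1
      & x = map_mx intr A *m l]].
Arguments newton_polytope R {n N} A.

(* The affine hull of S is the whole space: no proper linear subspace contains
   all the differences of points of S. *)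
Definition full_dimensional (R : realType) (n : nat) (S : set 'cV[R]_n) : Prop :=
  S !=set0 /\ forall U : {vspace 'cV[R]_n},
    (forall x y, S x -> S y -> x - y \in U) -> U = fullv.

(* n-dimensional Lebesgue measure, as the iterated product of the Lebesgue
   measure on R: the successor case is the unfolding of [product_measure1]. *)
Fixpoint lebesgue_volume (R : realType) (n : nat) :
    set 'cV[R]_n -> \bar R :=
  match n with
  | 0 => fun S : set 'cV[R]_0 => (\1_S (0 : 'cV[R]_0))%:E
  | n'.+1 => fun S : set 'cV[R]_(1 + n') =>
      (\int[lebesgue_measure]_t
         lebesgue_volume [set x : 'cV[R]_n' | S (col_mx (const_mx t) x)])%E
  end.

Definition standard_simplex (R : realType) (n : nat) : set 'cV[R]_n :=
  newton_polytope R (row_mx (0 : 'cV[int]_n) 1%:M).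
Arguments standard_simplex R n : clear implicits.

Definition normalized_volume (R : realType) (n N : nat) (A : 'M[int]_(n, N)) :
    R :=
  fine (lebesgue_volume (newton_polytope R A)) /
  fine (lebesgue_volume (standard_simplex R n)).
Arguments normalized_volume R {n N} A.

Definition circuit (R : realType) (n N : nat) (A : 'M[int]_(n, N)) : Prop :=
  [/\ N = n.+2, injective (fun i => col i A)
    & full_dimensional (newton_polytope R A)].

Definition homogenize (n N : nat) (A : 'M[int]_(n, N)) : 'M[int]_(1 + n, N) :=
  col_mx (const_mx 1) A.

Definition gale_dual (n N : nat) (A : 'M[int]_(n, N)) (B : 'cV[int]_N) : Prop :=
  forall b : 'cV[int]_N, homogenize A *m b = 0 <-> exists k : int, b = k *: B.

Definition sign_ordered (n N1 N2 : nat) (A : 'M[int]_(n, N1 + N2)) : Prop :=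
  exists B : 'cV[int]_(N1 + N2),
    [/\ gale_dual A B, forall i, 0 < usubmx B i 0
      & forall i, dsubmx B i 0 < 0].

Definition orthogonal_form (m1 m2 : nat)
    (A : 'M[int]_(m1 + m2, (m1 + 1) + (m2 + 1))) : Prop :=
  [/\ sign_ordered A, ursubmx A = 0 & dlsubmx A = 0].

Definition special_block (m : nat) (A : 'M[int]_(m, m + 1)) : Prop :=
  exists2 p : 'rV[int]_m, forall i, 0 < p 0 i & lsubmx A = - diag_mx p.

Definition special_orthogonal_form (m1 m2 : nat)
    (A : 'M[int]_(m1 + m2, (m1 + 1) + (m2 + 1))) : Prop :=
  [/\ orthogonal_form A, special_block (ulsubmx A)
    & special_block (drsubmx A)].

Definition components (T : topologicalType) (U : set T) : set (set T) :=
  [set connected_component U x | x in U].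

Definition coamoeba_complement (R : realType) (n N : nat) (A : 'M[int]_(n, N))
    (f : 'I_N -> R[i]) : set (torus R n) :=
  ~` closure (coamoeba A f).

Definition one_per_component (T : topologicalType) (U I : set T) : Prop :=
  forall K, components U K -> exists! t, I t /\ K t.

(* The second alternative is the convention under which points of I may lie in
   the closed coamoeba. *)
Definition index_set (R : realType) (n N : nat) (A : 'M[int]_(n, N))
    (f : 'I_N -> R[i]) (I : set (torus R n)) : Prop :=
  [/\ finite_set I, I `<=` coamoeba_complement A f
    & one_per_component (coamoeba_complement A f) I]
  \/
  (exists2 k : nat, (I #= `I_k)%card & k%:R = normalized_volume R A) /\
  one_per_component (coamoeba_complement A f) I.

(* Main.v *)
Require Import Defs.
From mathcomp Require Import ring lra zify intdiv measurable_realfun.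

Set Implicit Arguments.
Unset Strict Implicit.
Unset Printing Implicit Defensive.

Import Order.TTheory GRing.Theory Num.Theory.
Import numFieldNormedType.Exports.

Local Open Scope classical_set_scope.
Local Open Scope ring_scope.

(* Write f = f1(z1) + f2(z2).  On the fibre of Arg over theta the terms of f_k
   have fixed phases, and their moduli range over all positive vectors with one
   prescribed weighted product, the weights being given by the Gale dual.  So
   theta lies in the coamoeba iff V1(theta1) meets -V2(theta2), where V_k is the
   set of values of f_k on the fibre, and theta is a critical argument iff the
   phases are equal inside each block.

   Let theta lie off the closed coamoeba.  A real lift of the phases is singled
   out: if a block has at least three terms, its phases lie in an open
   half-plane; if it has two, V_k is a curve and the lift records on which side
   of the curve the values of the other block lie.  Moving the lifted phases
   linearly to their weighted mean, one block after the other, never meets the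
   coamoeba, and ends at a critical argument.  For a value w of the other block
   this follows from convex duality: w is not attained iff some half-plane
   inequality Re(e^{-i eta} w) < const * prod cos(phi_i - eta)^lam_i holds
   (weighted AM-GM and its equality case), and the right hand side increases
   along the motion since log cos is concave.  The lift, hence the endpoint, is
   locally constant, so each component of the complement contains exactly one
   critical argument.

   The critical arguments are the solutions of an integral linear system modulo
   2 pi, so their number is a determinant (Smith normal form); it is the
   normalized volume, which is computed by slicing the Newton polytope. *)

(** * One block of terms *)

(** The number of terms of a block decides what can keep a value w out of [V_k]. Three or more
    phasors satisfy a nontrivial real relation; sliding the moduli along it keeps the value and
    drives their weighted product to 0, so a value of higher level also has the given level, and
    only the half-plane inequality is left. Two independent phasors have no relation: w may also
    escape to a strictly higher level, which no half-plane detects, and a lift with phases pi or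
    more apart stands for this case. Such a lift is carried along paths by connectedness (it exists,
    is open, and is unique up to a common turn), because the values of the other block form an
    unbounded family, for which openness at each value yields no common neighbourhood. Lying off the
    closed coamoeba, not only off the coamoeba, excludes opposite phases in a block of three or more
    terms. Perturbations always keep the weighted mean of the phases of each block, since the linear
    forms given by the exponents have weighted mean 0. *)

Section RealFacts.
Variable R : realType.
Implicit Types x y z : R.

Lemma cos_gt0_norm x : `|x| < pi / 2 -> 0 < cos x.
Proof. by move=> h; apply: cos_gt0_pihalf; rewrite -ltr_norml. Qed.

Lemma tan_le x y : `|x| < pi / 2 -> `|y| < pi / 2 -> x <= y -> tan x <= tan y.
Proof.
rewrite !ltr_norml => ha hb; rewrite le_eqVlt => /predU1P[->//|ab].
by apply: ltW; rewrite ltr_tan ?in_itv.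
Qed.

(** The derivative [- tan] of log cos decreases, so the graph lies below its tangent at [x]; the
    mean value theorem is applied to [g], which is log cos minus the linear part of the tangent. *)
Lemma ln_cos_tangent x y : `|x| < pi / 2 -> `|y| < pi / 2 ->
  ln (cos y) <= ln (cos x) - tan x * (y - x).
Proof.
move=> hx hy.
pose g z := ln (cos z) + tan x * z.
suff: g y <= g x by rewrite /g; lra.
have dg z : `|z| < pi / 2 -> is_derive z 1 g (tan x - tan z).
  move=> hz; have cz := cos_gt0_norm hz.
  have dl : is_derive (cos z) 1 (@ln R) (cos z)^-1 by exact: is_derive1_ln.
  have dc : is_derive z 1 (@cos R) (- sin z) by exact: is_derive_cos.
  have dlc := @is_derive1_comp R (@ln R) (@cos R) z _ _ dl dc.
  have dm : is_derive z 1 (fun z => tan x * z) (tan x).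
    have := @is_deriveZ R R R id (tan x) z 1 1 (is_derive_id _ _).
    by rewrite /GRing.scale /= mulr1.
  have -> : tan x - tan z = (cos z)^-1 * - sin z + tan x.
    rewrite /tan; lra.
  exact: is_deriveD.
have mvt a b : `|a| < pi / 2 -> `|b| < pi / 2 -> a < b ->
    exists2 c, a < c < b & g b - g a = (tan x - tan c) * (b - a).
  move=> ha hb ab; have between c : a <= c <= b -> `|c| < pi / 2.
    by move: ha hb; rewrite !ltr_norml; lra.
  have [||c] := @MVT R g (fun c => tan x - tan c) a b ab.
  - by move=> z; rewrite in_itv/= => /andP[? ?]; apply/dg/between; rewrite !ltW.
  - apply: derivable_within_continuous => z; rewrite in_itv/= => zab.
    by have [] := dg z (between z zab).
  by rewrite in_itv/= => cab cE; exists c.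
have [xy|yx|->//] := ltgtP x y.
- have [c /andP[xc cy] cE] := mvt x y hx hy xy.
  have hc : `|c| < pi / 2 by move: hx hy; rewrite !ltr_norml; lra.
  by have := tan_le hx hc (ltW xc) => hh; nra.
- have [c /andP[yc cx] cE] := mvt y x hy hx yx.
  have hc : `|c| < pi / 2 by move: hx hy; rewrite !ltr_norml; lra.
  by have := tan_le hc hx (ltW cx) => hh; nra.
Qed.

Lemma ln_le_subr1 x : 0 < x -> ln x <= x - 1.
Proof.
move=> x0; have := @le_ln1Dx R (x - 1).
by rewrite (addrC 1) subrK; apply; lra.
Qed.

Section Limits.
Context {U : Type} {F : set_system U} {FF : Filter F}.
Implicit Types (g : U -> R) (a : R).

(** The filter is arbitrary because limits are taken both at real parameters and along
    [phase_filter]. *)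
Lemma cvg_ln g a : 0 < a -> g u @[u --> F] --> a -> ln (g u) @[u --> F] --> ln a.
Proof. by move=> a0 ga; apply: (cvg_comp g (@ln R) ga); exact: continuous_ln. Qed.

Lemma cvg_expR g a : g u @[u --> F] --> a -> expR (g u) @[u --> F] --> expR a.
Proof. by move=> ga; apply: (cvg_comp g (@expR R) ga); exact: continuous_expR. Qed.

Lemma cvg_cos g a : g u @[u --> F] --> a -> cos (g u) @[u --> F] --> cos a.
Proof. by move=> ga; apply: (cvg_comp g (@cos R) ga); exact: continuous_cos. Qed.

Lemma cvg_sin g a : g u @[u --> F] --> a -> sin (g u) @[u --> F] --> sin a.
Proof. by move=> ga; apply: (cvg_comp g (@sin R) ga); exact: continuous_sin. Qed.

Lemma cvg_sum (T : finType) (g : T -> U -> R) (a : T -> R) :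
  (forall i, g i u @[u --> F] --> a i) ->
  (\sum_i g i u) @[u --> F] --> \sum_i a i.
Proof. by move=> ga; apply: cvg_big => [|i _]; [exact: add_continuous|exact: ga]. Qed.

Lemma near_lt g1 g2 a1 a2 : g1 u @[u --> F] --> a1 -> g2 u @[u --> F] --> a2 ->
  a1 < a2 -> \forall u \near F, g1 u < g2 u.
Proof.
move=> h1 h2 a12.
have m1 : a1 < (a1 + a2) / 2 by lra.
have m2 : (a1 + a2) / 2 < a2 by lra.
near=> u; apply: (@lt_trans _ _ ((a1 + a2) / 2)).
  by near: u; exact: cvgr_lt h1 _ m1.
by near: u; exact: cvgr_gt h2 _ m2.
Unshelve. all: by end_near. Qed.

End Limits.

Lemma exists_turn x : exists k : int, - pi < x + k%:~R * (2 * pi) <= pi.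
Proof.
have p0 : 0 < 2 * (pi : R) by have := pi_gt0 R; lra.
pose k := Num.floor ((pi - x) / (2 * pi)).
exists k; have := floor_le ((pi - x) / (2 * pi)); have := floorD1_gt ((pi - x) / (2 * pi)).
rewrite -/k ler_pdivlMr// ltr_pdivrMr// intrD => *; apply/andP; split; nra.
Qed.

Lemma cosD_turn x (k : int) : cos (x + k%:~R * (2 * pi)) = cos x.
Proof.
have nat_case y (n : nat) : cos (y + n%:R * (2 * pi)) = cos y.
  elim: n y => [|n IH] y; first by rewrite mul0r addr0.
  have -> : y + n.+1%:R * (2 * pi) = (y + n%:R * (2 * pi)) + pi *+ 2.
    by rewrite -natr1 mulr2n; ring.
  by rewrite cosD2pi IH.
case: k => n; first exact: nat_case.
rewrite NegzE -[LHS](nat_case _ n.+1); congr cos.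
by rewrite mulrNz mulNr subrK.
Qed.

Lemma sinD_turn x (k : int) : sin (x + k%:~R * (2 * pi)) = sin x.
Proof.
rewrite -[LHS]opprK -cosDpihalf addrAC cosD_turn.
by rewrite cosDpihalf opprK.
Qed.

End RealFacts.

Section Block.
Variables (R : realType) (T : finType) (lam : T -> R).

(* t_i are the moduli of the terms of one block, phi_i their phases, lam_i the
   normalized entries of the Gale dual; l is the logarithm of the prescribed
   product of the t_i ^ lam_i, so [attains] describes the values of the block on
   one fibre of Arg. *)
Definition moduli (l : R) (t : T -> R) : Prop :=
  (forall i, 0 < t i) /\ \sum_i lam i * ln (t i) = l.

Definition attains (l : R) (phi : T -> R) (w1 w2 : R) : Prop :=
  exists t, [/\ moduli l t, \sum_i t i * cos (phi i) = w1
    & \sum_i t i * sin (phi i) = w2].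

Definition certificate (l : R) (phi : T -> R) (w1 w2 : R) : Prop :=
  exists eta, (forall i, `|phi i - eta| < pi / 2) /\
    w1 * cos eta + w2 * sin eta <
      expR (l + \sum_i lam i * (ln (cos (phi i - eta)) - ln (lam i))).

Definition mean (phi : T -> R) : R := \sum_i lam i * phi i.

Definition contract (s : R) (phi : T -> R) : T -> R :=
  fun i => (1 - s) * phi i + s * mean phi.

Hypothesis lam_gt0 : forall i, 0 < lam i.
Hypothesis lam_sum1 : \sum_i lam i = 1.

Lemma block_nonempty : exists i : T, True.
Proof.
have [/pred0P T0|] := boolP (pred0b (@predT T)).
  move: lam_sum1; rewrite big_pred0 => [/eqP|i]; first by rewrite eq_sym oner_eq0.
  exact: T0.
by move/pred0Pn => [i _]; exists i.
Qed.

(** Summing ln y <= y - 1 at y = x_i / (lam_i S) with weights lam_i gives it: the right-hand sides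
    add up to 0. *)
Lemma weighted_AMGM (x : T -> R) : (forall i, 0 < x i) ->
  \sum_i lam i * (ln (x i) - ln (lam i)) <= ln (\sum_i x i).
Proof.
move=> x0; set S := \sum_i x i.
have [i0 _] := block_nonempty.
have S0 : 0 < S.
  rewrite /S (bigD1 i0)//=; apply: ltr_pwDl => //.
  by apply: sumr_ge0 => i _; exact: ltW.
rewrite -subr_le0.
have -> : ln S = \sum_i lam i * ln S by rewrite -mulr_suml lam_sum1 mul1r.
rewrite -sumrB.
apply: (@le_trans _ _ (\sum_i (x i / S - lam i))); last first.
  by rewrite sumrB lam_sum1 -mulr_suml divff ?subrr// gt_eqF.
apply: ler_sum => i _.
have li := lam_gt0 i.
have -> : lam i * (ln (x i) - ln (lam i)) - lam i * ln S =
    lam i * ln (x i / lam i / S).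
  by rewrite !ln_div ?posrE ?divr_gt0//; ring.
apply: (@le_trans _ _ (lam i * (x i / lam i / S - 1))).
  by rewrite ler_pM2l// ln_le_subr1// !divr_gt0.
by rewrite le_eqVlt; apply/orP; left; apply/eqP; field; rewrite !gt_eqF.
Qed.

(** The component of a value in the direction [eta] is the sum of the positive numbers t_i cos(phi_i
    - eta), which weighted AM-GM bounds below by the right-hand side of the certificate. This bound
    grows with the level, so all higher levels are excluded as well. *)
Lemma certificate_not_attains l l' phi w1 w2 :
  certificate l phi w1 w2 -> l <= l' -> ~ attains l' phi w1 w2.
Proof.
move=> [eta [heta hlt]] ll' [t [[t0 tl] tw1 tw2]]; subst w1 w2.
move: hlt; rewrite !mulr_suml -big_split/=.
have c0 i : 0 < cos (phi i - eta) by exact: cos_gt0_norm.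
under eq_bigr => i _ do rewrite -!mulrA -mulrDr -cosB.
apply/negP; rewrite -leNgt.
have S0 : 0 < \sum_i t i * cos (phi i - eta).
  have [i0 _] := block_nonempty.
  rewrite (bigD1 i0)//=; apply: ltr_pwDl; first exact: mulr_gt0.
  by apply: sumr_ge0 => i _; apply/ltW/mulr_gt0.
rewrite -[leRHS]lnK ?posrE// ler_expR.
apply: le_trans (weighted_AMGM _) => [|i]; last exact: mulr_gt0.
apply: (@le_trans _ _ (l' + \sum_i lam i * (ln (cos (phi i - eta)) - ln (lam i)))).
  by rewrite lerD2r.
rewrite -tl -big_split/= le_eqVlt; apply/orP; left; apply/eqP.
apply: eq_bigr => i _; rewrite lnM ?posrE//; ring.
Qed.

Lemma mean_shift phi c : mean (fun i => phi i - c) = mean phi - c.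
Proof.
rewrite /mean; under eq_bigr => i _ do rewrite mulrBr.
by rewrite sumrB -mulr_suml lam_sum1 mul1r.
Qed.

Lemma mean_lt phi c d : (forall i, phi i - c < d) -> mean phi - c < d.
Proof.
move=> h; rewrite -mean_shift.
have -> : d = \sum_i lam i * d by rewrite -mulr_suml lam_sum1 mul1r.
have [i0 _] := block_nonempty.
rewrite /mean (bigD1 i0)//= [ltRHS](bigD1 i0)//=.
apply: ltr_leD; first by rewrite ltr_pM2l.
by apply: ler_sum => i _; rewrite ler_pM2l// ltW.
Qed.

Lemma mean_opp phi : mean (fun i => - phi i) = - mean phi.
Proof. by rewrite /mean -sumrN; apply: eq_bigr => i _; rewrite mulrN. Qed.

Lemma mean_norm_lt phi c d : (forall i, `|phi i - c| < d) -> `|mean phi - c| < d.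
Proof.
move=> h; rewrite ltr_norml; apply/andP; split; last first.
  by apply: mean_lt => i; have := h i; rewrite ltr_norml => /andP[].
rewrite ltrNl opprB addrC.
have := @mean_lt (fun i => - phi i) (- c) d.
rewrite mean_opp opprK; apply=> i.
by have := h i; rewrite ltr_norml; lra.
Qed.

Lemma contract_norm_lt phi c d s : 0 <= s <= 1 ->
  (forall i, `|phi i - c| < d) -> forall i, `|contract s phi i - c| < d.
Proof.
move=> /andP[s0 s1] h i; have hm := mean_norm_lt h; have hi := h i.
rewrite /contract.
have -> : (1 - s) * phi i + s * mean phi - c =
  (1 - s) * (phi i - c) + s * (mean phi - c) by ring.
move: hm hi; rewrite !ltr_norml => /andP[? ?] /andP[? ?].
by apply/andP; split; have [->|/eqP sn0] := eqVneq s 0; nra.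
Qed.

Lemma mean_contract s phi : mean (contract s phi) = mean phi.
Proof.
rewrite {1}/mean /contract; under eq_bigr => i _ do rewrite mulrDr mulrCA.
rewrite big_split/= -mulr_sumr -/(mean phi) -mulr_suml lam_sum1; ring.
Qed.

(* log cos is concave, so moving the phases towards their mean increases the
   weighted sum of log cos (phi_i - eta). *)
Lemma certificate_contract l phi w1 w2 s : 0 <= s <= 1 ->
  certificate l phi w1 w2 -> certificate l (contract s phi) w1 w2.
Proof.
move=> s01 [eta [heta hlt]]; exists eta.
have hc := contract_norm_lt s01 heta.
have hm := mean_norm_lt heta.
split=> //; apply: lt_le_trans hlt _.
rewrite ler_expR lerD2l -subr_ge0 -sumrB.
pose y i := phi i - eta; pose m := mean phi - eta.
have zE i : contract s phi i - eta = (1 - s) * y i + s * m.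
  by rewrite /contract /y /m; ring.
have m0 : \sum_i lam i * (y i - m) = 0.
  under eq_bigr => i _ do rewrite mulrBr.
  rewrite sumrB -mulr_suml lam_sum1 /y -/(mean (fun i => phi i - eta)).
  by rewrite mean_shift /m; ring.
(* This sum is 0, so a termwise comparison suffices. The tangent of log cos at z_i has slope - tan
   z_i, and tan z_i may be replaced by tan m because z_i - m and y_i - m do not have opposite
   signs. *)
apply: (@le_trans _ _ (s * tan m * \sum_i lam i * (y i - m))).
  by rewrite m0 mulr0.
rewrite mulr_sumr; apply: ler_sum => i _.
rewrite zE; set z := (1 - s) * y i + s * m.
have hz : `|z| < pi / 2 by rewrite /z -zE.
have := ln_cos_tangent hz (heta i); rewrite -/(y i) => ht.
have yz : y i - z = s * (y i - m) by rewrite /z; ring.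
have zm : z - m = (1 - s) * (y i - m) by rewrite /z; ring.
have tt : tan m * (y i - m) <= tan z * (y i - m).
  have [yl|yl] := leP m (y i).
    have := @tan_le _ m z hm hz; rewrite -(subr_ge0 m z) zm => h.
    by apply: ler_wpM2r; [lra|apply: h; nra].
  have := @tan_le _ z m hz hm; rewrite -(subr_le0 m z) zm => h.
  by apply: ler_wnM2r; [lra|apply: h; nra].
have li := lam_gt0 i.
move: ht; rewrite yz => ht.
have -> : s * tan m * (lam i * (y i - m)) = lam i * (s * (tan m * (y i - m))) by ring.
rewrite -mulrBr ler_pM2l//.
have : s * (tan m * (y i - m)) <= s * (tan z * (y i - m)) by apply: ler_wpM2l => //; lra.
lra.
Qed.

End Block.

(** * Critical points of weighted sums of logarithms of affine functions *)

Section Interlacing.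
Variables (R : realType) (T : finType) (lam : T -> R).
Hypothesis lam_gt0 : forall i, 0 < lam i.
Hypothesis lam_sum1 : \sum_i lam i = 1.
Implicit Types c s : T -> R.

Definition all_pos c s (tau : R) := forall i, 0 < c i + tau * s i.

(** The derivative in tau of sum lam_i ln(c_i + tau s_i), a concave function on the interval where
    [all_pos] holds. *)
Definition log_slope c s (tau : R) : R := \sum_i lam i * (s i / (c i + tau * s i)).

Lemma all_pos_convex c s x y z : all_pos c s x -> all_pos c s y ->
  x <= z <= y -> all_pos c s z.
Proof.
move=> hx hy /andP[xz zy] i; have := hx i; have := hy i.
by have [?|?] := leP 0 (s i); nra.
Qed.

(** The ends of the interval of positivity are zeros r_i and r_j of two factors. At distance lam_i d
    from the left end and d from the right end, the i-th term contributes 1/d, while the others, of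
    total weight 1 - lam_i, contribute at least -(1 - lam_i)/d. *)
Lemma log_slope_ge0 c s tau0 a b : all_pos c s tau0 -> 0 < s a -> s b < 0 ->
  exists2 tau, all_pos c s tau & 0 <= log_slope c s tau.
Proof.
move=> V0 sa0 sb0; pose r i := - c i / s i.
have [i ia imax] := @arg_maxP _ R T a (fun i => 0 < s i) r sa0.
have [j jb jmin] := @arg_minP _ R T b (fun i => s i < 0) r sb0.
have rE k : s k != 0 -> c k = - r k * s k by move=> sk; rewrite /r; field.
have ri0 : r i < tau0.
  by have := V0 i; rewrite (rE i) ?gt_eqF// => h; nra.
have rj0 : tau0 < r j.
  by have := V0 j; rewrite (rE j) ?lt_eqF// => h; nra.
have li := lam_gt0 i.
have li1 : lam i <= 1.
  by rewrite -lam_sum1 (bigD1 i)//= lerDl; apply: sumr_ge0 => k _; exact: ltW.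
pose tau := (r i + lam i * r j) / (1 + lam i).
have tauE1 : tau - r i = lam i * ((r j - r i) / (1 + lam i)) by rewrite /tau; field; lra.
have tauE2 : r j - tau = (r j - r i) / (1 + lam i) by rewrite /tau; field; lra.
set d := (r j - r i) / (1 + lam i) in tauE1 tauE2.
have d0 : 0 < d by apply: divr_gt0; lra.
have rit : r i < tau by rewrite -subr_gt0 tauE1 mulr_gt0.
have rjt : tau < r j by rewrite -subr_gt0 tauE2.
have V : all_pos c s tau.
  move=> k; have [sk|sk|sk] := ltgtP 0 (s k).
  - have rk : r k <= r i := imax k sk; rewrite (rE k) ?gt_eqF//.
    have -> : - r k * s k + tau * s k = (tau - r k) * s k by ring.
    by apply: mulr_gt0 => //; lra.
  - have rk := jmin k sk; rewrite (rE k) ?lt_eqF//.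
    have -> : - r k * s k + tau * s k = (r k - tau) * - s k by ring.
    by apply: mulr_gt0; lra.
  - by have := V0 k; rewrite -sk !mulr0.
exists tau => //.
have term k : - d^-1 <= s k / (c k + tau * s k).
  have [sk|sk] := leP 0 (s k).
    apply: (@le_trans _ _ 0); first by rewrite oppr_le0 invr_ge0 ltW.
    by apply: divr_ge0 => //; apply: ltW.
  have rk := jmin k sk.
  have -> : s k / (c k + tau * s k) = - (r k - tau)^-1.
    have -> : c k + tau * s k = - ((r k - tau) * s k) by rewrite {1}(rE k) ?lt_eqF//; ring.
    have n1 : r k - tau != 0 by rewrite gt_eqF//; lra.
    have n2 : s k != 0 by rewrite lt_eqF.
    by field; rewrite n1 n2.
  by rewrite lerN2 lef_pV2 ?posrE//; lra.
have ti : s i / (c i + tau * s i) = (lam i * d)^-1.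
  have -> : c i + tau * s i = (tau - r i) * s i by rewrite {1}(rE i) ?gt_eqF//; ring.
  have n1 : tau - r i != 0 by rewrite gt_eqF//; lra.
  have n2 : s i != 0 by rewrite gt_eqF.
  by rewrite -tauE1; field; rewrite n1 n2.
rewrite /log_slope (bigD1 i)//= ti.
have -> : lam i * (lam i * d)^-1 = d^-1 by field; rewrite !gt_eqF.
have : \sum_(k | k != i) lam k * - d^-1 <= \sum_(k | k != i) lam k * (s k / (c k + tau * s k)).
  by apply: ler_sum => k _; rewrite ler_pM2l.
rewrite -mulr_suml.
have -> : \sum_(k | k != i) lam k = 1 - lam i.
  by have := lam_sum1; rewrite (bigD1 i)//= => <-; rewrite addrAC subrr add0r.
have : 0 < d^-1 by rewrite invr_gt0.
nra.
Qed.

(** The reflection tau -> -tau reduces the right end of the interval to the left end. *)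
Lemma log_slopeN c s tau : log_slope c (fun i => - s i) (- tau) = - log_slope c s tau.
Proof.
by rewrite /log_slope -sumrN; apply: eq_bigr => i _; rewrite mulrNN mulNr mulrN.
Qed.

Lemma all_posN c s tau : all_pos c (fun i => - s i) (- tau) <-> all_pos c s tau.
Proof. by split=> h i; have := h i; rewrite mulrNN. Qed.

Lemma log_slope_continuous c s tau : all_pos c s tau ->
  {for tau, continuous (log_slope c s)}.
Proof.
move=> V; apply: cvg_big => [|i _]; first exact: add_continuous.
apply: cvgM; first exact: cvg_cst.
apply: cvgM; first exact: cvg_cst.
apply: cvgV; first by rewrite gt_eqF.
apply: cvgD; first exact: cvg_cst.
by apply: cvgM; [exact: cvg_id|exact: cvg_cst].
Qed.

Lemma log_slope_sign_change c s x y : all_pos c s x -> all_pos c s y ->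
  0 <= log_slope c s x -> log_slope c s y <= 0 ->
  exists2 z, all_pos c s z & log_slope c s z = 0.
Proof.
move=> Vx Vy Qx Qy.
have [xy|yx] := leP x y.
  have [| |z] := @IVT R (log_slope c s) x y 0 xy.
  - apply: continuous_in_subspaceT => z; rewrite inE/= in_itv/= => zxy.
    exact/log_slope_continuous/(all_pos_convex Vx Vy).
  - by rewrite ge_min le_max Qx Qy orbT.
  by rewrite in_itv/= => zxy Q0; exists z => //; exact: all_pos_convex Vx Vy _.
have [| |z] := @IVT R (log_slope c s) y x 0 (ltW yx).
- apply: continuous_in_subspaceT => z; rewrite inE/= in_itv/= => zxy.
  exact/log_slope_continuous/(all_pos_convex Vy Vx).
- by rewrite ge_min le_max Qx Qy orbT.
by rewrite in_itv/= => zxy Q0; exists z => //; exact: all_pos_convex Vy Vx _.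
Qed.

(** Moving tau to the right decreases no factor. The step is chosen so that the factor [a] exceeds
    exp((K - C) / lam_a), where C bounds the other terms from below. *)
Lemma log_sum_unbounded c s tau0 a K : all_pos c s tau0 -> 0 < s a ->
  (forall i, 0 <= s i) ->
  exists2 tau, all_pos c s tau & K < \sum_i lam i * ln (c i + tau * s i).
Proof.
move=> V0 sa s0.
pose C := \sum_(i | i != a) lam i * ln (c i + tau0 * s i).
pose tau := tau0 + expR ((K - C) / lam a) / s a.
have tt : tau0 <= tau by rewrite lerDl divr_ge0// expR_ge0.
have V : all_pos c s tau.
  by move=> i; apply: lt_le_trans (V0 i) _; rewrite lerD2l ler_wpM2r.
exists tau => //.
rewrite (bigD1 a)//=.
have hC : C <= \sum_(i | i != a) lam i * ln (c i + tau * s i).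
  apply: ler_sum => i _; rewrite ler_pM2l// ler_ln ?posrE//.
  by rewrite lerD2l ler_wpM2r.
have : (K - C) / lam a < ln (c a + tau * s a).
  rewrite -ltr_expR lnK ?posrE//.
  have -> : c a + tau * s a = (c a + tau0 * s a) + expR ((K - C) / lam a).
    by rewrite /tau; field; rewrite gt_eqF.
  by rewrite ltrDr.
rewrite ltr_pdivrMr// => h; lra.
Qed.

(** If the s_i take both signs, the slope is nonnegative near the left end and nonpositive near the
    right end, and the intermediate value theorem applies. If only one strict sign occurs, the sum
    is unbounded, against the hypothesis; if all s_i are 0, so is the slope. *)
Lemma log_slope_root c s tau0 K : all_pos c s tau0 ->
  (forall tau, all_pos c s tau -> \sum_i lam i * ln (c i + tau * s i) <= K) ->
  exists2 tau, all_pos c s tau & log_slope c s tau = 0.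
Proof.
move=> V0 bnd.
have VN : all_pos c (fun i => - s i) (- tau0) by exact/all_posN.
have [/existsP[a sa]|noP] := boolP [exists a, 0 < s a].
  have [/existsP[b sb]|noN] := boolP [exists b, s b < 0].
    have [x Vx Qx] := log_slope_ge0 V0 sa sb.
    have [||y' Vy' Qy'] := @log_slope_ge0 c (fun i => - s i) (- tau0) b a VN.
    - by rewrite oppr_gt0.
    - by rewrite oppr_lt0.
    apply: (@log_slope_sign_change c s x (- y')) => //.
      by apply/all_posN; rewrite opprK.
    by rewrite -oppr_ge0 -log_slopeN opprK.
  have s0 i : 0 <= s i by rewrite leNgt; apply: contra noN => h; apply/existsP; exists i.
  have [tau V h] := log_sum_unbounded K V0 sa s0.
  by have := bnd _ V; rewrite leNgt h.
have s0 i : 0 <= - s i.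
  by rewrite oppr_ge0 leNgt; apply: contra noP => h; apply/existsP; exists i.
have [/existsP[b sb]|noN] := boolP [exists b, s b < 0].
  have sb' : 0 < - s b by rewrite oppr_gt0.
  have [tau V h] := @log_sum_unbounded c (fun i => - s i) (- tau0) b K VN sb' s0.
  have V' : all_pos c s (- tau) by apply/all_posN; rewrite opprK.
  have := bnd _ V'; rewrite leNgt; under eq_bigr => i _ do rewrite mulNr -mulrN.
  by rewrite h.
exists tau0 => //; rewrite /log_slope big1// => i _.
suff -> : s i = 0 by rewrite mul0r mulr0.
apply/eqP; rewrite eq_le -oppr_ge0 s0/= leNgt.
by apply: contra noN => h; apply/existsP; exists i.
Qed.

End Interlacing.

(** * Duality between certificates and attained values *)

Section Duality.
Variables (R : realType) (T : finType) (lam : T -> R).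
Hypothesis lam_gt0 : forall i, 0 < lam i.
Hypothesis lam_sum1 : \sum_i lam i = 1.

(** A positive cosine locates an angle only modulo 2 pi; the bound 3 pi / 2 discards all arcs but
    the central one. *)
Lemma cos_gt0_norm_lt (z : R) : `|z| < 3 * (pi / 2) -> 0 < cos z -> `|z| < pi / 2.
Proof.
rewrite -(cos_norm z); set x := `|z| => h c0; rewrite ltNge; apply/negP => hx.
have : 0 <= cos (x - pi) by apply: cos_ge0_pihalf; move: h hx; lra.
by rewrite cosB cospi sinpi; lra.
Qed.

(** The argument is e + atan(B / A), where A and B are the components of w along and across the
    direction [e]; since A > 0 it is within pi/2 of [e]. *)
Lemma polar_near (w1 w2 e : R) : 0 < w1 * cos e + w2 * sin e ->
  exists rho psi, [/\ 0 < rho, `|e - psi| < pi / 2, w1 = rho * cos psi & w2 = rho * sin psi].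
Proof.
set A := _ + _ => A0; pose B := w2 * cos e - w1 * sin e.
pose a := atan (B / A).
have ha : `|a| < pi / 2 by rewrite ltr_norml atan_gtNpi2 atan_ltpi2.
have ca := cos_gt0_norm ha.
have tB : B = A * (sin a / cos a).
  by rewrite -[_ / _]/(tan a) atanK; field; rewrite gt_eqF.
exists (A / cos a), (e + a); split.
- exact: divr_gt0.
- by rewrite opprD addrA subrr add0r normrN.
- rewrite cosD.
  have -> : A / cos a * (cos e * cos a - sin e * sin a) = A * cos e - (A * (sin a / cos a)) * sin e.
    by field; rewrite gt_eqF.
  rewrite -tB /A /B.
  have -> : (w1 * cos e + w2 * sin e) * cos e - (w2 * cos e - w1 * sin e) * sin e =
    w1 * (cos e ^+ 2 + sin e ^+ 2) by ring.
  by rewrite cos2Dsin2 mulr1.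
- rewrite sinD.
  have -> : A / cos a * (sin e * cos a + cos e * sin a) = A * sin e + (A * (sin a / cos a)) * cos e.
    by field; rewrite gt_eqF.
  rewrite -tB /A /B.
  have -> : (w1 * cos e + w2 * sin e) * sin e + (w2 * cos e - w1 * sin e) * cos e =
    w2 * (cos e ^+ 2 + sin e ^+ 2) by ring.
  by rewrite cos2Dsin2 mulr1.
Qed.

(* The minimum over eta in the certificate inequality is reached where
   sum lam_i sin(phi_i - psi) / cos(phi_i - eta) = 0, psi = arg w, and there
   t_i = lam_i |w| cos(psi - eta) / cos(phi_i - eta) represents w. *)
Lemma certificate_or_attains l phi w1 w2 eta0 :
  (forall i, `|phi i - eta0| < pi / 2) -> ~ certificate lam l phi w1 w2 ->
  exists2 l', l <= l' & attains lam l' phi w1 w2.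
Proof.
move=> h0 nc.
(* Otherwise [eta0] itself gives a certificate, the exponential being positive. *)
have A0 : 0 < w1 * cos eta0 + w2 * sin eta0.
  rewrite ltNge; apply/negP => hle; apply: nc; exists eta0; split=> //.
  by apply: le_lt_trans hle _; exact: expR_gt0.
have [rho [psi [rho0 he0 w1E w2E]]] := polar_near A0.
subst w1 w2.
pose c i := cos (phi i - psi); pose s i := sin (phi i - psi).
have cosE e i : `|e| < pi / 2 ->
    cos (phi i - (psi + e)) = cos e * (c i + tan e * s i).
  move=> /cos_gt0_norm ce; rewrite opprD addrA cosB /c /s /tan.
  by field; rewrite gt_eqF.
have V0 : all_pos c s (tan (eta0 - psi)).
  move=> i; have := cos_gt0_norm (h0 i).
  have -> : phi i - eta0 = phi i - (psi + (eta0 - psi)) by ring.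
  by rewrite cosE// pmulr_rgt0 ?cos_gt0_norm.
pose S tau := l + \sum_i lam i * (ln (c i + tau * s i) - ln (lam i)).
(* For eta = psi + atan tau the factor cos(eta - psi) occurs on both sides of the certificate and
   cancels, so the absence of certificates bounds a concave function of tau. *)
have nocert tau : all_pos c s tau -> S tau <= ln rho.
  move=> V; pose e := atan tau.
  have he : `|e| < pi / 2 by rewrite ltr_norml atan_gtNpi2 atan_ltpi2.
  have ce := cos_gt0_norm he.
  rewrite -ler_expR lnK ?posrE// leNgt; apply/negP => hlt; apply: nc.
  exists (psi + e).
  have cE i : cos (phi i - (psi + e)) = cos e * (c i + tau * s i).
    by rewrite cosE// /e atanK.
  split.
    move=> i; apply: cos_gt0_norm_lt; last by rewrite cE; apply: mulr_gt0.
    have -> : phi i - (psi + e) = (phi i - eta0) + (eta0 - psi) + - e by ring.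
    apply: le_lt_trans (ler_normD _ _) _; rewrite normrN.
    have := ler_normD (phi i - eta0) (eta0 - psi); have := h0 i; lra.
  have -> : rho * cos psi * cos (psi + e) + rho * sin psi * sin (psi + e) = cos e * rho.
    have -> : cos e = cos ((psi + e) - psi) by congr cos; ring.
    by rewrite cosB; ring.
  have -> : l + \sum_i lam i * (ln (cos (phi i - (psi + e))) - ln (lam i)) = ln (cos e) + S tau.
    rewrite /S addrCA; congr (_ + _).
    have -> : ln (cos e) = \sum_i lam i * ln (cos e) by rewrite -mulr_suml lam_sum1 mul1r.
    rewrite -big_split/=; apply: eq_bigr => i _.
    by rewrite cE lnM ?posrE//; ring.
  by rewrite expRD lnK ?posrE// ltr_pM2l.
have [|tau V Q0] := @log_slope_root _ _ lam lam_gt0 lam_sum1 c s _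
    (ln rho - l + \sum_i lam i * ln (lam i)) V0.
  move=> tau V; have := nocert tau V; rewrite /S.
  by under eq_bigr => i _ do rewrite mulrBr; rewrite sumrB; lra.
pose D i := c i + tau * s i.
have D0 i : 0 < D i := V i.
exists (\sum_i lam i * ln (lam i * rho / D i)).
  have := nocert tau V; rewrite /S => h.
  have -> : \sum_i lam i * ln (lam i * rho / D i) =
      ln rho - \sum_i lam i * (ln (D i) - ln (lam i)).
    have -> : ln rho = \sum_i lam i * ln rho by rewrite -mulr_suml lam_sum1 mul1r.
    rewrite -sumrB; apply: eq_bigr => i _.
    by rewrite ln_div ?posrE ?mulr_gt0// lnM ?posrE//; ring.
  by rewrite -subr_ge0; move: h; rewrite -/(D _); lra.
exists (fun i => lam i * rho / D i).
(* At the critical tau the vector sum of the t_i e^(i phi_i) has component 0 across the direction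
   psi and rho along it. *)
have Q1 : \sum_i lam i * rho / D i * s i = 0.
  transitivity (rho * log_slope lam c s tau); last by rewrite Q0 mulr0.
  by rewrite mulr_sumr; apply: eq_bigr => i _; rewrite -/(D i); ring.
have Q2 : \sum_i lam i * rho / D i * c i = rho.
  transitivity (\sum_i (lam i * rho - tau * (lam i * rho / D i * s i))).
    by apply: eq_bigr => i _; rewrite /D; field; rewrite gt_eqF.
  by rewrite sumrB -mulr_sumr Q1 mulr0 subr0 -mulr_suml lam_sum1 mul1r.
have phiE i : phi i = (phi i - psi) + psi by ring.
split; first by split=> // i; apply: divr_gt0 => //; exact: mulr_gt0.
- under eq_bigr => i _ do rewrite (phiE i) cosD mulrBr !mulrA.
  by rewrite sumrB -!mulr_suml Q1 Q2 mul0r subr0.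
- under eq_bigr => i _ do rewrite (phiE i) sinD mulrDr !mulrA.
  by rewrite big_split/= -!mulr_suml Q1 Q2 mul0r add0r.
Qed.

End Duality.

(** * Relations among the phasors of a block *)

Section Filling.
Variables (R : realType) (T : finType) (lam : T -> R).
Hypothesis lam_gt0 : forall i, 0 < lam i.
Hypothesis lam_sum1 : \sum_i lam i = 1.

(* Along a relation tau among the phasors the value is constant, and the product
   of the moduli tends to 0 as the first modulus vanishes. *)
Lemma attains_neg_direction l l' phi w1 w2 (tau : T -> R) i0 :
  l <= l' -> attains lam l' phi w1 w2 -> tau i0 < 0 ->
  \sum_i tau i * cos (phi i) = 0 -> \sum_i tau i * sin (phi i) = 0 ->
  attains lam l phi w1 w2.
Proof.
move=> ll' [t [[t0 tl'] tw1 tw2]] tau0 tc ts.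
(* The smallest of these quotients, [x1], is the first time at which a modulus t_i + x tau_i
   vanishes. *)
pose r i := t i / - tau i.
have [i ti imin] := @arg_minP _ R T i0 (fun i => tau i < 0) r tau0.
set x1 := r i in imin.
have x10 : 0 < x1 by apply: divr_gt0; rewrite ?oppr_gt0.
have pos x j : 0 <= x -> x < x1 -> 0 < t j + x * tau j.
  move=> x0 xx1; have [tj|tj] := leP 0 (tau j).
    by apply: ltr_pwDl => //; exact: mulr_ge0.
  have : x1 <= r j := imin j tj.
  have -> : t j = r j * - tau j by rewrite /r; field; rewrite lt_eqF.
  by nra.
pose M j := t j + x1 * `|tau j|.
pose C := \sum_(j | j != i) lam j * ln (M j).
(* At time x1 - dlt the i-th modulus is at most exp((l - C) / lam_i) and the other terms contribute
   at most C, so the level has dropped to [l] or below; the intermediate value theorem then yields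
   level exactly [l]. *)
pose dlt := Num.min x1 (expR ((l - C) / lam i) / - tau i).
have d0 : 0 < dlt by rewrite lt_min x10 divr_gt0 ?expR_gt0 ?oppr_gt0.
have dx1 : dlt <= x1 by rewrite ge_min lexx.
pose x := x1 - dlt.
have x0 : 0 <= x by rewrite subr_ge0.
have xx1 : x < x1 by rewrite ltrBlDr ltrDl.
pose L y := \sum_j lam j * ln (t j + y * tau j).
have L0 : L 0 = l'.
  by rewrite -tl'; apply: eq_bigr => j _; rewrite mul0r addr0.
have Lx : L x <= l.
  rewrite /L (bigD1 i)//=.
  have hC : \sum_(j | j != i) lam j * ln (t j + x * tau j) <= C.
    apply: ler_sum => j _; rewrite ler_pM2l// ler_ln ?posrE ?pos//.
      rewrite lerD2l; apply: (@le_trans _ _ (x * `|tau j|)).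
        by rewrite ler_wpM2l// ler_norm.
      by rewrite ler_wpM2r// ltW.
    by apply: ltr_pwDl => //; rewrite mulr_ge0// ltW.
  have hi : t i + x * tau i = dlt * - tau i.
    rewrite /x; have -> : t i = x1 * - tau i by rewrite /x1 /r; field; rewrite lt_eqF.
    ring.
  have : ln (t i + x * tau i) <= (l - C) / lam i.
    rewrite hi -ler_expR lnK ?posrE ?mulr_gt0 ?oppr_gt0//.
    by rewrite -ler_pdivlMr ?oppr_gt0// ge_min lexx orbT.
  by rewrite ler_pdivlMr//; lra.
have [| |y] := @IVT R L 0 x l x0.
- apply: continuous_in_subspaceT => z; rewrite inE/= in_itv/= => /andP[z0 zx].
  apply: cvg_big => [|j _]; first exact: add_continuous.
  apply: cvgM; first exact: cvg_cst.
  have zj := pos z j z0 (le_lt_trans zx xx1).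
  apply: cvg_ln => //; apply: cvgD; first exact: cvg_cst.
  by apply: cvgM; [exact: cvg_id|exact: cvg_cst].
- by rewrite ge_min le_max Lx L0 ll' orbT.
rewrite in_itv/= => /andP[y0 yx] Ly.
have yx1 := le_lt_trans yx xx1.
exists (fun j => t j + y * tau j); split.
- by split=> // j; exact: pos.
- under eq_bigr => j _ do rewrite mulrDl -mulrA.
  by rewrite big_split/= -mulr_sumr tc mulr0 addr0.
- under eq_bigr => j _ do rewrite mulrDl -mulrA.
  by rewrite big_split/= -mulr_sumr ts mulr0 addr0.
Qed.

(** A relation may be negated, so any nonzero coefficient provides a direction in which some modulus
    decreases. *)
Lemma attains_fill l l' phi w1 w2 (tau : T -> R) i0 :
  l <= l' -> attains lam l' phi w1 w2 -> tau i0 != 0 ->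
  \sum_i tau i * cos (phi i) = 0 -> \sum_i tau i * sin (phi i) = 0 ->
  attains lam l phi w1 w2.
Proof.
move=> ll' h tau0 tc ts.
have [tn|tp] := ltP (tau i0) 0; first exact: (attains_neg_direction ll' h tn).
apply: (@attains_neg_direction l l' phi w1 w2 (fun i => - tau i) i0 ll' h).
- by rewrite oppr_lt0 lt_neqAle eq_sym tau0.
- by under eq_bigr => j _ do rewrite mulNr; rewrite sumrN tc oppr0.
- by under eq_bigr => j _ do rewrite mulNr; rewrite sumrN ts oppr0.
Qed.

(** More than two vectors in the plane are linearly dependent: the matrix of their coordinates has a
    nonzero left kernel. *)
Lemma phasor_relation (phi : T -> R) : (2 < #|T|)%N ->
  exists tau : T -> R, exists i, [/\ tau i != 0,
    \sum_i tau i * cos (phi i) = 0 & \sum_i tau i * sin (phi i) = 0].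
Proof.
move=> T3.
pose M : 'M[R]_(#|T|, 2) := \matrix_(i, j)
  if j == 0 then cos (phi (enum_val i)) else sin (phi (enum_val i)).
have K0 : kermx M != 0.
  rewrite -mxrank_eq0 mxrank_ker subn_eq0 -ltnNge.
  by apply: leq_ltn_trans T3; exact: rank_leq_col.
have /rowV0Pn[v /sub_kermxP vM v0] := K0.
have sumE j : \sum_x v 0 (enum_rank x) * M (enum_rank x) j = 0.
  have /matrixP/(_ 0 j) := vM; rewrite mxE mxE => e; rewrite -[RHS]e.
  by rewrite [RHS](reindex (@enum_rank T))//; exact: onW_bij (@enum_rank_bij T).
have /rV0Pn[k vk] := v0.
exists (fun x => v 0 (enum_rank x)), (enum_val k); split.
- by rewrite enum_valK.
- rewrite -[RHS](sumE 0); apply: eq_bigr => x _; rewrite !mxE/= enum_rankK//.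
- rewrite -[RHS](sumE 1); apply: eq_bigr => x _; rewrite !mxE/= enum_rankK//.
Qed.

Lemma sum_at (i : T) (a : R) (g : T -> R) : \sum_x ((x == i)%:R * a) * g x = a * g i.
Proof.
rewrite (bigD1 i)//= eqxx mul1r big1 ?addr0// => x /negPf ->.
by rewrite !mul0r.
Qed.

(** Moduli of at least e^l have level at least [l], as the weights add up to 1; the relation then
    lowers the level without moving the value. *)
Lemma attains_of_large l phi w1 w2 (t tau : T -> R) i0 :
  (forall i, expR l <= t i) ->
  \sum_i t i * cos (phi i) = w1 -> \sum_i t i * sin (phi i) = w2 ->
  tau i0 != 0 ->
  \sum_i tau i * cos (phi i) = 0 -> \sum_i tau i * sin (phi i) = 0 ->
  attains lam l phi w1 w2.
Proof.
move=> tl tw1 tw2 tau0 tc ts.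
have t0 i : 0 < t i by apply: lt_le_trans (tl i); exact: expR_gt0.
apply: (@attains_fill l (\sum_i lam i * ln (t i)) _ _ _ tau i0) => //.
  have {1}-> : l = \sum_i lam i * l by rewrite -mulr_suml lam_sum1 mul1r.
  apply: ler_sum => i _; rewrite ler_pM2l// -ler_expR lnK ?posrE//.
by exists t; split.
Qed.

(** The three phasors satisfy the relation with the positive coefficients [sgi], [sgj], [sgk], hence
    they span the plane by nonnegative combinations. *)
Lemma attains_everything l phi i j k w1 w2 :
  0 < sin (phi j - phi i) -> 0 < sin (phi k - phi j) -> 0 < sin (phi i - phi k) ->
  attains lam l phi w1 w2.
Proof.
rewrite !sinB => s1 s2 s3.
set ci := cos (phi i) in s1 s2 s3; set si := sin (phi i) in s1 s2 s3.
set cj := cos (phi j) in s1 s2 s3; set sj := sin (phi j) in s1 s2 s3.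
set ck := cos (phi k) in s1 s2 s3; set sk := sin (phi k) in s1 s2 s3.
set sgk := sj * ci - cj * si in s1.
set sgi := sk * cj - ck * sj in s2.
set sgj := si * ck - ci * sk in s3.
(* Every modulus starts from e^l. The remainder (v1, v2) is expanded in the phasors i and j by
   Cramer's rule, and [Q] times the positive relation makes its coefficients nonnegative. *)
pose E := expR l.
pose v1 := w1 - E * \sum_x cos (phi x); pose v2 := w2 - E * \sum_x sin (phi x).
pose a := (v1 * sj - v2 * cj) / sgk; pose b := (ci * v2 - si * v1) / sgk.
pose Q := `|a| / sgi + `|b| / sgj.
have Q0 : 0 <= Q by rewrite addr_ge0// divr_ge0// ltW.
pose A := a + Q * sgi; pose B := b + Q * sgj; pose C := Q * sgk.
have A0 : 0 <= A.
  have : `|a| <= Q * sgi.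
    by rewrite -ler_pdivrMr// lerDl divr_ge0// ltW.
  have := ler_norm (- a); rewrite normrN /A; lra.
have B0 : 0 <= B.
  have : `|b| <= Q * sgj.
    by rewrite -ler_pdivrMr// lerDr divr_ge0// ltW.
  have := ler_norm (- b); rewrite normrN /B; lra.
have C0 : 0 <= C by rewrite mulr_ge0// ltW.
pose comb x y z (u : T) : R := (u == i)%:R * x + (u == j)%:R * y + (u == k)%:R * z.
have combE x y z g : \sum_u comb x y z u * g u = x * g i + y * g j + z * g k.
  under eq_bigr => u _ do rewrite /comb !mulrDl.
  by rewrite !big_split/= !sum_at.
apply: (@attains_of_large l phi w1 w2 (fun u => E + comb A B C u) (comb sgi sgj sgk) i).
- by move=> u; rewrite lerDl !addr_ge0// mulr_ge0.
- under eq_bigr => u _ do rewrite mulrDl.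
  rewrite big_split/= -mulr_sumr combE -/ci -/cj -/ck.
  have -> : A * ci + B * cj + C * ck = v1.
    rewrite /A /B /C /a /b /sgi /sgj.
    transitivity (((v1 * sj - v2 * cj) * ci + (ci * v2 - si * v1) * cj) / sgk
       + Q * (ci * (sk * cj - ck * sj) + cj * (si * ck - ci * sk) + ck * sgk)).
      ring.
    have -> : (v1 * sj - v2 * cj) * ci + (ci * v2 - si * v1) * cj = v1 * sgk.
      by rewrite /sgk; ring.
    rewrite mulfK ?gt_eqF// /sgk; ring.
  by rewrite /v1; ring.
- under eq_bigr => u _ do rewrite mulrDl.
  rewrite big_split/= -mulr_sumr combE -/si -/sj -/sk.
  have -> : A * si + B * sj + C * sk = v2.
    rewrite /A /B /C /a /b /sgi /sgj.
    transitivity (((v1 * sj - v2 * cj) * si + (ci * v2 - si * v1) * sj) / sgk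
       + Q * (si * (sk * cj - ck * sj) + sj * (si * ck - ci * sk) + sk * sgk)).
      ring.
    have -> : (v1 * sj - v2 * cj) * si + (ci * v2 - si * v1) * sj = v2 * sgk.
      by rewrite /sgk; ring.
    rewrite mulfK ?gt_eqF// /sgk; ring.
  by rewrite /v2; ring.
- rewrite gt_eqF// /comb eqxx mul1r -addrA; apply: ltr_pwDl => //.
  by rewrite addr_ge0// mulr_ge0// ltW.
- by rewrite combE /sgi /sgj /sgk -/ci -/cj -/ck; ring.
- by rewrite combE /sgi /sgj /sgk -/si -/sj -/sk; ring.
Qed.

Lemma spread_center (phi : T -> R) : (forall i j, `|phi i - phi j| < pi) ->
  exists eta, forall i, `|phi i - eta| < pi / 2.
Proof.
move=> h; have [i0 _] := block_nonempty lam_sum1.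
have [a _ amax] := @arg_maxP _ R T i0 predT phi isT.
have [b _ bmin] := @arg_minP _ R T i0 predT phi isT.
exists ((phi a + phi b) / 2) => i.
have : phi i <= phi a := amax i isT.
have : phi b <= phi i := bmin i isT.
have := h a b; rewrite !ltr_norml => /andP[_ ?] ? ?.
by apply/andP; split; lra.
Qed.

End Filling.

Section Lifts.
Variables (R : realType) (T : finType) (lam : T -> R).

Definition turn (k : T -> int) (phi : T -> R) : T -> R :=
  fun i => phi i + (k i)%:~R * (2 * pi).

Lemma attains_turn l phi k w1 w2 :
  attains lam l (turn k phi) w1 w2 <-> attains lam l phi w1 w2.
Proof.
split=> -[t [mt tc ts]]; exists t; split=> //.
- by rewrite -tc; apply: eq_bigr => i _; rewrite cosD_turn.
- by rewrite -ts; apply: eq_bigr => i _; rewrite sinD_turn.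
- by rewrite -tc; apply: eq_bigr => i _; rewrite cosD_turn.
- by rewrite -ts; apply: eq_bigr => i _; rewrite sinD_turn.
Qed.

Lemma turnK k phi : turn (fun i => - k i) (turn k phi) = phi.
Proof. by apply/funext => i; rewrite /turn mulrNz mulNr addrK. Qed.

End Lifts.

(** * Blocks with two terms *)

Section TwoPoints.
Variables (R : realType) (T : finType) (lam : T -> R).
Hypothesis lam_gt0 : forall i, 0 < lam i.
Hypothesis lam_sum1 : \sum_i lam i = 1.
Hypothesis card2 : #|T| = 2%N.

Lemma two_points : exists i j : T, i != j.
Proof.
have /card_gt1P[i [j [_ _ ij]]] : (1 < #|T|)%N by rewrite card2.
by exists i, j.
Qed.

Lemma two_pointsE (i j x : T) : i != j -> x = i \/ x = j.
Proof.
move=> ij; have := cards2 i j; rewrite ij => c2.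
have : ([set i; j] = [set: T])%SET by apply/eqP; rewrite eqEcard finset.subsetT cardsT card2 c2.
by move/setP/(_ x); rewrite !inE => /orP[/eqP|/eqP]; [left|right].
Qed.

Lemma sum_two (g : T -> R) i j : i != j -> \sum_x g x = g i + g j.
Proof.
move=> ij; rewrite (bigD1 i)//= (bigD1 j)/=; last by rewrite eq_sym.
rewrite big1 ?addr0// => x /andP[xi xj].
by have [xE|xE] := two_pointsE x ij; rewrite xE eqxx in xi xj.
Qed.

Lemma lam_two i j : i != j -> lam j = 1 - lam i.
Proof. by move=> ij; rewrite -lam_sum1 (sum_two _ ij) addrAC subrr add0r. Qed.

(* The second way for w to avoid the curve {sum t_k e^{i phi_k}} of a
   two-term block: w lies beyond the curve, seen from the origin, and the
   lifts phi_i, phi_j of the two phases are pi or more apart. *)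
Definition beyond (l : R) (phi : T -> R) (w1 w2 : R) (i j : T) : Prop :=
  let X := w1 * sin (phi i) - w2 * cos (phi i) in
  let Y := w2 * cos (phi j) - w1 * sin (phi j) in
  [/\ i != j, 0 < phi j - phi i < 2 * pi, 0 < X, 0 < Y &
    0 < expR (lam i * ln Y + lam j * ln X) + expR l * sin (phi j - phi i)].

(** [beyond] consists of strict inequalities without division by the sine, so it stays open where
    the lifts are exactly pi apart. For differences below pi it implies [certificate], by
    [beyond_midpoint]. *)
Definition lifted2 (l : R) (phi : T -> R) (w1 w2 : R) : Prop :=
  certificate lam l phi w1 w2 \/ exists i j, beyond l phi w1 w2 i j.

(** Cramer's rule: the cross products of w with the two phasors, which are the X and Y of [beyond],
    are the moduli up to the factor - sin(phi_j - phi_i). *)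
Lemma attains_two l phi w1 w2 i j : i != j -> attains lam l phi w1 w2 ->
  exists ti tj, [/\ 0 < ti, 0 < tj, lam i * ln ti + lam j * ln tj = l,
    w1 * sin (phi i) - w2 * cos (phi i) = - (tj * sin (phi j - phi i)) &
    w2 * cos (phi j) - w1 * sin (phi j) = - (ti * sin (phi j - phi i))].
Proof.
move=> ij [t [[t0 tl] tc ts]]; exists (t i), (t j).
rewrite !(sum_two _ ij) in tl tc ts.
by split=> //; rewrite -tc -ts sinB; ring.
Qed.

Lemma attains_two_of l phi w1 w2 i j ti tj : i != j -> 0 < ti -> 0 < tj ->
  lam i * ln ti + lam j * ln tj = l ->
  w1 = ti * cos (phi i) + tj * cos (phi j) ->
  w2 = ti * sin (phi i) + tj * sin (phi j) ->
  attains lam l phi w1 w2.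
Proof.
move=> ij ti0 tj0 tl -> ->.
exists (fun x => if x == i then ti else tj); have ji : (j == i) = false.
  by rewrite eq_sym; apply/negbTE.
split; first split.
- by move=> x; case: ifP.
- by rewrite (sum_two _ ij) eqxx ji.
- by rewrite (sum_two _ ij) eqxx ji.
- by rewrite (sum_two _ ij) eqxx ji.
Qed.

(** The moduli are Y and X divided by - sin(phi_j - phi_i), and this divisor enters the level with
    total weight 1. For a negative sine, the last inequality of [beyond] says that the level found
    here exceeds [l]. *)
Lemma beyond_attains phi w1 w2 i j : i != j ->
  let X := w1 * sin (phi i) - w2 * cos (phi i) in
  let Y := w2 * cos (phi j) - w1 * sin (phi j) in
  sin (phi j - phi i) < 0 -> 0 < X -> 0 < Y ->
  attains lam (lam i * ln Y + lam j * ln X - ln (- sin (phi j - phi i))) phi w1 w2.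
Proof.
move=> ij X Y sg X0 Y0.
set sg' := - sin _; have s0 : 0 < sg' by rewrite oppr_gt0.
have sE : sg' = cos (phi j) * sin (phi i) - sin (phi j) * cos (phi i).
  by rewrite /sg' sinB; ring.
apply: (@attains_two_of _ _ _ _ i j (Y / sg') (X / sg')) => //.
- exact: divr_gt0.
- exact: divr_gt0.
- rewrite !ln_div ?posrE//.
  by rewrite (lam_two ij); ring.
- have -> : Y / sg' * cos (phi i) + X / sg' * cos (phi j) = w1 * sg' / sg'.
    by rewrite {3}sE /X /Y; field; rewrite gt_eqF.
  by rewrite mulfK ?gt_eqF.
- have -> : Y / sg' * sin (phi i) + X / sg' * sin (phi j) = w2 * sg' / sg'.
    by rewrite {3}sE /X /Y; field; rewrite gt_eqF.
  by rewrite mulfK ?gt_eqF.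
Qed.

(** If w were attained, X > 0 would force a negative sine, and the last expression of [beyond] would
    be exactly 0. *)
Lemma lifted2_not_attains l phi w1 w2 : lifted2 l phi w1 w2 -> ~ attains lam l phi w1 w2.
Proof.
move=> [h|[i [j [ij dij X0 Y0 E0]]]] ha.
  exact: (certificate_not_attains lam_gt0 lam_sum1 h (lexx l) ha).
have [ti [tj [ti0 tj0 tl XE YE]]] := attains_two ij ha.
move: X0 Y0 E0; rewrite {}XE {}YE.
set sg := sin _ => X0 Y0; apply/negP; rewrite -leNgt.
have sg0 : 0 < - sg by rewrite -(pmulr_rgt0 _ tj0) mulrN.
rewrite -!mulrN !lnM ?posrE//.
have -> : lam i * (ln ti + ln (- sg)) + lam j * (ln tj + ln (- sg)) = l + ln (- sg).
  by rewrite -tl (lam_two ij); ring.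
by rewrite expRD lnK ?posrE// -mulrDr addNr mulr0.
Qed.

Lemma lifted2_turn l phi w1 w2 (c : int) :
  lifted2 l (turn (fun=> c) phi) w1 w2 -> lifted2 l phi w1 w2.
Proof.
case=> [[eta [h1 h2]]|[i [j]]].
  left; exists (eta - c%:~R * (2 * pi)).
  have phE i : phi i - (eta - c%:~R * (2 * pi)) = turn (fun=> c) phi i - eta.
    by rewrite /turn; ring.
  split; first by move=> i; rewrite phE.
  under eq_bigr => i _ do rewrite phE.
  by rewrite -mulNr -mulrNz cosD_turn sinD_turn.
rewrite /beyond /turn !cosD_turn !sinD_turn.
have -> : phi j + c%:~R * (2 * pi) - (phi i + c%:~R * (2 * pi)) = phi j - phi i by ring.
by move=> h; right; exists i, j.
Qed.

Lemma certificate_of_attains_not_above l phi w1 w2 i j :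
  `|phi j - phi i| < pi -> i != j -> ~ attains lam l phi w1 w2 ->
  certificate lam l phi w1 w2 \/
  exists2 l', l < l' & attains lam l' phi w1 w2.
Proof.
move=> hd ij na.
have [eta heta] : exists eta, forall x, `|phi x - eta| < pi / 2.
  apply: (spread_center lam_sum1) => x y.
  have [->|->] := two_pointsE x ij; have [->|->] := two_pointsE y ij;
    by rewrite ?subrr ?normr0 ?pi_gt0// distrC.
have [hc|hc] := pselect (certificate lam l phi w1 w2); first by left.
right; have [l' ll' h'] := certificate_or_attains lam_gt0 lam_sum1 heta hc.
exists l' => //; rewrite lt_neqAle ll' andbT; apply/eqP => lE.
by apply: na; rewrite lE.
Qed.

Lemma beyond_of_attains l l' phi w1 w2 i j : i != j -> l < l' ->
  attains lam l' phi w1 w2 -> 0 < phi j - phi i < 2 * pi ->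
  sin (phi j - phi i) < 0 -> beyond l phi w1 w2 i j.
Proof.
move=> ij ll' ha dij sg.
have [ti [tj [ti0 tj0 tl XE YE]]] := attains_two ij ha.
have s0 : 0 < - sin (phi j - phi i) by rewrite oppr_gt0.
split=> //.
- by rewrite XE -mulrN mulr_gt0.
- by rewrite YE -mulrN mulr_gt0.
have [sg' sE] : exists sg', sin (phi j - phi i) = - sg'.
  by exists (- sin (phi j - phi i)); rewrite opprK.
move: s0; rewrite XE YE sE !mulrN !opprK => s0; rewrite !lnM ?posrE//.
have -> : lam i * (ln ti + ln sg') + lam j * (ln tj + ln sg') = l' + ln sg'.
  by rewrite -tl (lam_two ij); ring.
by rewrite expRD lnK ?posrE// subr_gt0 ltr_pM2r// ltr_expR.
Qed.

Definition at_point (i : T) (c : int) : T -> int := fun x => if x == i then c else 0.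

Lemma turn_at_point phi i c : turn (at_point i c) phi i = phi i + c%:~R * (2 * pi) :> R.
Proof. by rewrite /turn /at_point eqxx. Qed.

Lemma turn_at_other phi i j c : i != j -> turn (at_point i c) phi j = phi j :> R.
Proof. by rewrite eq_sym /turn /at_point => /negbTE ->; rewrite mul0r addr0. Qed.

Lemma turnD k k' (phi : T -> R) : turn k (turn k' phi) = turn (fun i => k' i + k i) phi.
Proof. by apply/funext => i; rewrite /turn intrD; ring. Qed.

(** The difference of the phases is first brought into (-pi, pi]. Strictly inside, either the
    half-plane inequality holds or w has a higher level, and a turn of one phase by 2 pi then gives
    [beyond]. At pi the values fill a line, and the sign of X tells the side of w. *)
Lemma lifted2_exists l phi w1 w2 : ~ attains lam l phi w1 w2 ->
  exists k, lifted2 l (turn k phi) w1 w2.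
Proof.
have [i [j ij]] := two_points.
have ji : j != i by rewrite eq_sym.
suff main phi' : - pi < phi' j - phi' i <= pi -> ~ attains lam l phi' w1 w2 ->
    exists k, lifted2 l (turn k phi') w1 w2.
  move=> na; have [c hc] := exists_turn (phi j - phi i).
  have [||k hk] := main (turn (at_point j c) phi).
  - by rewrite turn_at_point turn_at_other//; move: hc; rewrite addrAC.
  - by move/attains_turn.
  by move: hk; rewrite turnD; exists (fun x => at_point j c x + k x).
move=> {phi}; set phi := phi' => hd na.
have p0 := pi_gt0 R.
have [dpi|dpi] := eqVneq (phi j - phi i) pi; last first.
  have {}hd : `|phi j - phi i| < pi.
    move: hd => /andP[h1]; rewrite le_eqVlt (negbTE dpi)/= => h2.
    by rewrite ltr_norml h1.
  have [hc|[l' ll' ha]] := certificate_of_attains_not_above hd ij na.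
    by exists (fun=> 0); left; rewrite (_ : turn _ _ = phi)//; apply/funext => x;
       rewrite /turn mul0r addr0.
  have [d0|d0|d0] := ltgtP 0 (phi j - phi i).
  - exists (at_point i 1); right; exists j, i.
    have sE : turn (at_point i 1) phi i - turn (at_point i 1) phi j =
        - (phi j - phi i) + 1%:~R * (2 * pi).
      by rewrite turn_at_point turn_at_other//; ring.
    apply: (@beyond_of_attains l l') => //.
    + exact/attains_turn.
    + by rewrite sE; move: hd; rewrite ltr_norml; lra.
    + rewrite sE sinD_turn sinN oppr_lt0 sin_gt0_pi//.
      by move: hd; rewrite ltr_norml; lra.
  - exists (at_point j 1); right; exists i, j.
    have sE : turn (at_point j 1) phi j - turn (at_point j 1) phi i =
        - (phi i - phi j) + 1%:~R * (2 * pi).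
      by rewrite turn_at_point turn_at_other//; ring.
    apply: (@beyond_of_attains l l') => //.
    + exact/attains_turn.
    + by rewrite sE; move: hd; rewrite ltr_norml; lra.
    + rewrite sE sinD_turn sinN oppr_lt0 sin_gt0_pi//.
      by move: hd; rewrite ltr_norml; lra.
  (* Equal phases satisfy a relation, so a value of higher level would also have level [l]. *)
  - exfalso; apply: na.
    have ij0 : phi j = phi i by lra.
    apply: (@attains_fill _ _ _ lam_gt0 l l' _ _ _ (fun x => if x == i then 1 else - 1) i) => //.
    + exact: ltW.
    + by rewrite eqxx oner_eq0.
    + by rewrite (sum_two _ ij) eqxx (negbTE ji) ij0; ring.
    + by rewrite (sum_two _ ij) eqxx (negbTE ji) ij0; ring.
have phj : phi j = phi i + pi by lra.
pose X := w1 * sin (phi i) - w2 * cos (phi i).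
have cj : cos (phi j) = - cos (phi i) by rewrite phj cosDpi.
have sj : sin (phi j) = - sin (phi i) by rewrite phj sinDpi.
have [X0|X0|X0] := ltgtP 0 X.
- exists (fun=> 0); right; exists i, j.
  have -> : turn (fun=> 0) phi = phi by apply/funext => x; rewrite /turn mul0r addr0.
  rewrite /beyond cj sj dpi sinpi mulr0 addr0; split=> //; first by lra.
    by move: X0; rewrite /X; lra.
  exact: expR_gt0.
- exists (at_point i 1); right; exists j, i.
  rewrite /beyond.
  have -> : turn (at_point i 1) phi i - turn (at_point i 1) phi j = pi.
    by rewrite turn_at_point turn_at_other// phj; ring.
  rewrite turn_at_point turn_at_other// cosD_turn sinD_turn cj sj sinpi mulr0 addr0.
  split=> //; try by move: X0; rewrite /X; lra.
  exact: expR_gt0.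
(* Here w lies on the line of the two opposite phasors, with signed coordinate [r]. The moduli e^l +
   |r| + r and e^l + |r| differ by [r] and are at least e^l. *)
- exfalso; apply: na.
  pose r := w1 * cos (phi i) + w2 * sin (phi i).
  have cs := cos2Dsin2 (phi i).
  pose ti := expR l + `|r| + r; pose tj := expR l + `|r|.
  apply: (@attains_of_large _ _ _ lam_gt0 lam_sum1 l phi w1 w2
    (fun x => if x == i then ti else tj) (fun=> 1) i).
  + move=> x; case: ifP => _; rewrite /ti /tj; last by rewrite lerDl.
    by rewrite -addrA lerDl; have := ler_norm (- r); rewrite normrN; lra.
  + rewrite (sum_two _ ij) eqxx (negbTE ji) cj /ti /tj.
    have -> : (expR l + `|r| + r) * cos (phi i) + (expR l + `|r|) * - cos (phi i) = r * cos (phi i) by ring.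
    rewrite /r; transitivity (w1 * (cos (phi i) ^+ 2 + sin (phi i) ^+ 2) - sin (phi i) * X).
      by rewrite /X; ring.
    by rewrite cs -X0 mulr0 subr0 mulr1.
  + rewrite (sum_two _ ij) eqxx (negbTE ji) sj /ti /tj.
    have -> : (expR l + `|r| + r) * sin (phi i) + (expR l + `|r|) * - sin (phi i) = r * sin (phi i) by ring.
    rewrite /r; transitivity (w2 * (cos (phi i) ^+ 2 + sin (phi i) ^+ 2) + cos (phi i) * X).
      by rewrite /X; ring.
    by rewrite cs -X0 mulr0 addr0 mulr1.
  + exact: oner_neq0.
  + by rewrite (sum_two _ ij) cj; ring.
  + by rewrite (sum_two _ ij) sj; ring.
Qed.

End TwoPoints.

Section CertificateNear.
Variables (R : realType) (T : finType) (lam : T -> R).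

Lemma certificate_near (U : Type) (F : set_system U) {FF : Filter F} l
    (phi : U -> T -> R) (w1 w2 : U -> R) (phi0 : T -> R) (a1 a2 : R) :
  (forall i, phi u i @[u --> F] --> phi0 i) ->
  w1 u @[u --> F] --> a1 -> w2 u @[u --> F] --> a2 ->
  certificate lam l phi0 a1 a2 ->
  \forall u \near F, certificate lam l (phi u) (w1 u) (w2 u).
Proof.
move=> hphi h1 h2 [eta [heta hlt]].
have hd i : phi u i - eta @[u --> F] --> phi0 i - eta.
  by apply: cvgB; [exact: hphi|exact: cvg_cst].
have n1 : \forall u \near F, forall i, `|phi u i - eta| < pi / 2.
  apply: filter_forall => i.
  have hn : `|phi u i - eta| @[u --> F] --> `|phi0 i - eta| by exact: cvg_norm.
  exact: cvgr_lt hn _ (heta i).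
have n2 : \forall u \near F, w1 u * cos eta + w2 u * sin eta <
    expR (l + \sum_i lam i * (ln (cos (phi u i - eta)) - ln (lam i))).
  apply: near_lt hlt.
    by apply: cvgD; apply: cvgM => //; exact: cvg_cst.
  apply: cvg_expR; apply: cvgD; first exact: cvg_cst.
  apply: cvg_sum => i; apply: cvgM; first exact: cvg_cst.
  apply: cvgB; last exact: cvg_cst.
  by apply: cvg_ln; [exact: cos_gt0_norm|exact: cvg_cos].
near=> u; exists eta; split; first by near: u.
by near: u.
Unshelve. all: by end_near. Qed.

End CertificateNear.

(** * Lifts of two phases: openness, uniqueness, transport along paths *)

Section TwoPointsLifts.
Variables (R : realType) (T : finType) (lam : T -> R).
Hypothesis lam_gt0 : forall i, 0 < lam i.
Hypothesis lam_sum1 : \sum_i lam i = 1.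
Hypothesis card2 : #|T| = 2%N.

Lemma lifted2_near (U : Type) (F : set_system U) {FF : Filter F} l
    (phi : U -> T -> R) (w1 w2 : U -> R) (phi0 : T -> R) (a1 a2 : R) :
  (forall i, phi u i @[u --> F] --> phi0 i) ->
  w1 u @[u --> F] --> a1 -> w2 u @[u --> F] --> a2 ->
  lifted2 lam l phi0 a1 a2 ->
  \forall u \near F, lifted2 lam l (phi u) (w1 u) (w2 u).
Proof.
move=> hphi h1 h2 [hc|[i [j [ij /andP[d0 d1] X0 Y0 E0]]]].
  have n : \forall u \near F, certificate lam l (phi u) (w1 u) (w2 u) by apply: certificate_near hc.
  by apply: filterS n => u; left.
have hd : phi u j - phi u i @[u --> F] --> phi0 j - phi0 i by exact: cvgB.
have hX : w1 u * sin (phi u i) - w2 u * cos (phi u i) @[u --> F] -->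
   a1 * sin (phi0 i) - a2 * cos (phi0 i).
  by apply: cvgB; apply: cvgM => //; [exact: cvg_sin|exact: cvg_cos].
have hY : w2 u * cos (phi u j) - w1 u * sin (phi u j) @[u --> F] -->
   a2 * cos (phi0 j) - a1 * sin (phi0 j).
  by apply: cvgB; apply: cvgM => //; [exact: cvg_cos|exact: cvg_sin].
have nX : \forall u \near F, 0 < w1 u * sin (phi u i) - w2 u * cos (phi u i).
  exact: near_lt (cvg_cst _) hX X0.
have nY : \forall u \near F, 0 < w2 u * cos (phi u j) - w1 u * sin (phi u j).
  exact: near_lt (cvg_cst _) hY Y0.
have nd0 : \forall u \near F, 0 < phi u j - phi u i by exact: near_lt (cvg_cst _) hd d0.
have nd1 : \forall u \near F, phi u j - phi u i < 2 * pi by exact: near_lt hd (cvg_cst _) d1.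
have nE : \forall u \near F, 0 <
    expR (lam i * ln (w2 u * cos (phi u j) - w1 u * sin (phi u j)) +
          lam j * ln (w1 u * sin (phi u i) - w2 u * cos (phi u i))) +
    expR l * sin (phi u j - phi u i).
  apply: near_lt (cvg_cst _) _ E0.
  apply: cvgD; last by apply: cvgM; [exact: cvg_cst|exact: cvg_sin].
  by apply: cvg_expR; apply: cvgD; (apply: cvgM; [exact: cvg_cst|exact: cvg_ln]).
near=> u; right; exists i, j; split=> //; first by apply/andP; split; near: u.
- by near: u.
- by near: u.
- by near: u.
Unshelve. all: by end_near. Qed.

(** A certificate keeps the lifts less than pi apart, and [beyond] keeps their ordered difference in
    (0, 2 pi). The two coexist only below pi: further apart, [beyond] attains w at a level that the
    certificate forbids. In every case the two differences are less than 2 pi apart. *)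
Lemma lifted2_unique l phi k w1 w2 i j :
  lifted2 lam l phi w1 w2 -> lifted2 lam l (turn k phi) w1 w2 -> k i = k j.
Proof.
have p0 := pi_gt0 R.
have [->//|ij] := eqVneq i j.
have kE x y : phi x - phi y = turn k phi x - turn k phi y - (k x - k y)%:~R * (2 * pi).
  by rewrite /turn intrB; ring.
have close x y : `|(turn k phi x - turn k phi y) - (phi x - phi y)| < 2 * pi -> k x = k y.
  rewrite (kE x y) opprB addrC subrK normrM (gtr0_norm (_ : 0 < 2 * pi)); last by lra.
  rewrite gtr_pMl; last by lra.
  rewrite -intr_norm -[1]/(1%:~R) ltr_int => h.
  by apply/eqP; rewrite -subr_eq0 -normr_le0; lia.
have cdiff (phi' : T -> R) : certificate lam l phi' w1 w2 -> forall x y, `|phi' x - phi' y| < pi.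
  move=> [eta [h _]] x y.
  have -> : phi' x - phi' y = (phi' x - eta) - (phi' y - eta) by ring.
  have := ler_normB (phi' x - eta) (phi' y - eta); have := h x; have := h y; lra.
have mix (phi' : T -> R) k' x y : certificate lam l phi' w1 w2 ->
    beyond lam l (turn k' phi') w1 w2 x y -> turn k' phi' y - turn k' phi' x < pi.
  move=> hc [xy /andP[d0 d1] X0 Y0 E0].
  rewrite ltNge; apply/negP => dp.
  have [dpi|dpi] := eqVneq (turn k' phi' y - turn k' phi' x) pi.
    have := cdiff _ hc y x.
    have dE : phi' y - phi' x = pi + (k' x - k' y)%:~R * (2 * pi).
      by move: dpi; rewrite /turn intrB => dpi; lra.
    have : cos (phi' y - phi' x) = -1 by rewrite dE cosD_turn cospi.
    rewrite ltr_norml => hcos /andP[h1 h2].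
    have hs : sin (phi' y - phi' x) = 0 by rewrite dE sinD_turn sinpi.
    have [z0|z0|z0] := ltgtP 0 (phi' y - phi' x).
    - have : 0 < sin (phi' y - phi' x) by apply: sin_gt0_pi; rewrite z0.
      by rewrite hs ltxx.
    - have : 0 < sin (- (phi' y - phi' x)) by apply: sin_gt0_pi; apply/andP; split; lra.
      by rewrite sinN hs oppr0 ltxx.
    - by move: hcos; rewrite -z0 cos0; lra.
  have sg : sin (turn k' phi' y - turn k' phi' x) < 0.
    have -> : turn k' phi' y - turn k' phi' x = (turn k' phi' y - turn k' phi' x - pi) + pi.
      by rewrite subrK.
    rewrite sinDpi oppr_lt0; apply: sin_gt0_pi; apply/andP; split; last by lra.
    by rewrite subr_gt0 lt_neqAle eq_sym dpi.
  have ha := beyond_attains lam_sum1 card2 xy sg X0 Y0.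
  move/attains_turn: ha.
  apply: (certificate_not_attains lam_gt0 lam_sum1 hc).
  have sg0 : 0 < - sin (turn k' phi' y - turn k' phi' x) by rewrite oppr_gt0.
  rewrite lerBrDr -ler_expR expRD lnK ?posrE//.
  by move: E0; rewrite mulrN; lra.
have fromE x y : beyond lam l phi w1 w2 x y -> lifted2 lam l (turn k phi) w1 w2 -> k x = k y.
  move=> hb; have [xy /andP[d0 d1] X0 Y0 E0] := hb => -[hc|[x' [y' hb']]].
    have := mix (turn k phi) (fun z => - k z) x y hc; rewrite turnK => /(_ hb) h.
    have := cdiff _ hc y x => h'; apply/esym/close; move: h'; rewrite !ltr_norml; lra.
  have [xy' /andP[d0' d1'] X0' Y0' E0'] := hb'.
  have [x'E|x'E] := two_pointsE card2 x' xy; have [y'E|y'E] := two_pointsE card2 y' xy;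
    subst x' y'; try (by rewrite eqxx in xy'); try (by apply/esym/close; rewrite ltr_norml; lra).
  (* With the two points in the opposite order, one cross product would be both positive and
     negative. *)
  by exfalso; move: X0 Y0'; rewrite /turn cosD_turn sinD_turn; lra.
case=> [hc|[x [y hb]]]; last first.
  move=> h; have kxy := fromE _ _ hb h; have [xy _ _ _ _] := hb.
  have [->|->] := two_pointsE card2 i xy; have [->|->] := two_pointsE card2 j xy => //.
case=> [hc'|[x [y hb]]].
  by apply: close; have := cdiff _ hc i j; have := cdiff _ hc' i j; rewrite !ltr_norml; lra.
have kxy : k x = k y.
  have := mix phi k x y hc hb; have [_ /andP[d0 d1] _ _ _] := hb => h.
  by have := cdiff _ hc y x => h'; apply/esym/close; move: h'; rewrite !ltr_norml; lra.
have [xy _ _ _ _] := hb.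
by have [->|->] := two_pointsE card2 i xy; have [->|->] := two_pointsE card2 j xy.
Qed.

(** The parameters with a right lift form an open set, and a closed one, since the remaining
    parameters are covered by the open sets where a turn by a nonconstant [k] is right; [0, 1] is
    connected. *)
Lemma lifted2_path l (phi : R -> T -> R) (w1 w2 : R -> R) :
  (forall i, continuous (fun s => phi s i)) -> continuous w1 -> continuous w2 ->
  (forall s, 0 <= s <= 1 -> ~ attains lam l (phi s) (w1 s) (w2 s)) ->
  lifted2 lam l (phi 0) (w1 0) (w2 0) -> lifted2 lam l (phi 1) (w1 1) (w2 1).
Proof.
move=> cphi c1 c2 na h0.
pose good k s := lifted2 lam l (turn k (phi s)) (w1 s) (w2 s).
have good_open k : open [set s | good k s].
  rewrite openE => s hs; rewrite /interior.
  apply: (@lifted2_near _ (nbhs s) _ l (fun s => turn k (phi s)) w1 w2 _ _ _ _ _ _ hs).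
  - by move=> i; apply: cvgD; [exact: cphi|exact: cvg_cst].
  - exact: c1.
  - exact: c2.
have [i [j ij]] := two_points card2.
pose B := [set s : R | 0 <= s <= 1 /\ lifted2 lam l (phi s) (w1 s) (w2 s)].
suff BE : B = [set` `[0 : R, 1]].
  have : [set` `[0 : R, 1]] 1 by rewrite /= in_itv/= ler01 lexx.
  by rewrite -BE => -[].
have turn0 s : turn (fun=> 0) (phi s) = phi s.
  by apply/funext => x; rewrite /turn mul0r addr0.
apply: (@segment_connected R 0 1).
- by exists 0; split; rewrite ?lexx ?ler01.
- exists [set s | good (fun=> 0) s]; first exact: good_open.
  by apply/seteqP; split=> s /=; rewrite in_itv/= /good turn0.
- exists (~` \bigcup_(k in [set k : T -> int | k i != k j]) [set s | good k s]).
    by apply: open_closedC; apply: bigcup_open => k _; exact: good_open.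
  apply/seteqP; split=> s /=; rewrite in_itv/=.
    move=> [s01 hs]; split=> // -[k /= kij hk].
    by rewrite (lifted2_unique i j hs hk) eqxx in kij.
  move=> [s01 hn]; split=> //.
  have [k hk] := lifted2_exists lam_gt0 lam_sum1 card2 (na s s01).
  have kij : k i = k j by apply/eqP/negP => /negP kn; apply: hn; exists k.
  apply: (@lifted2_turn _ _ _ _ _ _ _ (k i)); move: hk; rewrite /good.
  by congr lifted2; apply/funext => x; rewrite /turn;
    have [->|->] := two_pointsE card2 x ij; rewrite ?kij.
Qed.

End TwoPointsLifts.

(** * Contraction of two lifted phases *)

Section TwoPointsContract.
Variables (R : realType) (T : finType) (lam : T -> R).
Hypothesis lam_gt0 : forall i, 0 < lam i.
Hypothesis lam_sum1 : \sum_i lam i = 1.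
Hypothesis card2 : #|T| = 2%N.

Lemma contract_fst phi i j s : i != j ->
  contract lam s phi i = phi i + s * (1 - lam i) * (phi j - phi i).
Proof.
by move=> ij; rewrite /contract /mean (sum_two card2 _ ij) (lam_two lam_sum1 card2 ij); ring.
Qed.

Lemma contract_snd phi i j s : i != j ->
  contract lam s phi j = phi j - s * lam i * (phi j - phi i).
Proof.
by move=> ij; rewrite /contract /mean (sum_two card2 _ ij) (lam_two lam_sum1 card2 ij); ring.
Qed.

Lemma contract_diff phi i j s : contract lam s phi j - contract lam s phi i = (1 - s) * (phi j - phi i).
Proof. by rewrite /contract; ring. Qed.

(** X + Y equals -2 sin(d / 2) times the component of w along the bisecting direction, d being the
    difference of the lifts. *)
Lemma beyond_midpoint l phi w1 w2 i j : beyond lam l phi w1 w2 i j ->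
  w1 * cos ((phi i + phi j) / 2) + w2 * sin ((phi i + phi j) / 2) < 0.
Proof.
move=> [ij /andP[d0 d1] X0 Y0 _]; set eta := (_ + _) / 2; pose h := (phi j - phi i) / 2.
have iE : phi i = eta - h by rewrite /eta /h; lra.
have jE : phi j = eta + h by rewrite /eta /h; lra.
have h0 : 0 < sin h by apply: sin_gt0_pi; rewrite /h; apply/andP; split; lra.
move: X0 Y0; rewrite {1 2}iE {1 2}jE sinB cosB sinD cosD => X0 Y0.
have : 0 < - (w1 * cos eta + w2 * sin eta) * (2 * sin h) by move: X0 Y0; lra.
by rewrite pmulr_lgt0 ?oppr_gt0//; lra.
Qed.

Lemma lam_le1 i : lam i <= 1.
Proof.
rewrite -lam_sum1 (bigD1 i)//= lerDl; apply: sumr_ge0 => k _; exact: ltW.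
Qed.

(** On the complementary arc the contraction moves the phases apart. A certificate at the level [q0]
    of w for the contracted phases would contract back to one for the original phases, where w is
    attained at [q0]. So there is none, and by duality w has level at least [q0], hence above [l],
    after the contraction. *)
Lemma beyond_contract_gt l phi w1 w2 i j s : 0 <= s <= 1 ->
  pi < (1 - s) * (phi j - phi i) ->
  beyond lam l phi w1 w2 i j -> beyond lam l (contract lam s phi) w1 w2 i j.
Proof.
move=> /andP[s0 s1] ds [ij /andP[d0 d1] X0 Y0 E0].
have p0 := pi_gt0 R.
set d := phi j - phi i in ds d0 d1 E0.
have dds : (1 - s) * d <= d by rewrite ler_piMl; lra.
have sgn x : pi < x < 2 * pi -> sin (x : R) < 0.
  move=> xx; have -> : x = (x - pi) + pi by rewrite subrK.
  by rewrite sinDpi oppr_lt0; apply: sin_gt0_pi; lra.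
have sg : sin d < 0 by apply: sgn; lra.
have sgs : sin ((1 - s) * d) < 0 by apply: sgn; lra.
have ha := beyond_attains lam_sum1 card2 ij sg X0 Y0.
set q0 := (X in attains _ X) in ha.
have lq : l < q0.
  have sg0 : 0 < - sin d by rewrite oppr_gt0.
  rewrite /q0 ltrBrDr -ltr_expR expRD lnK ?posrE//.
  by move: E0; rewrite mulrN; lra.
(* Turning phi_i forward by 2 pi replaces the arc by its complement, which is shorter than pi. *)
pose short psi := turn (at_point i 1) psi : T -> R.
have shortE psi : short psi i = psi i + 2 * pi by rewrite /short turn_at_point mul1r.
have shortE' psi : short psi j = psi j by rewrite /short turn_at_other.
have hs : `|short (contract lam s phi) j - short (contract lam s phi) i| < pi.
  rewrite shortE shortE' opprD addrA contract_diff -/d ltr_norml; lra.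
suff [l' ql' ha'] : exists2 l', q0 <= l' & attains lam l' (short (contract lam s phi)) w1 w2.
  apply: (@beyond_of_attains _ _ _ lam_sum1 card2 l l') => //.
  - exact: lt_le_trans ql'.
  - exact/attains_turn/ha'.
  - by rewrite contract_diff -/d; lra.
  - by rewrite contract_diff.
have [eta heta] : exists eta, forall x, `|short (contract lam s phi) x - eta| < pi / 2.
  apply: (spread_center lam_sum1) => x y.
  have [->|->] := two_pointsE card2 x ij; have [->|->] := two_pointsE card2 y ij;
    by rewrite ?subrr ?normr0 ?pi_gt0// distrC.
apply: (certificate_or_attains lam_gt0 lam_sum1 heta) => hc.
(* Chosen so that the contraction by [s'] shrinks the complementary arc 2 pi - (1 - s) d back to 2
   pi - d. *)
pose s' := 1 - (2 * pi - d) / (2 * pi - (1 - s) * d).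
have e0 : 0 < 2 * pi - (1 - s) * d by lra.
have s'01 : 0 <= s' <= 1.
  rewrite /s' subr_ge0 ler_pdivrMr// mul1r gerBl divr_ge0//; last by rewrite ltW.
    by rewrite andbT; lra.
  by lra.
have := certificate_contract lam_gt0 lam_sum1 s'01 hc.
have -> : contract lam s' (short (contract lam s phi)) = short phi.
  apply/funext => x; have se : (1 - s') * (2 * pi - (1 - s) * d) = 2 * pi - d.
    by rewrite /s' opprB addrC subrK divfK// gt_eqF.
  have dE : short (contract lam s phi) j - short (contract lam s phi) i =
      - (2 * pi - (1 - s) * d).
    by rewrite shortE shortE' opprD addrA contract_diff -/d; ring.
  have [->|->] := two_pointsE card2 x ij.
    rewrite (contract_fst _ _ ij) dE !shortE (contract_fst _ _ ij) -/d.
    transitivity (phi i + 2 * pi + (1 - lam i) * (s * d + (1 - s') * (2 * pi - (1 - s) * d)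
      - (2 * pi - (1 - s) * d))); first by ring.
    by rewrite se; ring.
  rewrite (contract_snd _ _ ij) dE !shortE' (contract_snd _ _ ij) -/d.
  transitivity (phi j - lam i * (s * d + (1 - s') * (2 * pi - (1 - s) * d)
      - (2 * pi - (1 - s) * d))); first by ring.
  by rewrite se; ring.
move=> hc0; apply: (certificate_not_attains lam_gt0 lam_sum1 hc0 (lexx q0)).
exact/attains_turn.
Qed.

(** Write w = - rho e^(i chi). The signs of X and Y place chi strictly between phi_i and phi_i + pi,
    and phi_j less than pi ahead of chi. The contraction moves phi_i forward and phi_j back, so when
    they are exactly pi apart chi is still strictly between them. *)
Lemma beyond_contract_pi l phi w1 w2 i j s : 0 <= s <= 1 ->
  (1 - s) * (phi j - phi i) = pi ->
  beyond lam l phi w1 w2 i j -> beyond lam l (contract lam s phi) w1 w2 i j.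
Proof.
move=> /andP[s0 s1] ds [ij /andP[d0 d1] X0 Y0 E0].
have p0 := pi_gt0 R.
have dpi : pi <= phi j - phi i by rewrite -ds ler_piMl; lra.
have : 0 < - w1 * cos (phi i + pi / 2) + - w2 * sin (phi i + pi / 2).
  by rewrite cosDpihalf sinDpihalf; move: X0; lra.
move=> /polar_near[rho [chi [rho0 hchi w1E w2E]]].
have {}w1E : w1 = - (rho * cos chi) by rewrite -w1E opprK.
have {}w2E : w2 = - (rho * sin chi) by rewrite -w2E opprK.
have XE x : w1 * sin x - w2 * cos x = rho * sin (chi - x).
  by rewrite w1E w2E sinB; ring.
have YE x : w2 * cos x - w1 * sin x = rho * sin (x - chi).
  by rewrite w1E w2E sinB; ring.
move: X0 Y0; rewrite XE YE !pmulr_rgt0// => X0 Y0.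
move: hchi; rewrite ltr_norml => /andP[c1 c2].
have g1 : phi j - chi < pi.
  rewrite ltNge; apply/negP => g.
  have : 0 <= sin (phi j - chi - pi) by apply: sin_ge0_pi; lra.
  by rewrite sinB cospi sinpi; lra.
have li := lam_gt0 i; have li1 := lam_le1 i.
have sl : 0 <= s * lam i by apply: mulr_ge0 => //; exact: ltW.
have sl' : 0 <= s * (1 - lam i) by apply: mulr_ge0 => //; lra.
have i1 : phi i <= contract lam s phi i.
  by rewrite (contract_fst _ _ ij) lerDl mulr_ge0// ltW.
have j1 : contract lam s phi j <= phi j.
  by rewrite (contract_snd _ _ ij) gerBl mulr_ge0// ltW.
have dE : contract lam s phi j - contract lam s phi i = pi by rewrite contract_diff.
split=> //; rewrite ?dE.
- by lra.
- by rewrite XE pmulr_rgt0//; apply: sin_gt0_pi; lra.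
- by rewrite YE pmulr_rgt0//; apply: sin_gt0_pi; lra.
- by rewrite sinpi mulr0 addr0 expR_gt0.
Qed.

(** Once the difference is below pi, a certificate takes over: w has a negative component along the
    direction bisecting the phases at the moment when they are pi apart (or at the start, if they
    are closer), and the contracted phases stay within pi/2 of that direction. *)
Lemma lifted2_contract l phi w1 w2 s : 0 <= s <= 1 ->
  lifted2 lam l phi w1 w2 -> lifted2 lam l (contract lam s phi) w1 w2.
Proof.
move=> s01 [hc|[i [j hb]]]; first by left; exact: certificate_contract.
have p0 := pi_gt0 R.
have [ij /andP[d0 d1] _ _ _] := hb; move: (s01) => /andP[s0 s1].
have cert_of eta : w1 * cos eta + w2 * sin eta < 0 ->
    `|contract lam s phi i - eta| < pi / 2 -> `|contract lam s phi j - eta| < pi / 2 ->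
    lifted2 lam l (contract lam s phi) w1 w2.
  move=> A0 hi hj; left; exists eta; split; last exact: lt_trans A0 (expR_gt0 _).
  by move=> x; have [->|->] := two_pointsE card2 x ij.
have [ds|ds] := ltP pi ((1 - s) * (phi j - phi i)).
  by right; exists i, j; exact: beyond_contract_gt.
have li := lam_gt0 i; have li1 := lam_le1 i.
have lj : lam j = 1 - lam i := lam_two lam_sum1 card2 ij.
have lj0 := lam_gt0 j.
have [dpi|dpi] := ltP (phi j - phi i) pi.
  have hx x : `|phi x - (phi i + phi j) / 2| < pi / 2.
    by have [->|->] := two_pointsE card2 x ij; rewrite ltr_norml; lra.
  apply: (cert_of ((phi i + phi j) / 2)); first exact: beyond_midpoint hb.
    exact: contract_norm_lt.
  exact: contract_norm_lt.
(* The moment at which the contracted difference equals pi. *)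
pose s' := 1 - pi / (phi j - phi i).
have ds' : (1 - s') * (phi j - phi i) = pi by rewrite /s' subKr divfK// gt_eqF.
have s'01 : 0 <= s' <= 1.
  rewrite /s' subr_ge0 ler_pdivrMr// mul1r dpi/= gerBl.
  by apply: divr_ge0; exact: ltW.
have hb' := beyond_contract_pi s'01 ds' hb.
have [->|sn] := eqVneq s s'; first by right; exists i, j.
have ss' : s' < s.
  rewrite lt_neqAle eq_sym sn/= leNgt; apply/negP => h.
  by move: ds; rewrite -ds' ler_pM2r//; lra.
have := beyond_midpoint hb'; set eta := (contract lam s' phi i + _) => A0.
have e1 : contract lam s' phi j - contract lam s' phi i = pi by rewrite contract_diff.
have e2 : contract lam s' phi i < contract lam s phi i.
  rewrite !(contract_fst _ _ ij) ltrD2l ltr_pM2r// ltr_pM2r//; lra.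
have e3 : contract lam s phi j < contract lam s' phi j.
  rewrite !(contract_snd _ _ ij) ltrD2l ltrN2 ltr_pM2r// ltr_pM2r//; lra.
have e4 : contract lam s phi i <= contract lam s phi j.
  by rewrite -subr_ge0 contract_diff mulr_ge0//; lra.
by apply: (cert_of (eta / 2)) => //; rewrite ltr_norml /eta; lra.
Qed.

End TwoPointsContract.

Section Balls.
Variables (R : realType) (T : finType) (lam : T -> R).

(** Only perturbations with the same weighted mean come from points of the torus, since the linear
    forms of the exponents have weighted mean 0. *)
Definition phase_close (e : R) (phi phi' : T -> R) : Prop :=
  mean lam phi' = mean lam phi /\ forall i, `|phi' i - phi i| < e.

Definition phase_filter (phi : T -> R) : set_system (T -> R) :=
  filter_from [set e : R | 0 < e] (fun e => [set phi' | forall i, `|phi' i - phi i| < e]).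

Global Instance phase_filter_filter phi : Filter (phase_filter phi).
Proof.
apply: filter_from_filter; first by exists 1; rewrite /= ltr01.
move=> e1 e2 /= h1 h2; exists (Num.min e1 e2); first by rewrite /= lt_min h1 h2.
by move=> phi' h; split=> i; have := h i; rewrite lt_min => /andP[].
Qed.

Lemma cvg_phase phi i : phi' i @[phi' --> phase_filter phi] --> phi i.
Proof.
apply/cvgrPdist_lt => e e0; exists e => // phi' h.
by rewrite /= distrC; exact: h.
Qed.

Lemma contract0 phi : contract lam 0 phi = phi.
Proof. by apply/funext => i; rewrite /contract subr0 mul1r mul0r addr0. Qed.

Lemma contract1 phi : contract lam 1 phi = fun=> mean lam phi.
Proof. by apply/funext => i; rewrite /contract subrr mul0r mul1r add0r. Qed.

Lemma mean_add phi psi : mean lam (fun i => phi i + psi i) = mean lam phi + mean lam psi.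
Proof. by rewrite /mean -big_split; apply: eq_bigr => i _; rewrite mulrDr. Qed.

Lemma mean_scale c phi : mean lam (fun i => c * phi i) = c * mean lam phi.
Proof. by rewrite /mean mulr_sumr; apply: eq_bigr => i _; rewrite mulrCA. Qed.

End Balls.

(** * Two blocks *)

Record block (R : realType) := Block {
  block_index :> finType;
  weight : block_index -> R;
  level : R;
  weight_gt0 : forall i, 0 < weight i;
  weight_sum1 : \sum_i weight i = 1 }.

Section TwoBlocks.
Variable R : realType.
Implicit Types a b : block R.

Definition block_moduli a (t : a -> R) := moduli (@weight R a) (level a) t.

Definition reaches a (phi : a -> R) w1 w2 := attains (@weight R a) (level a) phi w1 w2.

(** Membership in the coamoeba, read on the phases of the two blocks ([coamoeba_vanishes]). *)
Definition vanishes a b (phi : a -> R) (psi : b -> R) : Prop :=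
  exists2 u, block_moduli u &
    reaches phi (- \sum_i u i * cos (psi i)) (- \sum_i u i * sin (psi i)).

(** Corresponds to lying off the closed coamoeba ([regular_complement]). *)
Definition regular a b (phi : a -> R) (psi : b -> R) : Prop :=
  exists2 e : R, 0 < e & forall phi' psi',
    phase_close (@weight R a) e phi phi' -> phase_close (@weight R b) e psi psi' ->
    ~ vanishes phi' psi'.

(* phi is the right choice of real lifts for block a against block b. *)
Definition lifted a b (phi : a -> R) (psi : b -> R) : Prop :=
  if #|a| == 2%N then
    forall u, block_moduli u -> lifted2 (@weight R a) (level a) phi
      (- \sum_i u i * cos (psi i)) (- \sum_i u i * sin (psi i))
  else forall i j, `|phi i - phi j| < pi.

Lemma vanishes_sym a b (phi : a -> R) (psi : b -> R) : vanishes phi psi -> vanishes psi phi.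
Proof.
move=> [u mu [t [mt tc ts]]]; exists t => //; exists u; split=> //.
  by rewrite tc opprK.
by rewrite ts opprK.
Qed.

Lemma regular_sym a b (phi : a -> R) (psi : b -> R) : regular phi psi -> regular psi phi.
Proof.
move=> [e e0 h]; exists e => // psi' phi' h1 h2 /vanishes_sym.
exact: h.
Qed.

Lemma regular_not_vanishes a b (phi : a -> R) (psi : b -> R) : regular phi psi -> ~ vanishes phi psi.
Proof.
by move=> [e e0 h]; apply: h; split=> // i; rewrite subrr normr0.
Qed.

Lemma moduli_exist a : exists u : a -> R, block_moduli u.
Proof.
exists (fun=> expR (level a)); split=> [i|]; first exact: expR_gt0.
by under eq_bigr => i _ do rewrite expRK; rewrite -mulr_suml weight_sum1 mul1r.
Qed.

Lemma block_card_gt0 a : (0 < #|a|)%N.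
Proof. by have [i _] := block_nonempty (@weight_sum1 R a); apply/card_gt0P; exists i. Qed.

Lemma vanishes_turn a b (phi : a -> R) (psi : b -> R) k k' :
  vanishes (turn k phi) (turn k' psi) <-> vanishes phi psi.
Proof.
have cE u : \sum_i u i * cos (turn k' psi i) = \sum_i u i * cos (psi i).
  by apply: eq_bigr => i _; rewrite cosD_turn.
have sE u : \sum_i u i * sin (turn k' psi i) = \sum_i u i * sin (psi i).
  by apply: eq_bigr => i _; rewrite sinD_turn.
by split=> -[u mu h]; exists u => //; move: h; rewrite cE sE /reaches => /attains_turn.
Qed.

Lemma phase_close_turn a e (phi phi' : a -> R) k :
  phase_close (@weight R a) e (turn k phi) phi' ->
  phase_close (@weight R a) e phi (turn (fun i => - k i) phi').
Proof.
move=> [hm hn]; split.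
  rewrite /turn mean_add hm /turn mean_add -addrA -mean_add -[RHS]addr0; congr (_ + _).
  by rewrite /mean big1// => i _; rewrite mulrNz mulNr subrr mulr0.
move=> i; have := hn i; rewrite /turn mulrNz mulNr.
by have -> : phi' i - (k i)%:~R * (2 * pi) - phi i = phi' i - (phi i + (k i)%:~R * (2 * pi)) by ring.
Qed.

Lemma regular_turn a b (phi : a -> R) (psi : b -> R) k k' :
  regular phi psi -> regular (turn k phi) (turn k' psi).
Proof.
move=> [e e0 h]; exists e => // phi' psi' /phase_close_turn h1 /phase_close_turn h2 hv.
by apply: (h _ _ h1 h2); apply/vanishes_turn.
Qed.

Lemma lifted_turn_env a b (phi : a -> R) (psi : b -> R) k :
  lifted phi (turn k psi) <-> lifted phi psi.
Proof.
have cE u : \sum_i u i * cos (turn k psi i) = \sum_i u i * cos (psi i).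
  by apply: eq_bigr => i _; rewrite cosD_turn.
have sE u : \sum_i u i * sin (turn k psi i) = \sum_i u i * sin (psi i).
  by apply: eq_bigr => i _; rewrite sinD_turn.
rewrite /lifted; case: ifP => // _.
by split=> h u mu; have := h u mu; rewrite cE sE.
Qed.

Lemma lifted_unique a b (phi : a -> R) (psi : b -> R) k i j :
  lifted phi psi -> lifted (turn k phi) psi -> k i = k j.
Proof.
rewrite /lifted; case: ifP => [/eqP c2|_] h1 h2.
  have [u mu] := moduli_exist b.
  exact: (lifted2_unique (@weight_gt0 R a) (@weight_sum1 R a) c2 i j (h1 u mu) (h2 u mu)).
have p0 := pi_gt0 R.
have := h1 i j; have := h2 i j.
have -> : turn k phi i - turn k phi j = phi i - phi j + (k i - k j)%:~R * (2 * pi).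
  by rewrite /turn intrB; ring.
set m := k i - k j; rewrite !ltr_norml => /andP[a1 a2] /andP[a3 a4].
have m1 : m%:~R < 1%:~R :> R by rewrite -(@ltr_pM2r _ (2 * pi))//; lra.
have m2 : (-1)%:~R < m%:~R :> R by rewrite -(@ltr_pM2r _ (2 * pi))//; lra.
by move: m1 m2; rewrite !ltr_int /m; lia.
Qed.

Lemma sum_two_deltas (T : finType) (x y : T) (g : R) : x != y ->
  \sum_i ((i == x)%:R - (i == y)%:R) * g = 0.
Proof.
move=> xy; rewrite -mulr_suml sumrB (bigD1 x)//= big1 => [|i /negbTE->//].
rewrite (bigD1 y)//= [X in _ - (_ + X)]big1 => [|i /negbTE->//].
by rewrite !eqxx addr0 subrr mul0r.
Qed.

(** Two aligned phasors have difference 0, and by this relation a value of higher level is also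
    reached at the given one; so only a certificate can exclude w. *)
Lemma const_certificate a c w1 w2 : (1 < #|a|)%N ->
  ~ reaches (fun _ : a => c) w1 w2 ->
  certificate (@weight R a) (level a) (fun=> c) w1 w2.
Proof.
move=> /card_gt1P[x [y [_ _ xy]]] na.
have [//|hc] := pselect (certificate (@weight R a) (level a) (fun=> c) w1 w2).
exfalso; apply: na.
have hcen (i : a) : `|c - c| < pi / 2 by rewrite subrr normr0 divr_gt0// pi_gt0.
have [l' ll' h] := certificate_or_attains (@weight_gt0 R a) (@weight_sum1 R a) hcen hc.
apply: (@attains_fill _ _ _ (@weight_gt0 R a) (level a) l' _ _ _
  (fun i => (i == x)%:R - (i == y)%:R) x ll' h).
- by rewrite eqxx (negbTE xy) subr0 oner_neq0.
- exact: sum_two_deltas.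
- exact: sum_two_deltas.
Qed.

Lemma const_lifted a b (psi : b -> R) c :
  ~ vanishes (fun _ : a => c) psi -> lifted (fun _ : a => c) psi.
Proof.
move=> nv; rewrite /lifted; case: ifP => [/eqP c2|_].
  move=> u mu; left; apply: const_certificate; first by rewrite c2.
  by move=> h; apply: nv; exists u.
by move=> i j; rewrite subrr normr0 pi_gt0.
Qed.

(** Two terms are covered by [lifted2_contract], and a single phase is its own mean. With three or
    more terms, a value reached after the contraction has no certificate then, hence none before; by
    duality it is reached before at some higher level, and by a phasor relation at the given one. *)
Lemma lifted_contract a b (phi : a -> R) (psi : b -> R) s : 0 <= s <= 1 ->
  ~ vanishes phi psi -> lifted phi psi ->
  ~ vanishes (contract (@weight R a) s phi) psi /\
  lifted (contract (@weight R a) s phi) psi.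
Proof.
move=> s01 nv; rewrite /lifted; case: ifP => [/eqP c2|/eqP c2] h.
  have hu u : block_moduli u -> lifted2 (@weight R a) (level a) (contract (@weight R a) s phi)
      (- \sum_i u i * cos (psi i)) (- \sum_i u i * sin (psi i)).
    by move=> mu; apply: lifted2_contract (h u mu) => //; [exact: weight_gt0|exact: weight_sum1].
  split=> // -[u mu]; apply: (lifted2_not_attains (@weight_gt0 R a) (@weight_sum1 R a) c2).
  exact: hu.
split; last first.
  move=> i j; have -> : contract (@weight R a) s phi i - contract (@weight R a) s phi j =
    (1 - s) * (phi i - phi j) by rewrite /contract; ring.
  rewrite normrM; apply: le_lt_trans (h i j).
  by rewrite ler_piMl// ger0_norm; lra.
move=> [u mu hat]; apply: nv; exists u => //.
have [c3|] := ltnP 2 #|a|; last first.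
  rewrite leq_eqVlt (introF eqP c2)/= ltnS => c1.
  have -> : phi = contract (@weight R a) s phi => //.
  apply/funext => i; rewrite /contract /mean.
  have ai x : x = i by apply: (fintype_le1P c1).
  have := @weight_sum1 R a; rewrite (bigD1 i)//= big1 ?addr0 => [e|x /eqP[]//].
  rewrite (bigD1 i)//= big1 ?addr0 => [|x /eqP[]//].
  by rewrite e; ring.
have [eta heta] := spread_center (@weight_sum1 R a) h.
have [hc|hc] := pselect (certificate (@weight R a) (level a) phi
   (- \sum_i u i * cos (psi i)) (- \sum_i u i * sin (psi i))).
  exfalso; have hc' := certificate_contract (@weight_gt0 R a) (@weight_sum1 R a) s01 hc.
  exact: (certificate_not_attains (@weight_gt0 R a) (@weight_sum1 R a) hc' (lexx _) hat).
have [l' ll' h'] := certificate_or_attains (@weight_gt0 R a) (@weight_sum1 R a) heta hc.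
have [tau [i [ti tc ts]]] := phasor_relation phi c3.
exact: (attains_fill (@weight_gt0 R a) ll' h' ti tc ts).
Qed.

Lemma lifted_path a b (phi : R -> a -> R) (psi : R -> b -> R) :
  #|a| = 2%N ->
  (forall i, continuous (fun s => phi s i)) -> (forall i, continuous (fun s => psi s i)) ->
  (forall s, 0 <= s <= 1 -> ~ vanishes (phi s) (psi s)) ->
  lifted (phi 0) (psi 0) -> lifted (phi 1) (psi 1).
Proof.
move=> c2 cphi cpsi nv; rewrite /lifted c2 eqxx => h u mu.
apply: (@lifted2_path _ _ _ (@weight_gt0 R a) (@weight_sum1 R a) c2 (level a) phi
   (fun s => - \sum_i u i * cos (psi s i)) (fun s => - \sum_i u i * sin (psi s i))) => //.
- move=> s; apply: cvgN; apply: cvg_sum => i; apply: cvgM; first exact: cvg_cst.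
  by apply: cvg_cos; exact: cpsi.
- move=> s; apply: cvgN; apply: cvg_sum => i; apply: cvgM; first exact: cvg_cst.
  by apply: cvg_sin; exact: cpsi.
- by move=> s s01 ha; apply: (nv s s01); exists u.
- exact: h.
Qed.

Lemma continuous_affine (x y : R) : continuous (fun s : R => (1 - s) * x + s * y).
Proof.
move=> s; apply: cvgD; last by apply: cvgM; [exact: cvg_id|exact: cvg_cst].
by apply: cvgM; [apply: cvgB; [exact: cvg_cst|exact: cvg_id]|exact: cvg_cst].
Qed.

(** For two terms, openness at each [u] is not uniform in the unbounded family of moduli. The lift
    is carried instead along the segment to the perturbed phases, which stays in the ball of
    regularity as the means agree. *)
Lemma lifted_near a b (phi : a -> R) (psi : b -> R) : regular phi psi -> lifted phi psi ->
  exists2 e : R, 0 < e & forall phi' psi',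
    phase_close (@weight R a) e phi phi' -> phase_close (@weight R b) e psi psi' ->
    lifted phi' psi'.
Proof.
move=> [e e0 he]; have [c2|c2] := eqVneq #|a| 2%N.
  move=> h; exists e => // phi' psi' [m1 n1] [m2 n2].
  pose pf s i := (1 - s) * phi i + s * phi' i.
  pose pg s i := (1 - s) * psi i + s * psi' i.
  have -> : phi' = pf 1 by apply/funext => i; rewrite /pf subrr mul0r mul1r add0r.
  have -> : psi' = pg 1 by apply/funext => i; rewrite /pg subrr mul0r mul1r add0r.
  apply: lifted_path => //.
  - by move=> i; exact: continuous_affine.
  - by move=> i; exact: continuous_affine.
  - move=> s /andP[s0 s1]; apply: he; split.
    + by rewrite mean_add !mean_scale m1; ring.
    + move=> i; have -> : pf s i - phi i = s * (phi' i - phi i) by rewrite /pf; ring.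
      rewrite normrM ger0_norm//; apply: le_lt_trans (n1 i); exact: ler_piMl.
    + by rewrite mean_add !mean_scale m2; ring.
    + move=> i; have -> : pg s i - psi i = s * (psi' i - psi i) by rewrite /pg; ring.
      rewrite normrM ger0_norm//; apply: le_lt_trans (n2 i); exact: ler_piMl.
  - have -> : pf 0 = phi by apply/funext => i; rewrite /pf subr0 mul0r mul1r addr0.
    by have -> : pg 0 = psi by apply/funext => i; rewrite /pg subr0 mul0r mul1r addr0.
rewrite /lifted (negbTE c2) => h.
have [d d0 hd] : \forall phi' \near phase_filter phi, forall ij : a * a, `|phi' ij.1 - phi' ij.2| < pi.
  apply: filter_forall => -[i j] /=.
  have hn : `|phi' i - phi' j| @[phi' --> phase_filter phi] --> `|phi i - phi j|.
    by apply: cvg_norm; apply: cvgB; exact: cvg_phase.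
  exact: near_lt hn (cvg_cst _) (h i j).
by exists d => // phi' psi' [_ n1] _ i j; exact: (hd phi' n1 (i, j)).
Qed.

End TwoBlocks.

(** * Existence of lifts at regular phases *)

Section TwoBlocks.
Variable R : realType.
Implicit Types a b : block R.

(** Three such phasors let the block reach every value, in particular the opposite of a value of the
    other block. *)
Lemma regular_no_triple a b (phi : a -> R) (psi : b -> R) e phi' i j k :
  (forall phi' psi', phase_close (@weight R a) e phi phi' ->
    phase_close (@weight R b) e psi psi' -> ~ vanishes phi' psi') -> 0 < e ->
  phase_close (@weight R a) e phi phi' ->
  0 < sin (phi' j - phi' i) -> 0 < sin (phi' k - phi' j) -> 0 < sin (phi' i - phi' k) -> False.
Proof.
move=> he e0 hp s1 s2 s3; apply: (he phi' psi hp).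
  by split=> // x; rewrite subrr normr0.
have [u mu] := moduli_exist b; exists u => //.
exact: (attains_everything (@weight_gt0 R a) (@weight_sum1 R a) _ _ _ s1 s2 s3).
Qed.

(** Each of the two phases moves by the weight of the other one, in opposite directions, so the
    weighted mean is fixed. *)
Definition shift_pair a (phi : a -> R) (x y : a) (h : R) : a -> R :=
  fun i => phi i + h * ((i == y)%:R * weight x - (i == x)%:R * weight y).

Lemma mean_shift_pair a (phi : a -> R) x y h :
  mean (@weight R a) (shift_pair phi x y h) = mean (@weight R a) phi.
Proof.
rewrite /shift_pair mean_add -[RHS]addr0; congr (_ + _).
rewrite mean_scale /mean.
under eq_bigr => i _ do rewrite mulrBr ![weight i * _]mulrC.
by rewrite sumrB !sum_at (mulrC (weight x)) subrr mulr0.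
Qed.

Lemma shift_pair_close a (phi : a -> R) x y h e : x != y -> 0 <= h < e ->
  phase_close (@weight R a) e phi (shift_pair phi x y h).
Proof.
move=> xy /andP[h0 he]; split; first exact: mean_shift_pair.
move=> i; rewrite /shift_pair addrAC subrr add0r normrM ger0_norm//.
have le1 z := lam_le1 (@weight_gt0 R a) (@weight_sum1 R a) z.
have ge0 z := ltW (weight_gt0 z : 0 < weight (b := a) z).
apply: le_lt_trans he; rewrite ler_piMr//.
have [->|_] := eqVneq i y; have [_|_] := eqVneq _ x;
  rewrite ?mul1r ?mul0r ler_norml; have := le1 x; have := le1 y;
  have := ge0 x; have := ge0 y; lra.
Qed.

Lemma shift_pair_fst a (phi : a -> R) x y h : x != y ->
  shift_pair phi x y h x = phi x - h * weight y.
Proof. by move=> /negbTE xy; rewrite /shift_pair eqxx xy mul0r mul1r; ring. Qed.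

Lemma shift_pair_snd a (phi : a -> R) x y h : x != y ->
  shift_pair phi x y h y = phi y + h * weight x.
Proof. by rewrite eq_sym => /negbTE xy; rewrite /shift_pair eqxx xy mul0r mul1r; ring. Qed.

Lemma shift_pair_other a (phi : a -> R) x y z h : z != x -> z != y ->
  shift_pair phi x y h z = phi z.
Proof. by move=> /negbTE zx /negbTE zy; rewrite /shift_pair zx zy !mul0r; ring. Qed.

Lemma small_positive (e : R) (P : R -> Prop) : 0 < e ->
  (\forall h \near (0 : R), P h) -> exists h, [/\ 0 < h, h < e & P h].
Proof.
move=> e0 /nbhs_ballP[d /= d0 hP]; exists (Num.min (e / 2) (d / 2)); split.
- by rewrite lt_min !divr_gt0.
- by rewrite gt_min; apply/orP; left; lra.
apply: hP; rewrite /ball/= sub0r normrN ger0_norm ?le_min ?divr_ge0 ?ltW//.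
by rewrite gt_min; apply/orP; right; lra.
Qed.

Lemma cvg_near0 (x c : R) : x + h * c @[h --> (0 : R)] --> x.
Proof.
rewrite -[X in _ --> X]addr0 -[X in _ --> _ + X](mul0r c); apply: cvgD; first exact: cvg_cst.
by apply: cvgM; [exact: cvg_id|exact: cvg_cst].
Qed.

(** A third phasor lies on the line of the opposite pair or off it. In both cases an arbitrarily
    small perturbation with the same mean makes the three positively spanning, and then the sum
    vanishes. *)
Lemma regular_no_antipodal a b (phi : a -> R) (psi : b -> R) x y :
  (2 < #|a|)%N -> regular phi psi -> x != y -> cos (phi y - phi x) <> -1.
Proof.
move=> c3 [e e0 he] xy hc.
have [z [zx zy]] : exists z, z != x /\ z != y.
  have : [set: a]%SET != [set x; y]%SET.
    by apply/eqP => E; move: c3; rewrite -cardsT E cards2 xy.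
  rewrite finset.eqEsubset finset.subsetT andbT => /subsetPn[z _].
  by rewrite !inE negb_or => /andP[]; exists z.
have hs : sin (phi y - phi x) = 0.
  have := cos2Dsin2 (phi y - phi x); rewrite hc sqrrN expr1n => h.
  by apply/eqP; rewrite -sqrf_eq0; apply/eqP; lra.
have sy w : sin (phi y - w) = - sin (phi x - w).
  have -> : phi y - w = (phi y - phi x) + (phi x - w) by ring.
  by rewrite sinD hc hs; ring.
have cy w : cos (phi y - w) = - cos (phi x - w).
  have -> : phi y - w = (phi y - phi x) + (phi x - w) by ring.
  by rewrite cosD hc hs; ring.
have p0 := pi_gt0 R.
have wg0 (i : a) := weight_gt0 i.
have wg1 (i : a) : weight i <= 1 := lam_le1 (@weight_gt0 R a) (@weight_sum1 R a) i.
(* one of the two opposite phasors may be rotated away from z *)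
have off x' y' : x' != y' -> z != x' -> z != y' ->
    cos (phi y' - phi x') = -1 -> sin (phi y' - phi x') = 0 ->
    0 < sin (phi z - phi x') -> False.
  move=> xy' zx' zy' hc' hs' s0.
  have s1 : 0 < sin (phi y' - phi z).
    have -> : phi y' - phi z = (phi y' - phi x') - (phi z - phi x') by ring.
    by rewrite sinB hc' hs'; lra.
  have n1 : \forall h \near (0 : R), 0 < sin (phi z - phi x' + h * weight y').
    exact: near_lt (cvg_cst _) (cvg_sin (@cvg_near0 _ _)) s0.
  have n2 : \forall h \near (0 : R), 0 < sin (phi y' - phi z + h * weight x').
    exact: near_lt (cvg_cst _) (cvg_sin (@cvg_near0 _ _)) s1.
  have [||h [h0 h1 [h2 h3]]] := @small_positive (Num.min e 1)
    (fun h => 0 < sin (phi z - phi x' + h * weight y') /\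
              0 < sin (phi y' - phi z + h * weight x')).
  - by rewrite lt_min e0 ltr01.
  - near=> h; split; near: h; [exact: n1|exact: n2].
  move: h1; rewrite lt_min => /andP[he1 h1].
  apply: (@regular_no_triple a b phi psi e (shift_pair phi x' y' h) x' z y' he e0).
  - by apply: shift_pair_close => //; rewrite ltW.
  - rewrite shift_pair_fst// shift_pair_other//.
    by have <- : phi z - phi x' + h * weight y' = phi z - (phi x' - h * weight y') by ring.
  - rewrite shift_pair_snd// shift_pair_other//.
    by have <- : phi y' - phi z + h * weight x' = phi y' + h * weight x' - phi z by ring.
  - rewrite shift_pair_snd// shift_pair_fst//.
    have -> : phi x' - h * weight y' - (phi y' + h * weight x') =
      - ((phi y' - phi x') + h * (weight x' + weight y')) by ring.
    rewrite sinN sinD hc' hs' mul0r add0r mulN1r opprK.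
    have w1 : weight x' + weight y' <= 1.
      have := @weight_sum1 R a; rewrite (bigD1 x')//= (bigD1 y')/=; last by rewrite eq_sym.
      move=> <-; rewrite addrA lerDl; apply: sumr_ge0 => i _; exact: ltW.
    have w0 : 0 < weight x' + weight y' by apply: addr_gt0.
    apply: sin_gt0_pi; apply/andP; split; first exact: mulr_gt0.
    by have := pi_ge2 R; nra.
(* Here z is parallel to x': the two are rotated apart, z forward and x' back, while y' stays
   between their opposites. *)
have on x' y' : x' != y' -> z != x' -> z != y' ->
    cos (phi y' - phi x') = -1 -> sin (phi y' - phi x') = 0 ->
    sin (phi z - phi x') = 0 -> cos (phi z - phi x') = 1 -> False.
  move=> xy' zx' zy' hc' hs' s0 c0.
  pose h := Num.min e 1 / 2.
  have m0 : 0 < Num.min e 1 by rewrite lt_min e0 ltr01.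
  have me : Num.min e 1 <= e by rewrite ge_min lexx.
  have m1 : Num.min e 1 <= 1 by rewrite ge_min lexx orbT.
  have h0 : 0 < h by rewrite /h; lra.
  have he1 : h < e by rewrite /h; lra.
  have h1 : h < 1 by rewrite /h; lra.
  have xz' : x' != z by rewrite eq_sym.
  have yx' : y' != x' by rewrite eq_sym.
  have yz' : y' != z by rewrite eq_sym.
  have hw (i : a) : 0 < h * weight i < pi.
    apply/andP; split; first exact: mulr_gt0.
    by have := wg0 i; have := wg1 i; have := pi_ge2 R; nra.
  apply: (@regular_no_triple a b phi psi e (shift_pair phi x' z h) x' z y' he e0).
  - by apply: shift_pair_close => //; rewrite ltW.
  - rewrite shift_pair_snd// shift_pair_fst//.
    have -> : phi z + h * weight x' - (phi x' - h * weight z) =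
      (phi z - phi x') + h * (weight x' + weight z) by ring.
    rewrite sinD s0 c0 mul0r add0r mul1r.
    have w1 : weight x' + weight z <= 1.
      have := @weight_sum1 R a; rewrite (bigD1 x')//= (bigD1 z)//=.
      move=> <-; rewrite addrA lerDl; apply: sumr_ge0 => i _; exact: ltW.
    have w0 : 0 < weight x' + weight z by apply: addr_gt0.
    apply: sin_gt0_pi; apply/andP; split; first exact: mulr_gt0.
    by have := pi_ge2 R; nra.
  - rewrite shift_pair_snd// shift_pair_other//.
    have -> : phi y' - (phi z + h * weight x') = (phi y' - phi x') - ((phi z - phi x') + h * weight x') by ring.
    rewrite sinB hc' hs' mul0r sub0r mulN1r opprK sinD s0 c0 mul0r add0r mul1r.
    exact: sin_gt0_pi.
  - rewrite shift_pair_fst// shift_pair_other//.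
    have -> : phi x' - h * weight z - phi y' = - ((phi y' - phi x') + h * weight z) by ring.
    rewrite sinN sinD hc' hs' mul0r add0r mulN1r opprK.
    exact: sin_gt0_pi.
have yx : y != x by rewrite eq_sym.
have hcyx : cos (phi x - phi y) = -1 by rewrite -opprB cosN.
have hsyx : sin (phi x - phi y) = 0 by rewrite -opprB sinN hs oppr0.
have szy : sin (phi z - phi y) = - sin (phi z - phi x).
  by rewrite -opprB sinN sy -(opprB (phi x)) sinN opprK.
have czy : cos (phi z - phi y) = - cos (phi z - phi x).
  by rewrite -opprB cosN cy -(opprB (phi x)) cosN.
have [s0|s0|s0] := ltgtP 0 (sin (phi z - phi x)).
- exact: (off x y).
- by apply: (off y x) => //; rewrite szy; lra.
- have cc : cos (phi z - phi x) ^+ 2 = 1.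
    by have := cos2Dsin2 (phi z - phi x); rewrite -s0; lra.
  have [c0|c0] : cos (phi z - phi x) = 1 \/ cos (phi z - phi x) = -1.
    by move/eqP: cc; rewrite sqrf_eq1 => /orP[/eqP|/eqP]; [left|right].
  + exact: (on x y).
  + by apply: (on y x) => //; rewrite ?szy ?czy -?s0 ?c0; lra.
Unshelve. all: by end_near. Qed.

(** All phases are lifted to within pi of a reference phase. Opposite pairs are excluded, and two
    lifts more than pi apart would form a positively spanning triple with the reference phase. *)
Lemma regular_spread a b (phi : a -> R) (psi : b -> R) :
  (2 < #|a|)%N -> regular phi psi ->
  exists k, forall i j, `|turn k phi i - turn k phi j| < pi.
Proof.
move=> c3 hreg.
have [i0 _] := block_nonempty (@weight_sum1 R a).
have p0 := pi_gt0 R.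
have [k hk] : exists k : a -> int, forall i, - pi < phi i - phi i0 + (k i)%:~R * (2 * pi) <= pi.
  exists (fun i => projT1 (cid (exists_turn (phi i - phi i0)))) => i.
  exact: (projT2 (cid (exists_turn (phi i - phi i0)))).
have k0 : k i0 = 0.
  have := hk i0; rewrite subrr add0r => /andP[a1 a2].
  have m1 : (k i0)%:~R < 1%:~R :> R by rewrite -(@ltr_pM2r _ (2 * pi))//; lra.
  have m2 : (-1)%:~R < (k i0)%:~R :> R by rewrite -(@ltr_pM2r _ (2 * pi))//; lra.
  by move: m1 m2; rewrite !ltr_int; lia.
exists k; set phi1 := turn k phi.
have reg1 : regular phi1 psi.
  have := regular_turn k (fun=> 0) hreg.
  by have -> : turn (fun=> 0) psi = psi by apply/funext => x; rewrite /turn mul0r addr0.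
pose d i := phi1 i - phi1 i0.
have dE i : d i = phi i - phi i0 + (k i)%:~R * (2 * pi).
  by rewrite /d /phi1 /turn k0; ring.
have hd i : - pi < d i <= pi by rewrite dE; exact: hk.
have anti i j : d i - d j <> pi.
  have -> : d i - d j = phi1 i - phi1 j by rewrite /d; ring.
  move=> e; have [ij|ji] := eqVneq j i.
    by move: e; rewrite ij subrr => e0; rewrite -e0 ltxx in p0.
  by apply: (regular_no_antipodal c3 reg1 ji); rewrite e cospi.
have dpi i : d i < pi.
  have /andP[_ h] := hd i; rewrite lt_neqAle h andbT; apply/eqP => e.
  by apply: (anti i i0); rewrite e /d subrr subr0.
have main i j : d j - d i < pi.
  rewrite ltNge; apply/negP; rewrite le_eqVlt => /predU1P[/esym/anti//|gt].
  have /andP[di _] := hd i; have dj := dpi j.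
  have [e e0 he] := reg1.
  apply: (@regular_no_triple a b phi1 psi e phi1 i0 j i he e0).
  - by split=> // x; rewrite subrr normr0.
  - rewrite -/(d j); apply: sin_gt0_pi; lra.
  - have -> : phi1 i - phi1 j = (d i - d j + 2 * pi) + (-1)%:~R * (2 * pi) by rewrite /d; ring.
    by rewrite sinD_turn; apply: sin_gt0_pi; lra.
  - have -> : phi1 i0 - phi1 i = - d i by rewrite /d; ring.
    by apply: sin_gt0_pi; have := dpi j; lra.
move=> i j; have -> : phi1 i - phi1 j = d i - d j by rewrite /d; ring.
by rewrite ltr_norml; have := main i j; have := main j i; lra.
Qed.

Lemma lifted_exists a b (phi : a -> R) (psi : b -> R) : regular phi psi ->
  exists k, lifted (turn k phi) psi.
Proof.
move=> hreg; have nv := regular_not_vanishes hreg.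
have [c3|] := ltnP 2 #|a|.
  have [k hk] := regular_spread c3 hreg; exists k.
  by rewrite /lifted; case: ifP => // /eqP c2; rewrite c2 in c3.
rewrite leq_eqVlt => /predU1P[c2|]; last first.
  rewrite ltnS => c1; exists (fun=> 0); rewrite /lifted; case: ifP => [/eqP c2|_].
    by rewrite c2 in c1.
  by move=> i j; rewrite (fintype_le1P c1 i j) subrr normr0 pi_gt0.
have [u mu] := moduli_exist b.
have na : ~ reaches phi (- \sum_i u i * cos (psi i)) (- \sum_i u i * sin (psi i)).
  by move=> h; apply: nv; exists u.
have [k hk] := lifted2_exists (@weight_gt0 R a) (@weight_sum1 R a) c2 na.
exists k; rewrite /lifted c2 eqxx => v mv.
(* Geometric interpolation preserves the level, so all intermediate moduli are admissible; along it
   the lift found for the one [u] is carried to an arbitrary [v]. *)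
pose us (s : R) i := expR ((1 - s) * ln (u i) + s * ln (v i)).
have us0 : us 0 = u.
  by apply/funext => i; rewrite /us subr0 mul1r mul0r addr0 lnK// posrE; case: mu.
have us1 : us 1 = v.
  by apply/funext => i; rewrite /us subrr mul0r mul1r add0r lnK// posrE; case: mv.
have cus i : continuous (fun s => us s i).
  by move=> s; apply: cvg_expR; exact: continuous_affine.
have mus s : block_moduli (us s).
  split=> [i|]; first exact: expR_gt0.
  under eq_bigr => i _ do rewrite expRK mulrDr mulrCA [X in _ + X]mulrCA.
  by rewrite big_split/= -!mulr_sumr; case: mu => _ ->; case: mv => _ ->; ring.
have := @lifted2_path _ _ _ (@weight_gt0 R a) (@weight_sum1 R a) c2 (level a)
   (fun=> turn k phi) (fun s => - \sum_i us s i * cos (psi i))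
   (fun s => - \sum_i us s i * sin (psi i)); rewrite us0 us1; apply => //.
- by move=> i s; exact: cvg_cst.
- move=> s; apply: cvgN; apply: cvg_sum => i; apply: cvgM; last exact: cvg_cst.
  exact: cus.
- move=> s; apply: cvgN; apply: cvg_sum => i; apply: cvgM; last exact: cvg_cst.
  exact: cus.
- move=> s _ /attains_turn h; apply: nv; exists (us s) => //.
Qed.

End TwoBlocks.

(** * Contraction of both blocks *)

Section TwoBlocks.
Variable R : realType.
Implicit Types a b : block R.

(** Equal moduli S / #|a| add up to [S] in the common direction, and the relation between two
    aligned terms corrects their level. *)
Lemma reaches_far a c S : (1 < #|a|)%N -> #|a|%:R * expR (level a) <= S ->
  reaches (fun _ : a => c) (S * cos c) (S * sin c).
Proof.
move=> a1 hS; have a0 : 0 < #|a|%:R :> R by rewrite ltr0n; exact: ltn_trans a1.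
have /card_gt1P[x [y [_ _ xy]]] := a1.
have sumc (g : R) : \sum_(i : a) S / #|a|%:R * g = S * g.
  rewrite sumr_const -mulr_natr -mulrA mulrCA !mulrA; field; rewrite gt_eqF//.
apply: (@attains_of_large _ _ _ (@weight_gt0 R a) (@weight_sum1 R a) _ _ _ _
  (fun=> S / #|a|%:R) (fun i => (i == x)%:R - (i == y)%:R) x).
- by move=> i; rewrite ler_pdivlMr// mulrC.
- exact: sumc.
- exact: sumc.
- by rewrite eqxx (negbTE xy) subr0 oner_neq0.
- exact: sum_two_deltas.
- exact: sum_two_deltas.
Qed.

Lemma phase_closeW a e e' (phi phi' : a -> R) : e <= e' ->
  phase_close (@weight R a) e phi phi' -> phase_close (@weight R a) e' phi phi'.
Proof. by move=> ee' [m n]; split=> // i; exact: lt_le_trans (n i) ee'. Qed.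

(** The single term of [b] has its phase fixed by the mean and its modulus by the level, so one
    value has to be avoided, and the certificate against it is an open condition. *)
Lemma const_regular_point a b c d : (1 < #|a|)%N -> #|b| = 1%N ->
  ~ vanishes (fun _ : a => c) (fun _ : b => d) ->
  regular (fun _ : a => c) (fun _ : b => d).
Proof.
move=> a1 b1 nv.
have [y _] := block_nonempty (@weight_sum1 R b).
have yE x : x = y by apply: fintype_le1P; rewrite b1.
have wy : weight y = 1.
  have := @weight_sum1 R b; rewrite (bigD1 y)//= big1 ?addr0// => x /eqP[]//.
have [u mu] := moduli_exist b.
set w1 := - \sum_i u i * cos d; set w2 := - \sum_i u i * sin d.
have na : ~ reaches (fun _ : a => c) w1 w2 by move=> h; apply: nv; exists u.
have hc := const_certificate a1 na.
have [e e0 he] : \forall phi \near phase_filter (fun _ : a => c),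
    certificate (@weight R a) (level a) phi w1 w2.
  apply: certificate_near hc; try exact: cvg_cst.
  by move=> i; exact: cvg_phase.
exists e => // phi psi [_ n1] [m2 _] [v mv hat].
have psiE : psi = fun=> d.
  apply/funext => x; move: m2; rewrite /mean (bigD1 y)//= [in RHS](bigD1 y)//=.
  by rewrite !big1 => [|i /eqP[]//|i /eqP[]//]; rewrite !addr0 wy !mul1r (yE x).
have vE : v = u.
  apply/funext => x; case: mu => u0 ul; case: mv => v0 vl.
  move: vl; rewrite -ul (bigD1 y)//= [in RHS](bigD1 y)//=.
  rewrite !big1 => [|i /eqP[]//|i /eqP[]//]; rewrite !addr0 wy !mul1r (yE x).
  by apply: ln_inj; rewrite posrE.
move: hat; rewrite psiE vE.
exact: (certificate_not_attains (@weight_gt0 R a) (@weight_sum1 R a) (he phi n1) (lexx _)).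
Qed.

(** When both blocks have several terms, opposite directions would make far points of the two rays
    cancel. Otherwise the sum of the two unit vectors has a positive product with each; nearby
    phasors keep this property, so their sums cannot vanish. *)
Lemma const_regular a b c d : (1 < #|a|)%N || (1 < #|b|)%N ->
  ~ vanishes (fun _ : a => c) (fun _ : b => d) ->
  regular (fun _ : a => c) (fun _ : b => d).
Proof.
move=> ab nv.
have [a1|a1] := ltnP 1 #|a|; last first.
  have {}a1 : #|a| = 1%N by apply/eqP; rewrite eqn_leq a1 block_card_gt0.
  apply: regular_sym; apply: const_regular_point => //.
    by move: ab; rewrite a1.
  by move/vanishes_sym.
have [b1|b1] := ltnP 1 #|b|; last first.
  have {}b1 : #|b| = 1%N by apply/eqP; rewrite eqn_leq b1 block_card_gt0.
  exact: const_regular_point.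
have cd : 0 < 1 + cos (c - d).
  have h1 : 0 <= 1 + cos (c - d) by have := cos_geN1 (c - d); lra.
  rewrite lt_neqAle h1 andbT; apply/eqP => e; apply: nv.
  have hcos : cos (c - d) = -1 by lra.
  have hsin : sin (c - d) = 0.
    have := cos2Dsin2 (c - d); rewrite hcos sqrrN expr1n => h.
    by apply/eqP; rewrite -sqrf_eq0; apply/eqP; lra.
  have cE : cos d = - cos c.
    have -> : d = c - (c - d) by ring.
    by rewrite cosB hcos hsin; ring.
  have sE : sin d = - sin c.
    have -> : d = c - (c - d) by ring.
    by rewrite sinB hcos hsin; ring.
  pose S := #|a|%:R * expR (level a) + #|b|%:R * expR (level b).
  have Sa : #|a|%:R * expR (level a) <= S by rewrite lerDl mulr_ge0// expR_ge0.
  have Sb : #|b|%:R * expR (level b) <= S by rewrite lerDr mulr_ge0// expR_ge0.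
  have [u [mu uc us]] := reaches_far d b1 Sb.
  exists u => //; rewrite uc us cE sE !mulrN !opprK.
  exact: reaches_far.
pose x := cos c + cos d; pose y := sin c + sin d.
have hcd : cos (c - d) = cos c * cos d + sin c * sin d := cosB c d.
have pa : 0 < x * cos c + y * sin c.
  by move: cd; rewrite hcd /x /y -(cos2Dsin2 c); lra.
have pb : 0 < x * cos d + y * sin d.
  by move: cd; rewrite hcd /x /y -(cos2Dsin2 d); lra.
have near_pos (k : block R) z : 0 < x * cos z + y * sin z ->
    \forall phi \near phase_filter (fun _ : k => z), forall i, 0 < x * cos (phi i) + y * sin (phi i).
  move=> hz; apply: filter_forall => i; apply: near_lt (cvg_cst _) _ hz.
  have hi := @cvg_phase R k (fun=> z) i.
  by apply: cvgD; apply: cvgM; [exact: cvg_cst|exact: cvg_cos|exact: cvg_cst|exact: cvg_sin].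
have [e1 e10 he1] := near_pos a c pa; have [e2 e20 he2] := near_pos b d pb.
exists (Num.min e1 e2); first by rewrite lt_min e10.
move=> phi psi [_ n1] [_ n2] [u [u0 _] [t [[t0 _] tc ts]]].
have {}n1 : forall i, 0 < x * cos (phi i) + y * sin (phi i).
  by apply: he1 => i; apply: lt_le_trans (n1 i) _; rewrite ge_min lexx.
have {}n2 : forall i, 0 < x * cos (psi i) + y * sin (psi i).
  by apply: he2 => i; apply: lt_le_trans (n2 i) _; rewrite ge_min lexx orbT.
have s1 : 0 < \sum_i t i * (x * cos (phi i) + y * sin (phi i)).
  have [i _] := block_nonempty (@weight_sum1 R a).
  rewrite (bigD1 i)//=; apply: ltr_pwDl; first exact: mulr_gt0.
  by apply: sumr_ge0 => j _; apply/ltW/mulr_gt0.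
have s2 : 0 <= \sum_i u i * (x * cos (psi i) + y * sin (psi i)).
  by apply: sumr_ge0 => j _; apply/ltW/mulr_gt0.
have linE (k : block R) (v f : k -> R) :
    \sum_i v i * (x * cos (f i) + y * sin (f i)) =
    x * \sum_i v i * cos (f i) + y * \sum_i v i * sin (f i).
  by rewrite !mulr_sumr -big_split/=; apply: eq_bigr => i _; ring.
by move: s1 s2; rewrite !linE tc ts; lra.
Qed.

Definition good a b (phi : a -> R) (psi : b -> R) := lifted phi psi /\ lifted psi phi.

Lemma continuous_contract a (phi : a -> R) i (s : R) :
  continuous (fun r : R => contract (@weight R a) (s * r) phi i).
Proof.
move=> r; have hr : s * x @[x --> r] --> s * r.
  by apply: cvgM; [exact: cvg_cst|exact: cvg_id].
apply: cvgD; apply: cvgM; try exact: cvg_cst; last exact: hr.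
by apply: cvgB; [exact: cvg_cst|exact: hr].
Qed.

(** The blocks are contracted one after the other. In between, the lift of the second block has to
    stay right against the contracted first block, which for two terms is a transport along the
    contraction. *)
Lemma good_contract_not_vanishes a b (phi : a -> R) (psi : b -> R) s s' :
  0 <= s <= 1 -> 0 <= s' <= 1 -> ~ vanishes phi psi -> good phi psi ->
  ~ vanishes (contract (@weight R a) s phi) (contract (@weight R b) s' psi).
Proof.
move=> s01 s01' nv [g1 g2].
have step r : 0 <= r <= 1 -> ~ vanishes (contract (@weight R a) (s * r) phi) psi.
  move=> /andP[r0 r1].
  have sr : 0 <= s * r <= 1 by move: s01 => /andP[h1 h2]; rewrite mulr_ge0//= mulr_ile1.
  by have [] := lifted_contract sr nv g1.
have nv1 : ~ vanishes psi (contract (@weight R a) s phi).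
  by move=> /vanishes_sym; have := step 1; rewrite mulr1; apply; rewrite ler01 lexx.
have g2' : lifted psi (contract (@weight R a) s phi).
  have [c2|c2] := eqVneq #|b| 2%N; last first.
    by move: g2; rewrite /lifted (negbTE c2).
  rewrite -[s]mulr1.
  apply: (@lifted_path _ b a (fun=> psi) (fun r => contract (@weight R a) (s * r) phi)) => //.
  - by move=> i r; exact: cvg_cst.
  - by move=> i; exact: continuous_contract.
  - by move=> r r01 /vanishes_sym; exact: step.
  - by rewrite mulr0 contract0.
have [h _] := lifted_contract s01' nv1 g2'.
by move/vanishes_sym.
Qed.

Lemma good_near a b (phi : a -> R) (psi : b -> R) : regular phi psi -> good phi psi ->
  exists2 e : R, 0 < e & forall phi' psi',
    phase_close (@weight R a) e phi phi' -> phase_close (@weight R b) e psi psi' ->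
    ~ vanishes phi' psi' /\ good phi' psi'.
Proof.
move=> hreg [g1 g2]; have [e e0 he] := hreg.
have [e1 e10 he1] := lifted_near hreg g1.
have [e2 e20 he2] := lifted_near (regular_sym hreg) g2.
exists (Num.min e (Num.min e1 e2)); first by rewrite !lt_min e0 e10.
move=> phi' psi' h1 h2.
have l0 : Num.min e (Num.min e1 e2) <= e by rewrite ge_min lexx.
have l1 : Num.min e (Num.min e1 e2) <= e1 by rewrite !ge_min lexx orbT.
have l2 : Num.min e (Num.min e1 e2) <= e2 by rewrite !ge_min lexx !orbT.
split; first exact: he _ _ (phase_closeW l0 h1) (phase_closeW l0 h2).
split; first exact: he1 _ _ (phase_closeW l1 h1) (phase_closeW l1 h2).
exact: he2 _ _ (phase_closeW l2 h2) (phase_closeW l2 h1).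
Qed.

(* For s < 1 the contraction is a dilation, so it carries a neighbourhood of
   good phases onto a neighbourhood; s = 1 is the critical point itself. *)
Lemma regular_contract a b (phi : a -> R) (psi : b -> R) s :
  (1 < #|a|)%N || (1 < #|b|)%N -> 0 <= s <= 1 ->
  regular phi psi -> good phi psi ->
  regular (contract (@weight R a) s phi) (contract (@weight R b) s psi).
Proof.
move=> ab s01 hreg hgood.
have [e e0 he] := good_near hreg hgood.
have [->|s1] := eqVneq s 1.
  have o1 : 0 <= (1 : R) <= 1 by rewrite ler01 lexx.
  have := good_contract_not_vanishes o1 o1 (regular_not_vanishes hreg) hgood.
  by rewrite !contract1 => nv; exact: const_regular.
have {}s1 : 0 < 1 - s by move: s01 => /andP[_]; rewrite le_eqVlt (negbTE s1)/= subr_gt0.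
exists ((1 - s) * e); first exact: mulr_gt0.
move=> phi' psi' h1 h2.
have back (k : block R) (f f' : k -> R) :
    phase_close (@weight R k) ((1 - s) * e) (contract (@weight R k) s f) f' ->
    exists2 f0, phase_close (@weight R k) e f f0 & f' = contract (@weight R k) s f0.
  move=> [m n]; rewrite (mean_contract (@weight_sum1 R k)) in m.
  (* The inverse of the dilation by 1 - s about the common mean. *)
  pose f0 i := f i + (1 - s)^-1 * (f' i - contract (@weight R k) s f i).
  have m0 : mean (@weight R k) f0 = mean (@weight R k) f.
    rewrite /f0 mean_add mean_scale.
    have -> : mean (@weight R k) (fun i => f' i - contract (@weight R k) s f i) = 0.
      rewrite -[fun i => _]/(fun i => f' i + (fun j => - contract (@weight R k) s f j) i).
      by rewrite mean_add mean_opp (mean_contract (@weight_sum1 R k)) m subrr.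
    by rewrite mulr0 addr0.
  exists f0.
    split=> // i; rewrite /f0 addrAC subrr add0r normrM gtr0_norm ?invr_gt0//.
    by rewrite mulrC ltr_pdivrMr// mulrC.
  apply/funext => i; rewrite /contract m0 /f0 /contract; field.
  by rewrite gt_eqF.
have [f0 c0 ->] := back _ _ _ h1; have [g0 d0 ->] := back _ _ _ h2.
have [nv g] := he f0 g0 c0 d0.
exact: good_contract_not_vanishes.
Qed.

Lemma good_exists a b (phi : a -> R) (psi : b -> R) : regular phi psi ->
  exists k k', good (turn k phi) (turn k' psi).
Proof.
move=> hreg; have [k hk] := lifted_exists hreg.
have [k' hk'] := lifted_exists (regular_sym hreg).
by exists k, k'; split; apply/lifted_turn_env.
Qed.

Lemma good_unique a b (phi : a -> R) (psi : b -> R) k k' :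
  good phi psi -> good (turn k phi) (turn k' psi) ->
  (forall i j, k i = k j) /\ (forall i j, k' i = k' j).
Proof.
move=> [g1 g2] [/lifted_turn_env h1 /lifted_turn_env h2].
by split=> i j; [exact: lifted_unique g1 h1|exact: lifted_unique g2 h2].
Qed.

Lemma good_const a b c d : ~ vanishes (fun _ : a => c) (fun _ : b => d) ->
  good (fun _ : a => c) (fun _ : b => d).
Proof. by move=> nv; split; apply: const_lifted => // /vanishes_sym. Qed.

End TwoBlocks.

(** * Laurent polynomials in polar coordinates *)

Section Angles.
Variable R : realType.
Implicit Types x y : R.

Lemma angleP x y : reflect (exists k : int, y = x + k%:~R * (2 * pi)) (angle x == angle y).
Proof.
apply: (iffP idP).
  move=> /eqP/eqquotP/asboolP[k kE]; exists (- k); rewrite mulrNz mulNr -kE; ring.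
move=> [k kE]; apply/eqP/eqquotP/asboolP; exists (- k); rewrite kE mulrNz; ring.
Qed.

Lemma angle_surj (a : circle R) : exists x, angle x = a.
Proof. by exists (repr a); rewrite /angle reprK. Qed.

Lemma cos_sin_eq x y : cos x = cos y -> sin x = sin y ->
  exists k : int, y = x + k%:~R * (2 * pi).
Proof.
move=> hc hs; have [k hk] := exists_turn (x - y).
exists k; apply/eqP; rewrite eq_sym -subr_eq0; apply/eqP.
set z := x - y + k%:~R * (2 * pi) in hk.
have -> : x + k%:~R * (2 * pi) - y = z by rewrite /z; ring.
have zc : cos z = 1.
  by rewrite /z cosD_turn cosB hc hs -!expr2 cos2Dsin2.
have z0 : cos `|z| = cos 0 by rewrite cos_norm zc cos0.
have /eqP : `|z| = 0.
  have zpi : `|z| <= pi by rewrite ler_norml; move: hk; lra.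
  by apply: cos_inj z0; rewrite in_itv/= ?normr_ge0 ?zpi ?lexx ?pi_ge0.
by rewrite normr_eq0 => /eqP.
Qed.

End Angles.

Section PolarForm.
Variable R : realType.
Implicit Types x y a b : R.

(** The number e^(x + i a); in these coordinates monomials are additive. *)
Definition polar x a : R[i] := Complex (expR x * cos a) (expR x * sin a).

Lemma polar_neq0 x a : polar x a != 0.
Proof.
rewrite eq_complex /=; apply/negP => /andP[].
rewrite !mulf_eq0 !expR_eq0/= => /eqP c0 /eqP s0.
by have := cos2Dsin2 a; rewrite c0 s0 expr0n/= addr0 => /eqP; rewrite eq_sym oner_eq0.
Qed.

Lemma polarD x y a b : polar (x + y) (a + b) = polar x a * polar y b.
Proof.
apply/eqP; rewrite eq_complex /= expRD cosD sinD; apply/andP; split; apply/eqP; ring.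
Qed.

Lemma polar0 : polar 0 0 = 1.
Proof. by apply/eqP; rewrite eq_complex /= expR0 cos0 sin0 mulr1 mulr0 !eqxx. Qed.

Lemma polarX x a n : polar (n%:R * x) (n%:R * a) = polar x a ^+ n.
Proof.
elim: n => [|n IH]; first by rewrite !mul0r polar0 expr0.
by rewrite -natr1 !mulrDl !mul1r polarD IH exprSr.
Qed.

Lemma polarV x a : polar (- x) (- a) = (polar x a)^-1.
Proof.
apply: (mulfI (polar_neq0 x a)); rewrite mulfV ?polar_neq0//.
by rewrite -polarD !subrr polar0.
Qed.

Lemma polarXz x a (k : int) : polar (k%:~R * x) (k%:~R * a) = polar x a ^ k.
Proof.
case: k => n; first exact: polarX.
by rewrite NegzE !mulrNz !mulNr polarV -exprnN; congr (_^-1); exact: polarX.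
Qed.

Lemma polar_prod (I : finType) (x a : I -> R) :
  polar (\sum_i x i) (\sum_i a i) = \prod_i polar (x i) (a i).
Proof.
elim/big_ind3 : _ => //; first exact: polar0.
by move=> u1 v1 w1 u2 v2 w2 <- <-; rewrite polarD.
Qed.

Lemma polar_turn x a (k : int) : polar x (a + k%:~R * (2 * pi)) = polar x a.
Proof. by rewrite /polar cosD_turn sinD_turn. Qed.

Lemma polar_norm x a : `|polar x a| = (expR x)%:C%C.
Proof.
rewrite normc_def /=; congr (_%:C)%C.
have -> : (expR x * cos a) ^+ 2 + (expR x * sin a) ^+ 2 = expR x ^+ 2.
  rewrite !exprMn -mulrDr cos2Dsin2 mulr1 //.
by rewrite sqrtr_sqr ger0_norm ?expR_ge0.
Qed.

Lemma polar_split x a : polar x a = (expR x)%:C%C * Complex (cos a) (sin a).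
Proof. by apply/eqP; rewrite eq_complex /= !mul0r subr0 addr0 !eqxx. Qed.

Lemma polar_exists (z : R[i]) : z != 0 -> exists x a, z = polar x a.
Proof.
case: z => u v; rewrite eq_complex /= negb_and => uv.
have s0 : 0 < u ^+ 2 + v ^+ 2.
  rewrite lt_neqAle addr_ge0 ?sqr_ge0// andbT eq_sym.
  by rewrite paddr_eq0 ?sqr_ge0// !sqrf_eq0 negb_and.
pose r := Num.sqrt (u ^+ 2 + v ^+ 2).
have r0 : 0 < r by rewrite sqrtr_gt0.
have r2 : r ^+ 2 = u ^+ 2 + v ^+ 2 by rewrite sqr_sqrtr// ltW.
pose c := u / r.
have c2 : c ^+ 2 + (v / r) ^+ 2 = 1.
  by rewrite /c !expr_div_n -mulrDl -r2 divff// sqrf_eq0 gt_eqF.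
have c1 : -1 <= c <= 1.
  by rewrite -ler_norml -(@expr_le1 _ 2)// -normrX ger0_norm ?sqr_ge0// -c2 lerDl sqr_ge0.
have sa : sin (acos c) ^+ 2 = (v / r) ^+ 2.
  by rewrite sin2cos2 acosK ?in_itv//= -c2; ring.
have rE : expR (ln r) = r by rewrite lnK.
move: sa => /eqP; rewrite eqf_sqr => /orP[]/eqP sa.
  exists (ln r), (acos c); apply/eqP; rewrite eq_complex /= rE acosK ?in_itv//= sa /c.
  by apply/andP; split; apply/eqP; field; rewrite gt_eqF.
exists (ln r), (- acos c); apply/eqP.
rewrite eq_complex /= rE cosN sinN acosK ?in_itv//= sa opprK /c.
by apply/andP; split; apply/eqP; field; rewrite gt_eqF.
Qed.

Lemma polar_inj_angle x y a b : polar x a = polar y b -> x = y /\ angle a = angle b.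
Proof.
move=> e; have xy : x = y.
  have := congr1 Num.norm e; rewrite !polar_norm => /complexI; exact: expR_inj.
split=> //; move: e; rewrite xy => -[/(mulfI (lt0r_neq0 (expR_gt0 y))) hc].
move=> /(mulfI (lt0r_neq0 (expR_gt0 y))) hs.
by apply/eqP/angleP; exact: cos_sin_eq.
Qed.

Lemma arg_polar x a : arg (polar x a) = angle a.
Proof.
rewrite /arg; set S := [set theta | _].
have : S (xget 0 S) by apply: xgetPex; exists a; rewrite /S /= polar_norm polar_split.
set b := xget 0 S; rewrite /S /= polar_norm -polar_split => /polar_inj_angle[_ ->] //.
Qed.

Lemma sum_complex (I : finType) (u v : I -> R) :
  \sum_i Complex (u i) (v i) = Complex (\sum_i u i) (\sum_i v i).
Proof. by elim/big_ind3 : _ => // x1 x2 x3 y1 y2 y3 -> ->. Qed.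

End PolarForm.

Section LaurentPolar.
Variables (R : realType) (n N : nat) (A : 'M[int]_(n, N)) (f : 'I_N -> R[i]).
Variables (gam alp : 'I_N -> R).
Hypothesis fE : forall i, f i = polar (gam i) (alp i).
Implicit Types x th : 'cV[R]_n.

Definition linear_form (i : 'I_N) (x : 'cV[R]_n) : R := \sum_j (A j i)%:~R * x j 0.

Definition polar_point x th : 'cV[R[i]]_n := \col_j polar (x j 0) (th j 0).

Lemma monomial_polar i x th :
  monomial (col i A) (polar_point x th) = polar (linear_form i x) (linear_form i th).
Proof.
rewrite /monomial /linear_form polar_prod; apply: eq_bigr => j _.
by rewrite !mxE polarXz.
Qed.

Definition term_log i x : R := gam i + linear_form i x.
Definition term_arg i th : R := alp i + linear_form i th.

Lemma laurent_polar x th :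
  laurent A f (polar_point x th) = \sum_i polar (term_log i x) (term_arg i th).
Proof.
by apply: eq_bigr => i _; rewrite monomial_polar fE polarD.
Qed.

(** Multiplying the j-th derivative by z_j gives the terms of f weighted by the j-th exponents, and
    z_j is invertible. *)
Lemma partial_polar j x th :
  partial j A f (polar_point x th) =
  (polar (x j 0) (th j 0))^-1 * \sum_i (A j i)%:~R * polar (term_log i x) (term_arg i th).
Proof.
rewrite mulr_sumr; apply: eq_bigr => i _.
have -> : monomial (col i A - delta_mx j 0) (polar_point x th) =
    (polar (x j 0) (th j 0))^-1 * monomial (col i A) (polar_point x th).
  rewrite /monomial (bigD1 j)//= [in RHS](bigD1 j)//= mulrA; congr (_ * _).
    rewrite !mxE !eqxx /= expfzDr ?polar_neq0// mulrC.
    by rewrite -invr_expz expr1z.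
  by apply: eq_bigr => k /negbTE kj; rewrite !mxE kj /= subr0.
by rewrite monomial_polar polarD -fE; ring.
Qed.

Lemma algebraic_torus_polar z : algebraic_torus z -> exists x th, z = polar_point x th.
Proof.
move=> hz; pose P j := cid (polar_exists (hz j)).
pose Q j := cid (projT2 (P j)).
exists (\col_j projT1 (P j)), (\col_j projT1 (Q j)).
apply/colP => j; rewrite !mxE; exact: (projT2 (Q j)).
Qed.

Lemma polar_point_torus x th : algebraic_torus (polar_point x th).
Proof. by move=> j; rewrite !mxE polar_neq0. Qed.

Definition wrap (th : 'cV[R]_n) : torus R n := map_mx (@angle R) th.

Lemma Arg_polar x th : Arg (polar_point x th) = wrap th.
Proof. by apply/colP => j; rewrite !mxE arg_polar. Qed.

Lemma wrap_surj (t : torus R n) : exists th, wrap th = t.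
Proof.
pose P j := cid (angle_surj (t j 0)).
exists (\col_j projT1 (P j)); apply/colP => j; rewrite !mxE; exact: (projT2 (P j)).
Qed.

Lemma wrapP th th' : wrap th = wrap th' <->
  exists k : 'I_n -> int, forall j, th' j 0 = th j 0 + (k j)%:~R * (2 * pi).
Proof.
split=> [e|[k kE]]; last first.
  by apply/colP => j; rewrite !mxE; apply/eqP/angleP; exists (k j).
have h j : exists k : int, th' j 0 = th j 0 + k%:~R * (2 * pi).
  by apply/angleP/eqP; have /colP/(_ j) := e; rewrite !mxE.
pose P j := cid (h j); exists (fun j => projT1 (P j)) => j; exact: (projT2 (P j)).
Qed.

Lemma coamoeba_wrap th : coamoeba A f (wrap th) <->
  exists x, \sum_i expR (term_log i x) * cos (term_arg i th) = 0 /\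
            \sum_i expR (term_log i x) * sin (term_arg i th) = 0.
Proof.
split=> [[z [/algebraic_torus_polar[x [th' ->]] z0]]|[x [hc hs]]].
  rewrite Arg_polar => /wrapP[k kE].
  exists x; move: z0.
  have -> : polar_point x th' = polar_point x th.
    by apply/colP => j; rewrite !mxE kE polar_turn.
  by rewrite laurent_polar sum_complex => -[].
exists (polar_point x th); last exact: Arg_polar.
split; first exact: polar_point_torus.
by rewrite laurent_polar sum_complex hc hs.
Qed.

End LaurentPolar.

(** * Components of the coamoeba complement *)

Section TorusTopology.
Variable R : realType.

(** The image of an interval is open in the quotient because its preimage is the union of the
    translates of the interval by multiples of 2 pi. *)
Lemma nbhs_angle (x : R) (P : set (circle R)) :
  nbhs (angle x) P <-> exists2 e : R, 0 < e & forall y, `|y - x| < e -> P (angle y).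
Proof.
split=> [nP|[e e0 he]].
  have ca : {for x, continuous (@angle R : R -> circle R)} := @pi_continuous R _ x.
  have /nbhs_ballP[e /= e0 he] : nbhs x ((@angle R) @^-1` P) := ca _ nP.
  exists e => // y hy; apply: (he y); by rewrite /ball/= distrC.
rewrite nbhsE; exists ((@angle R) @` [set y | `|y - x| < e]); last first.
  by move=> _ [y hy <-]; exact: he.
split; last by exists x => //=; rewrite subrr normr0.
rewrite /open/= /quotient_open.
change (open ((@angle R) @^-1` ((@angle R) @` [set y | `|y - x| < e]))).
rewrite openE => y [z /= hz /eqP/angleP[k kE]].
apply/nbhs_ballP; exists (e - `|z - x|); first by rewrite /= subr_gt0.
move=> y'; rewrite /ball/= => hy'.
exists (y' - k%:~R * (2 * pi)) => /=.
  have -> : y' - k%:~R * (2 * pi) - x = (z - x) - (y - y') by rewrite kE; ring.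
  by apply: le_lt_trans (ler_normB _ _) _; lra.
by apply/eqP/angleP; exists k; rewrite subrK.
Qed.

Lemma nbhs_wrap n (th : 'cV[R]_n) (S : set (torus R n)) :
  nbhs (wrap th) S <->
  exists2 e : R, 0 < e & forall th' : 'cV[R]_n, (forall j, `|th' j 0 - th j 0| < e) -> S (wrap th').
Proof.
split=> [[P nP sPS]|[e e0 he]].
  have h j : exists2 e : R, 0 < e & forall y, `|y - th j 0| < e -> P j 0 (angle y).
    by apply/nbhs_angle; have := nP j 0; rewrite mxE.
  have [E E0 hE] : exists2 E : 'I_n -> R, forall j, 0 < E j &
      forall j y, `|y - th j 0| < E j -> P j 0 (angle y).
    exists (fun j => s2val (cid2 (h j))) => j; first exact: (s2valP (cid2 (h j))).
    exact: (s2valP' (cid2 (h j))).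
  (* The initial value 1 keeps the radius positive even when n = 0. *)
  exists (\big[Num.min/1]_j E j).
    by apply/lt_bigmin => //; exact: ltr01.
  move=> th' hth'; apply: sPS => j k; rewrite ord1 mxE; apply: hE.
  by apply: lt_le_trans (hth' j) _; exact: bigmin_le.
exists (fun j _ => (@angle R) @` [set y | `|y - th j 0| < e]).
  move=> j k; rewrite ord1 mxE; apply/nbhs_angle; exists e => //.
move=> t ht; have h j : exists2 y, `|y - th j 0| < e & angle y = t j 0.
  by have [y hy yE] := ht j 0; exists y.
pose th' : 'cV[R]_n := \col_j s2val (cid2 (h j)).
have -> : t = wrap th'.
  by apply/colP => j; rewrite !mxE; rewrite (s2valP' (cid2 (h j))).
by apply: he => j; rewrite mxE; exact: (s2valP (cid2 (h j))).
Qed.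

Lemma open_wrap n (S : set (torus R n)) :
  (forall th, S (wrap th) -> exists2 e : R, 0 < e &
     forall th' : 'cV[R]_n, (forall j, `|th' j 0 - th j 0| < e) -> S (wrap th')) -> open S.
Proof.
move=> h; rewrite openE => t St; have [th thE] := wrap_surj t.
by rewrite -thE in St *; apply/nbhs_wrap/h.
Qed.

Lemma closure_wrap n (C : set (torus R n)) th :
  (~` closure C) (wrap th) <-> exists2 e : R, 0 < e &
    forall th' : 'cV[R]_n, (forall j, `|th' j 0 - th j 0| < e) -> ~ C (wrap th').
Proof.
split=> [h|[e e0 he] hcl].
  have : nbhs (wrap th) (~` C).
    apply: contrapT => nn; apply: h => B nB.
    apply: contrapT => CB; apply: nn; apply: filterS nB => x Bx Cx.
    by apply: CB; exists x.
  by move/nbhs_wrap.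
have nB : nbhs (wrap th) (~` C) by apply/nbhs_wrap; exists e.
by have [x [Cx nCx]] := hcl _ nB; exact: nCx.
Qed.

Lemma connected_wrap_segment n (th0 th1 : 'cV[R]_n) :
  connected ((fun s : R => wrap ((1 - s) *: th0 + s *: th1)) @` [set` `[0 : R, 1]]).
Proof.
apply: connected_continuous_connected; first exact: segment_connected.
apply: continuous_subspaceT => s S /nbhs_wrap[e e0 he].
pose M := \sum_j `|th1 j 0 - th0 j 0| + 1.
have M0 : 0 < M by rewrite ltr_wpDl// sumr_ge0.
apply/nbhs_ballP; exists (e / M) => /=; first exact: divr_gt0.
move=> r; rewrite /ball/= => hr; apply: he => j; rewrite !mxE.
have -> : (1 - r) * th0 j 0 + r * th1 j 0 - ((1 - s) * th0 j 0 + s * th1 j 0) =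
  (r - s) * (th1 j 0 - th0 j 0) by ring.
rewrite normrM distrC; apply: (@le_lt_trans _ _ (`|s - r| * M)).
  rewrite ler_wpM2l// /M (bigD1 j)//= -addrA lerDl addr_ge0// sumr_ge0//.
by rewrite -ltr_pdivlMr.
Qed.

End TorusTopology.

(** * Linear algebra of one simplex block *)

Section SimplexBlock.
Variables (R : realType) (m : nat) (C : 'M[int]_(m, m + 1)) (lam : 'I_(m + 1) -> R).
Hypothesis C_special : special_block C.
Hypothesis lam_gt0 : forall i, 0 < lam i.
Hypothesis lamC : forall j, \sum_i lam i * (C j i)%:~R = 0.

Lemma special_entry : exists2 p : 'I_m -> R, forall j, 1 <= p j &
  forall j k, (C j (lshift 1 k))%:~R = - p k *+ (j == k) :> R.
Proof.
have [p p0 pE] := C_special; exists (fun j => (p 0 j)%:~R).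
  by move=> j; rewrite -[1]/(1%:~R) ler_int -gtz0_ge1.
move=> j k; have /matrixP/(_ j k) := pE; rewrite !mxE => ->.
by case: eqVneq => [->|_]; rewrite ?mulr1n ?mulr0n ?oppr0// mulrNz.
Qed.

Lemma mean_linear_form (x : 'cV[R]_m) : \sum_i lam i * linear_form C i x = 0.
Proof.
rewrite /linear_form; under eq_bigr => i _ do rewrite mulr_sumr.
rewrite exchange_big big1//= => j _.
under eq_bigr => i _ do rewrite mulrA.
by rewrite -mulr_suml lamC mul0r.
Qed.

Lemma linear_form_lshift p k x :
  (forall j k, (C j (lshift 1 k))%:~R = - p k *+ (j == k) :> R) ->
  linear_form C (lshift 1 k) x = - p k * x k 0.
Proof.
move=> pE; rewrite /linear_form (bigD1 k)//= pE eqxx mulr1n big1 ?addr0// => j jk.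
by rewrite pE (negbTE jk) mulr0n mul0r.
Qed.

(** All forms but the last are multiples of single coordinates, and the last equation follows from
    the weighted relation. The bound on x holds because the p_j, being positive integers, are at
    least 1. *)
Lemma linear_form_solve (y : 'I_(m + 1) -> R) : \sum_i lam i * y i = 0 ->
  exists x : 'cV[R]_m, (forall i, linear_form C i x = y i) /\
    forall j, `|x j 0| <= `|y (lshift 1 j)|.
Proof.
move=> y0; have [p p1 pE] := special_entry.
have p0 j : 0 < p j := lt_le_trans ltr01 (p1 j).
pose x : 'cV[R]_m := \col_j - (y (lshift 1 j) / p j).
have xl k : linear_form C (lshift 1 k) x = y (lshift 1 k).
  by rewrite (linear_form_lshift _ _ pE) mxE mulrNN mulrC divfK// gt_eqF.
exists x; split=> [i|j]; last first.
  rewrite mxE normrN normrM normfV (gtr0_norm (p0 j)) ler_pdivrMr//.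
  by rewrite ler_peMr.
rewrite -(splitK i); case: (fintype.split i) => [k|k] /=; first exact: xl.
have : \sum_i lam i * linear_form C i x = \sum_i lam i * y i by rewrite mean_linear_form y0.
rewrite !big_split_ord /= !big_ord1.
under eq_bigr => j _ do rewrite xl.
by rewrite (ord1 k) => /addrI/(mulfI (lt0r_neq0 (lam_gt0 _))).
Qed.

Lemma linear_form_inj (x : 'cV[R]_m) : (forall i, linear_form C i x = 0) -> x = 0.
Proof.
move=> h; have [p p1 pE] := special_entry; apply/colP => j.
have := h (lshift 1 j); rewrite (linear_form_lshift _ _ pE) mxE => /eqP.
rewrite mulf_eq0 oppr_eq0 => /orP[/eqP p0|/eqP//].
by have := p1 j; rewrite p0 ler10.
Qed.

(* p_j T_j = a_j T_last with p_j, a_j > 0 *)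
Lemma kernel_same_arg (s th : 'I_(m + 1) -> R) :
  (forall j, \sum_i (C j i)%:~R * polar (s i) (th i) = 0) ->
  forall i, angle (th i) = angle (th (rshift m 0)).
Proof.
move=> h; have [p p1 pE] := special_entry.
have p0 j : 0 < p j := lt_le_trans ltr01 (p1 j).
have pr (z : int) x a : z%:~R * polar x a = Complex (z%:~R * (expR x * cos a)) (z%:~R * (expR x * sin a)) :> R[i].
  rewrite -(rmorph_int (real_complex R)) /=; apply/eqP; rewrite eq_complex /=.
  by rewrite !mul0r subr0 addr0 !eqxx.
move=> i; rewrite -(splitK i); case: (fintype.split i) => [k|k] /=; last by rewrite ord1.
pose q := (C k (rshift m 0))%:~R : R.
(* The weighted relation in row k reads lam_k p_k = lam_last q. *)
have q0 : 0 < q.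
  have := lamC k; rewrite big_split_ord /= big_ord1 (bigD1 k)//= pE eqxx mulr1n.
  rewrite big1 => [|j jk]; last by rewrite pE eq_sym (negbTE jk) mulr0n mulr0.
  rewrite addr0 -/q => e.
  have : 0 < lam (rshift m 0) * q.
    have : 0 < lam (lshift 1 k) * p k by apply: mulr_gt0.
    by move: e; lra.
  by rewrite pmulr_rgt0.
have := h k; under eq_bigr => j _ do rewrite pr.
rewrite sum_complex => -[].
rewrite !big_split_ord /= !big_ord1 -/q.
have sumE (g : 'I_(m + 1) -> R) : \sum_(j < m) (C k (lshift 1 j))%:~R * g (lshift 1 j) = - p k * g (lshift 1 k).
  rewrite (bigD1 k)//= pE eqxx mulr1n big1 ?addr0// => j jk.
  by rewrite pE eq_sym (negbTE jk) mulr0n mul0r.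
rewrite (sumE (fun j => expR (s j) * cos (th j))) (sumE (fun j => expR (s j) * sin (th j))) => hc hs.
suff : polar (ln (p k) + s (lshift 1 k)) (th (lshift 1 k)) =
       polar (ln q + s (rshift m 0)) (th (rshift m 0)) by move/polar_inj_angle => [].
apply/eqP; rewrite eq_complex /= !expRD !lnK ?posrE//.
by apply/andP; split; apply/eqP; move: hc hs; lra.
Qed.

End SimplexBlock.

(** * Arguments on the torus as phases of two blocks *)

Section Orthogonal.
Variables (R : realType) (m1 m2 : nat).
Variables (A : 'M[int]_(m1 + m2, (m1 + 1) + (m2 + 1))).
Variables (gam alp : 'I_((m1 + 1) + (m2 + 1)) -> R).
Variables (lam1 : 'I_(m1 + 1) -> R) (lam2 : 'I_(m2 + 1) -> R).
Hypothesis special1 : special_block (ulsubmx A).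
Hypothesis special2 : special_block (drsubmx A).
Hypothesis ur0 : ursubmx A = 0.
Hypothesis dl0 : dlsubmx A = 0.
Hypothesis lam1_gt0 : forall i, 0 < lam1 i.
Hypothesis lam2_gt0 : forall i, 0 < lam2 i.
Hypothesis lam1_sum : \sum_i lam1 i = 1.
Hypothesis lam2_sum : \sum_i lam2 i = 1.
Hypothesis lam1_ker : forall j, \sum_i lam1 i * (ulsubmx A j i)%:~R = 0.
Hypothesis lam2_ker : forall j, \sum_i lam2 i * (drsubmx A j i)%:~R = 0.
Hypothesis size_gt0 : (0 < m1 + m2)%N.

Let n := (m1 + m2)%N.
Implicit Types (x th : 'cV[R]_n).

Definition f_of : 'I_((m1 + 1) + (m2 + 1)) -> R[i] := fun i => polar (gam i) (alp i).

Let l1 := lshift (m2 + 1) : 'I_(m1 + 1) -> 'I_((m1 + 1) + (m2 + 1)).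
Let r2 := @rshift (m1 + 1) (m2 + 1) : 'I_(m2 + 1) -> 'I_((m1 + 1) + (m2 + 1)).

(** The level involves only the coefficients: the linear forms in the logarithms of |z_j| have
    weighted mean 0. *)
Definition block1 : block R :=
  Block (\sum_i lam1 i * gam (l1 i)) lam1_gt0 lam1_sum.
Definition block2 : block R :=
  Block (\sum_i lam2 i * gam (r2 i)) lam2_gt0 lam2_sum.

Definition phases1 th : block1 -> R := fun i => term_arg A alp (l1 i) th.
Definition phases2 th : block2 -> R := fun i => term_arg A alp (r2 i) th.

Lemma linear_form_l i x : linear_form A (l1 i) x = linear_form (ulsubmx A) i (usubmx x).
Proof.
rewrite /linear_form big_split_ord /= [X in _ + X]big1 ?addr0.
  by apply: eq_bigr => j _; rewrite !mxE.
move=> j _; have /matrixP/(_ j i) := dl0; rewrite !mxE => ->.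
by rewrite mul0r.
Qed.

Lemma linear_form_r i x : linear_form A (r2 i) x = linear_form (drsubmx A) i (dsubmx x).
Proof.
rewrite /linear_form big_split_ord /= [X in X + _]big1 ?add0r.
  by apply: eq_bigr => j _; rewrite !mxE.
move=> j _; have /matrixP/(_ j i) := ur0; rewrite !mxE => ->.
by rewrite mul0r.
Qed.

Lemma linear_formD N (D : 'M[int]_(n, N)) i x y :
  linear_form D i (x + y) = linear_form D i x + linear_form D i y.
Proof. by rewrite /linear_form -big_split; apply: eq_bigr => j _; rewrite mxE mulrDr. Qed.

Lemma linear_formZ N (D : 'M[int]_(n, N)) i (c : R) x :
  linear_form D i (c *: x) = c * linear_form D i x.
Proof. by rewrite /linear_form mulr_sumr; apply: eq_bigr => j _; rewrite mxE mulrCA. Qed.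

Lemma linear_formB N (D : 'M[int]_(n, N)) i x y :
  linear_form D i (x - y) = linear_form D i x - linear_form D i y.
Proof.
by rewrite /linear_form -sumrB; apply: eq_bigr => j _; rewrite !mxE mulrBr.
Qed.

Lemma solve_both (y1 : 'I_(m1 + 1) -> R) (y2 : 'I_(m2 + 1) -> R) :
  \sum_i lam1 i * y1 i = 0 -> \sum_i lam2 i * y2 i = 0 ->
  exists x, [/\ forall i, linear_form A (l1 i) x = y1 i,
    forall i, linear_form A (r2 i) x = y2 i &
    forall e, (forall i, `|y1 i| < e) -> (forall i, `|y2 i| < e) -> forall j, `|x j 0| < e].
Proof.
move=> /(linear_form_solve special1 lam1_gt0 lam1_ker)[x1 [h1 b1]].
move=> /(linear_form_solve special2 lam2_gt0 lam2_ker)[x2 [h2 b2]].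
exists (col_mx x1 x2); split=> [i|i|e e1 e2 j].
- by rewrite linear_form_l col_mxKu.
- by rewrite linear_form_r col_mxKd.
rewrite -(splitK j); case: (fintype.split j) => k /=.
  by rewrite col_mxEu; apply: le_lt_trans (b1 k) (e1 _).
by rewrite col_mxEd; apply: le_lt_trans (b2 k) (e2 _).
Qed.

Lemma linear_forms_inj x : (forall i, linear_form A i x = 0) -> x = 0.
Proof.
move=> h; rewrite -[x]vsubmxK.
rewrite (@linear_form_inj R _ _ special1 (usubmx x)) => [|i]; last by rewrite -linear_form_l h.
rewrite (@linear_form_inj R _ _ special2 (dsubmx x)) => [|i]; last by rewrite -linear_form_r h.
by rewrite col_mx0.
Qed.

Lemma mean_form1 x : \sum_i lam1 i * linear_form A (l1 i) x = 0.
Proof.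
under eq_bigr => i _ do rewrite linear_form_l.
exact: mean_linear_form.
Qed.

Lemma mean_form2 x : \sum_i lam2 i * linear_form A (r2 i) x = 0.
Proof.
under eq_bigr => i _ do rewrite linear_form_r.
exact: mean_linear_form.
Qed.

Lemma mean_phases1 th : mean lam1 (phases1 th) = \sum_i lam1 i * alp (l1 i).
Proof.
rewrite /mean /phases1 /term_arg; under eq_bigr => i _ do rewrite mulrDr.
by rewrite big_split /= mean_form1 addr0.
Qed.

Lemma mean_phases2 th : mean lam2 (phases2 th) = \sum_i lam2 i * alp (r2 i).
Proof.
rewrite /mean /phases2 /term_arg; under eq_bigr => i _ do rewrite mulrDr.
by rewrite big_split /= mean_form2 addr0.
Qed.

(** The weighted means are the only constraint on the phases of the two blocks, and the linear
    system is solved with a bound. *)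
Lemma phases_solve (phi : block1 -> R) (psi : block2 -> R) th0 :
  mean lam1 phi = mean lam1 (phases1 th0) -> mean lam2 psi = mean lam2 (phases2 th0) ->
  exists th, [/\ phases1 th = phi, phases2 th = psi &
    forall e, (forall i, `|phi i - phases1 th0 i| < e) ->
      (forall i, `|psi i - phases2 th0 i| < e) -> forall j, `|th j 0 - th0 j 0| < e].
Proof.
move=> e1 e2.
have [||x [x1 x2 xe]] := @solve_both (fun i => phi i - phases1 th0 i) (fun i => psi i - phases2 th0 i).
- under eq_bigr => i _ do rewrite mulrBr.
  by rewrite sumrB -/(mean lam1 phi) -/(mean lam1 (phases1 th0)) e1 subrr.
- under eq_bigr => i _ do rewrite mulrBr.
  by rewrite sumrB -/(mean lam2 psi) -/(mean lam2 (phases2 th0)) e2 subrr.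
exists (th0 + x); split.
- apply/funext => i; rewrite /phases1 /term_arg linear_formD x1 /phases1 /term_arg; ring.
- apply/funext => i; rewrite /phases2 /term_arg linear_formD x2 /phases2 /term_arg; ring.
- by move=> e h1 h2 j; rewrite mxE addrAC subrr add0r; exact: xe.
Qed.

(** Over a fixed argument the moduli of the terms are exactly those of the prescribed levels: the
    logarithms of |z_j| are found by solving the linear system. *)
Lemma coamoeba_vanishes th :
  coamoeba A f_of (wrap th) <-> vanishes (phases1 th) (phases2 th).
Proof.
rewrite (coamoeba_wrap A (fun i => erefl (f_of i))).
split=> [[x [hc hs]]|[u [u0 ul] [t [[t0 tl] tc ts]]]].
  rewrite big_split_ord /= in hc; rewrite big_split_ord /= in hs.
  exists (fun i => expR (term_log A gam (r2 i) x)).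
    split=> [i|]; first exact: expR_gt0.
    rewrite /= /term_log; under eq_bigr => i _ do rewrite expRK mulrDr.
    by rewrite big_split /= mean_form2 addr0.
  exists (fun i => expR (term_log A gam (l1 i) x)); split.
  - split=> [i|]; first exact: expR_gt0.
    rewrite /= /term_log; under eq_bigr => i _ do rewrite expRK mulrDr.
    by rewrite big_split /= mean_form1 addr0.
  - by apply/eqP; rewrite -addr_eq0; apply/eqP; exact: hc.
  - by apply/eqP; rewrite -addr_eq0; apply/eqP; exact: hs.
have [||x [x1 x2 _]] := @solve_both (fun i => ln (t i) - gam (l1 i)) (fun i => ln (u i) - gam (r2 i)).
- under eq_bigr => i _ do rewrite mulrBr.
  by rewrite sumrB; apply/eqP; rewrite subr_eq0; apply/eqP.
- under eq_bigr => i _ do rewrite mulrBr.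
  by rewrite sumrB; apply/eqP; rewrite subr_eq0; apply/eqP.
have tE i : expR (term_log A gam (l1 i) x) = t i.
  by rewrite /term_log x1 addrC subrK lnK// posrE.
have uE i : expR (term_log A gam (r2 i) x) = u i.
  by rewrite /term_log x2 addrC subrK lnK// posrE.
exists x; split; rewrite big_split_ord /=.
  under eq_bigr => i _ do rewrite tE.
  under [X in _ + X]eq_bigr => i _ do rewrite uE.
  by apply/eqP; rewrite addr_eq0; apply/eqP; exact: tc.
under eq_bigr => i _ do rewrite tE.
under [X in _ + X]eq_bigr => i _ do rewrite uE.
by apply/eqP; rewrite addr_eq0; apply/eqP; exact: ts.
Qed.

Definition form_bound : R := \sum_i \sum_j `|(A j i)%:~R| + 1.

Lemma form_bound_gt0 : 0 < form_bound.
Proof. by apply: ltr_wpDl => //; apply: sumr_ge0 => i _; apply: sumr_ge0. Qed.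

Lemma linear_form_bound i x e : 0 < e -> (forall j, `|x j 0| < e / form_bound) ->
  `|linear_form A i x| < e.
Proof.
move=> e0 hx; have b0 := form_bound_gt0.
have hb : \sum_j `|(A j i)%:~R : R| < form_bound.
  rewrite /form_bound (bigD1 i)//= -addrA ltrDl.
  by apply: ltr_wpDl => //; apply: sumr_ge0 => k _; apply: sumr_ge0.
apply: (@le_lt_trans _ _ ((\sum_j `|(A j i)%:~R : R|) * (e / form_bound))).
  rewrite mulr_suml; apply: le_trans (ler_norm_sum _ _ _) _.
  by apply: ler_sum => j _; rewrite normrM ler_wpM2l// ltW.
rewrite mulrCA -[ltRHS]mulr1 ltr_pM2l// ltr_pdivrMr// mul1r//.
Qed.

Lemma regular_complement th :
  (~` closure (coamoeba A f_of)) (wrap th) <-> regular (phases1 th) (phases2 th).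
Proof.
rewrite closure_wrap; split=> -[e e0 he].
  exists e => // phi psi [m1e n1] [m2e n2] hv.
  have [th' [h1 h2 h3]] := phases_solve m1e m2e.
  apply: (he th'); first exact: h3.
  by apply/coamoeba_vanishes; rewrite h1 h2.
exists (e / form_bound); first by rewrite divr_gt0// form_bound_gt0.
move=> th' hth' /coamoeba_vanishes.
have dE i : term_arg A alp i th' - term_arg A alp i th = linear_form A i (th' - th).
  rewrite /term_arg linear_formB; ring.
apply: he; split; rewrite /= ?mean_phases1 ?mean_phases2// => i;
  by rewrite dE; apply: linear_form_bound => // j; rewrite !mxE.
Qed.

(* t is the critical argument reached from th by contracting the lifted phases
   of both blocks to their means. *)
Definition endpoint th (t : torus R n) : Prop :=
  exists k1 k2 e, [/\ good (turn k1 (phases1 th)) (turn k2 (phases2 th)),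
    turn k1 (phases1 e) = (fun=> mean lam1 (turn k1 (phases1 th))),
    turn k2 (phases2 e) = (fun=> mean lam2 (turn k2 (phases2 th))) & t = wrap e].

(** This describes the critical arguments ([critical_args]). *)
Definition aligned th : Prop :=
  (exists c, forall i, angle (term_arg A alp (l1 i) th) = c) /\
  (exists c, forall i, angle (term_arg A alp (r2 i) th) = c).

Lemma mean_const (T : finType) (lam : T -> R) c : \sum_i lam i = 1 -> mean lam (fun=> c) = c.
Proof. by move=> h; rewrite /mean -mulr_suml h mul1r. Qed.

Lemma mean_turn1 k th th' : mean lam1 (turn k (phases1 th)) = mean lam1 (turn k (phases1 th')).
Proof. by rewrite /turn (mean_add _ (phases1 th)) (mean_add _ (phases1 th')) !mean_phases1. Qed.

Lemma mean_turn2 k th th' : mean lam2 (turn k (phases2 th)) = mean lam2 (turn k (phases2 th')).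
Proof. by rewrite /turn (mean_add _ (phases2 th)) (mean_add _ (phases2 th')) !mean_phases2. Qed.

Lemma endpoint_exists th : regular (phases1 th) (phases2 th) -> exists t, endpoint th t.
Proof.
move=> hreg; have [k1 [k2 hg]] := good_exists hreg.
pose phi i := mean lam1 (turn k1 (phases1 th)) - (k1 i)%:~R * (2 * pi).
pose psi i := mean lam2 (turn k2 (phases2 th)) - (k2 i)%:~R * (2 * pi).
have [||e [e1 e2 _]] := @phases_solve phi psi th.
- rewrite /phi.
  rewrite -[fun i => _ - _]/(fun i => (fun=> mean lam1 (turn k1 (phases1 th))) i + (fun j => - ((k1 j)%:~R * (2 * pi))) i).
  by rewrite mean_add mean_const// mean_opp /turn (mean_add _ (phases1 th)) addrK.
- rewrite /psi.
  rewrite -[fun i => _ - _]/(fun i => (fun=> mean lam2 (turn k2 (phases2 th))) i + (fun j => - ((k2 j)%:~R * (2 * pi))) i).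
  by rewrite mean_add mean_const// mean_opp /turn (mean_add _ (phases2 th)) addrK.
exists (wrap e), k1, k2, e; split=> //.
  by rewrite e1; apply/funext => i; rewrite {1}/turn /phi subrK.
by rewrite e2; apply/funext => i; rewrite {1}/turn /psi subrK.
Qed.

Lemma endpoint_aligned th t : endpoint th t -> exists2 e, t = wrap e & aligned e.
Proof.
move=> [k1 [k2 [e [_ h1 h2 ->]]]]; exists e => //; split.
  exists (angle (mean lam1 (turn k1 (phases1 th)))) => i.
  by apply/eqP/angleP; exists (k1 i); have := congr1 (fun g => g i) h1; rewrite /= => <-.
exists (angle (mean lam2 (turn k2 (phases2 th)))) => i.
by apply/eqP/angleP; exists (k2 i); have := congr1 (fun g => g i) h2; rewrite /= => <-.
Qed.

Lemma angle_const_turn (T : finType) (phi : T -> R) c : (forall i, angle (phi i) = angle c) ->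
  exists k, turn k phi = fun=> c.
Proof.
move=> h; have hk i : exists k : int, c = phi i + k%:~R * (2 * pi).
  by apply/angleP/eqP.
exists (fun i => projT1 (cid (hk i))); apply/funext => i.
by rewrite /turn -(projT2 (cid (hk i))).
Qed.

(** Aligned phases have constant lifts, which the contraction fixes. *)
Lemma endpoint_self th : regular (phases1 th) (phases2 th) -> aligned th -> endpoint th (wrap th).
Proof.
move=> hreg [[c1 h1] [c2 h2]].
have [d1 d1E] := angle_surj c1; have [d2 d2E] := angle_surj c2.
have [|k1 k1E] := @angle_const_turn _ (phases1 th) d1; first by move=> i; rewrite d1E; exact: h1.
have [|k2 k2E] := @angle_const_turn _ (phases2 th) d2; first by move=> i; rewrite d2E; exact: h2.
exists k1, k2, th; rewrite k1E k2E !mean_const//; split=> //.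
apply: good_const; rewrite -k1E -k2E => /vanishes_turn.
exact: regular_not_vanishes.
Qed.

Lemma wrap_shift_phases th th' : wrap th = wrap th' ->
  exists k1 k2, phases1 th' = turn k1 (phases1 th) /\ phases2 th' = turn k2 (phases2 th).
Proof.
move=> /wrapP[k kE].
pose K i := \sum_j A j i * k j.
have KE i : term_arg A alp i th' = term_arg A alp i th + (K i)%:~R * (2 * pi).
  rewrite /term_arg -addrA; congr (_ + _).
  rewrite /linear_form /K rmorph_sum /= mulr_suml -big_split /=; apply: eq_bigr => j _.
  by rewrite kE intrM; ring.
by exists (fun i => K (l1 i)), (fun i => K (r2 i)); split; apply/funext => i; exact: KE.
Qed.

(** Right lifts are unique up to a common turn in each block, so after removing the period [v] the
    linear forms of the difference of the end points are constant on each block. Their weighted mean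
    is 0, so they vanish, and the forms are jointly injective. *)
Lemma endpoint_unique th th' t t' : wrap th = wrap th' ->
  endpoint th t -> endpoint th' t' -> t = t'.
Proof.
move=> e [k1 [k2 [x [hg h1 h2 ->]]]] [k1' [k2' [x' [hg' h1' h2' ->]]]].
have [K1 [K2 [E1 E2]]] := wrap_shift_phases e.
have /wrapP[l lE] := e.
pose v : 'cV[R]_n := \col_j ((l j)%:~R * (2 * pi)).
have thE : th' = th + v by apply/colP => j; rewrite !mxE lE.
have vwrap y : wrap (y + v) = wrap y by apply/esym/wrapP; exists l => j; rewrite !mxE.
have : good (turn (fun i => - k1 i + K1 i + k1' i) (turn k1 (phases1 th)))
            (turn (fun i => - k2 i + K2 i + k2' i) (turn k2 (phases2 th))).
  suff [-> ->] : turn (fun i => - k1 i + K1 i + k1' i) (turn k1 (phases1 th)) = turn k1' (phases1 th') /\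
     turn (fun i => - k2 i + K2 i + k2' i) (turn k2 (phases2 th)) = turn k2' (phases2 th') by [].
  by rewrite E1 E2; split; apply/funext => i; rewrite /turn !intrD mulrNz; ring.
move=> /(good_unique hg)[u1 u2].
have LE y i : term_arg A alp i (y + v) - term_arg A alp i y = term_arg A alp i th' - term_arg A alp i th.
  by rewrite thE /term_arg !linear_formD; ring.
pose o1 : block1 := rshift m1 (0 : 'I_1); pose o2 : block2 := rshift m2 (0 : 'I_1).
have D1 : exists c, forall i, linear_form A (l1 i) (x' - v - x) = c.
  exists (mean lam1 (turn k1' (phases1 th')) - mean lam1 (turn k1 (phases1 th))
    - (- k1 o1 + K1 o1 + k1' o1)%:~R * (2 * pi)) => i.
  rewrite -(u1 i o1).
  have a1 := congr1 (fun g => g i) h1; have a2 := congr1 (fun g => g i) h1'.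
  rewrite /turn /= in a1 a2; rewrite -[mean lam1 (turn k1' _)]a2 -[mean lam1 (turn k1 _)]a1.
  have b1 := congr1 (fun g => g i) E1; rewrite /turn /= in b1.
  have b2 := LE (x' - v) (l1 i); rewrite subrK in b2.
  rewrite -/(phases1 th' i) b1 in b2.
  rewrite linear_formB !intrD mulrNz.
  move: b2; rewrite /phases1 /term_arg; lra.
have D2 : exists c, forall i, linear_form A (r2 i) (x' - v - x) = c.
  exists (mean lam2 (turn k2' (phases2 th')) - mean lam2 (turn k2 (phases2 th))
    - (- k2 o2 + K2 o2 + k2' o2)%:~R * (2 * pi)) => i.
  rewrite -(u2 i o2).
  have a1 := congr1 (fun g => g i) h2; have a2 := congr1 (fun g => g i) h2'.
  rewrite /turn /= in a1 a2; rewrite -[mean lam2 (turn k2' _)]a2 -[mean lam2 (turn k2 _)]a1.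
  have b1 := congr1 (fun g => g i) E2; rewrite /turn /= in b1.
  have b2 := LE (x' - v) (r2 i); rewrite subrK in b2.
  rewrite -/(phases2 th' i) b1 in b2.
  rewrite linear_formB !intrD mulrNz.
  move: b2; rewrite /phases2 /term_arg; lra.
have z : x' - v - x = 0.
  apply: linear_forms_inj => i; rewrite -(splitK i); case: (fintype.split i) => k /=.
    have [c hc] := D1; have := mean_form1 (x' - v - x).
    under eq_bigr => j _ do rewrite hc.
    by rewrite -mulr_suml lam1_sum mul1r hc.
  have [c hc] := D2; have := mean_form2 (x' - v - x).
  under eq_bigr => j _ do rewrite hc.
  by rewrite -mulr_suml lam2_sum mul1r hc.
have -> : x' = x + v.
  by move/eqP: z; rewrite subr_eq0 subr_eq => /eqP.
by rewrite vwrap.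
Qed.

(** The same turns remain right nearby, and the means do not depend on the point, so the very same
    end point serves. *)
Lemma endpoint_near th t : regular (phases1 th) (phases2 th) -> endpoint th t ->
  exists2 e : R, 0 < e & forall th' : 'cV[R]_n, (forall j, `|th' j 0 - th j 0| < e) -> endpoint th' t.
Proof.
move=> hreg [k1 [k2 [x [hg h1 h2 tE]]]].
have [e e0 he] := good_near (regular_turn k1 k2 hreg) hg.
exists (e / form_bound); first by rewrite divr_gt0// form_bound_gt0.
move=> th' hth'.
have dE i : term_arg A alp i th' - term_arg A alp i th = linear_form A i (th' - th).
  rewrite /term_arg linear_formB; ring.
have dlt i : `|term_arg A alp i th' - term_arg A alp i th| < e.
  by rewrite dE; apply: linear_form_bound => // j; rewrite !mxE.
exists k1, k2, x; split=> //; last 2 first.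
- by rewrite h1 (mean_turn1 k1 th th').
- by rewrite h2 (mean_turn2 k2 th th').
apply: (proj2 (he _ _ _ _)); split.
- exact: mean_turn1.
- move=> i; rewrite /turn opprD addrACA subrr addr0; exact: dlt.
- exact: mean_turn2.
- move=> i; rewrite /turn opprD addrACA subrr addr0; exact: dlt.
Qed.

Lemma block_cards : (1 < #|block1|)%N || (1 < #|block2|)%N.
Proof. by rewrite /block1 /block2 /= !card_ord; move: size_gt0; lia. Qed.

(** Along the segment to the end point the lifted phases are exactly the contractions of the initial
    ones, which stay regular. *)
Lemma endpoint_component th t : regular (phases1 th) (phases2 th) -> endpoint th t ->
  connected_component (~` closure (coamoeba A f_of)) (wrap th) t.
Proof.
move=> hreg [k1 [k2 [e [hg h1 h2 tE]]]].
pose S := (fun s : R => wrap ((1 - s) *: th + s *: e)) @` [set` `[0 : R, 1]].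
exists S; last first.
  by exists 1; rewrite /= ?in_itv/= ?ler01 ?lexx// subrr scale0r scale1r add0r.
split.
- by exists 0; rewrite /= ?in_itv/= ?ler01 ?lexx// subr0 scale0r scale1r addr0.
- move=> _ [s s01 <-]; rewrite /= in_itv /= in s01.
  apply/regular_complement.
  have pE i : term_arg A alp i ((1 - s) *: th + s *: e) =
     (1 - s) * term_arg A alp i th + s * term_arg A alp i e.
    by rewrite /term_arg linear_formD !linear_formZ; ring.
  have := regular_contract block_cards s01 (regular_turn k1 k2 hreg) hg.
  have <- : turn k1 (phases1 ((1 - s) *: th + s *: e)) = contract lam1 s (turn k1 (phases1 th)).
    apply/funext => i; rewrite /contract -(congr1 (fun g => g i) h1) /turn.
    rewrite /phases1 pE; ring.
  have <- : turn k2 (phases2 ((1 - s) *: th + s *: e)) = contract lam2 s (turn k2 (phases2 th)).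
    apply/funext => i; rewrite /contract -(congr1 (fun g => g i) h2) /turn.
    rewrite /phases2 pE; ring.
  move/(regular_turn (fun i => - k1 i) (fun i => - k2 i)).
  by rewrite !turnK.
- exact: connected_wrap_segment.
Qed.

Lemma aligned_one_per_component :
  one_per_component (~` closure (coamoeba A f_of)) [set wrap th | th in aligned].
Proof.
set U := ~` _ => K [u Uu <-].
have [th thE] := wrap_surj u; subst u.
have hreg : regular (phases1 th) (phases2 th) by exact/regular_complement.
have [t ht] := endpoint_exists hreg.
exists t; split.
  split; last exact: endpoint_component.
  by have [e -> he] := endpoint_aligned ht; exists e.
move=> t' [[th' al' <-] hK].
have U' : U (wrap th') by exact: connected_component_sub hK.
have hreg' : regular (phases1 th') (phases2 th') by exact/regular_complement.
have ht' := endpoint_self hreg' al'.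
(* The points of [U] with an endpoint in [P]. Such sets are open, and those of {t} and of its
   complement partition [U], so the component of [wrap th] lies in the first of them. *)
pose S (P : set (torus R n)) := [set x | U x /\ exists th0 t0, [/\ x = wrap th0, endpoint th0 t0 & P t0]].
have S_open P : open (S P).
  apply: open_wrap => th0 [U0 [th1 [t0 [e hend Pt]]]].
  have reg1 : regular (phases1 th1) (phases2 th1) by apply/regular_complement; rewrite -e.
  have oU : open U by apply: closed_openC; exact: closed_closure.
  have [e1 e10 he1] : exists2 e : R, 0 < e & forall th' : 'cV[R]_n, (forall j, `|th' j 0 - th1 j 0| < e) -> U (wrap th').
    by apply/nbhs_wrap; rewrite -e; exact: open_nbhs_nbhs.
  have [e2 e20 he2] := endpoint_near reg1 hend.
  have /wrapP[k kE] := e.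
  exists (Num.min e1 e2); first by rewrite lt_min e10.
  move=> th2 hth2.
  pose th3 : 'cV[R]_n := \col_j (th2 j 0 + (k j)%:~R * (2 * pi)).
  have th3E : wrap th2 = wrap th3 by apply/wrapP; exists k => j; rewrite mxE.
  have th3d j : `|th3 j 0 - th1 j 0| < Num.min e1 e2.
    by rewrite mxE kE opprD addrACA subrr addr0.
  rewrite th3E; split.
    by apply: he1 => j; apply: lt_le_trans (th3d j) _; rewrite ge_min lexx.
  exists th3, t0; split=> //.
  by apply: he2 => j; apply: lt_le_trans (th3d j) _; rewrite ge_min lexx orbT.
pose Kc := connected_component U (wrap th).
have KE : Kc `&` S [set t] = Kc.
  apply: (@component_connected _ U (wrap th)).
  - exists (wrap th); split; first exact: connected_component_refl.
    by split=> //; exists th, t.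
  - by exists (S [set t]).
  - exists (~` S (~` [set t])); first exact: open_closedC.
    apply/seteqP; split=> x [Kx].
      move=> [Ux [th0 [t0 [xE h0 t0E]]]]; split=> // -[_ [th1 [t1 [xE1 h1 t1n]]]].
      apply: t1n; rewrite -t0E /=; apply/esym.
      by apply: endpoint_unique h0 h1; rewrite -xE.
    move=> nS; split=> //.
    have Ux : U x by exact: connected_component_sub Kx.
    split=> //; have [th0 xE] := wrap_surj x; subst x.
    have [t0 h0] : exists t0, endpoint th0 t0 by apply: endpoint_exists; exact/regular_complement.
    exists th0, t0; split=> //.
    by apply: contrapT => tn; apply: nS; split=> //; exists th0, t0.
have : (Kc `&` S [set t]) (wrap th') by rewrite KE.
move=> [_ [_ [th0 [t0 [e h0 t0E]]]]].
by rewrite -t0E; apply: endpoint_unique h0 ht'.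
Qed.

End Orthogonal.

(** * Critical points and aligned phases *)

Section Critical.
Variables (R : realType) (m1 m2 : nat).
Variables (A : 'M[int]_(m1 + m2, (m1 + 1) + (m2 + 1))).
Variables (gam alp : 'I_((m1 + 1) + (m2 + 1)) -> R).
Variables (lam1 : 'I_(m1 + 1) -> R) (lam2 : 'I_(m2 + 1) -> R).
Hypothesis special1 : special_block (ulsubmx A).
Hypothesis special2 : special_block (drsubmx A).
Hypothesis ur0 : ursubmx A = 0.
Hypothesis dl0 : dlsubmx A = 0.
Hypothesis lam1_gt0 : forall i, 0 < lam1 i.
Hypothesis lam2_gt0 : forall i, 0 < lam2 i.
Hypothesis lam1_sum : \sum_i lam1 i = 1.
Hypothesis lam2_sum : \sum_i lam2 i = 1.
Hypothesis lam1_ker : forall j, \sum_i lam1 i * (ulsubmx A j i)%:~R = 0.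
Hypothesis lam2_ker : forall j, \sum_i lam2 i * (drsubmx A j i)%:~R = 0.

Let n := (m1 + m2)%N.
Implicit Types (x th : 'cV[R]_n).

Let l1 := lshift (m2 + 1) : 'I_(m1 + 1) -> 'I_((m1 + 1) + (m2 + 1)).
Let r2 := @rshift (m1 + 1) (m2 + 1) : 'I_(m2 + 1) -> 'I_((m1 + 1) + (m2 + 1)).

Lemma row_sum_l j (T : 'I_((m1 + 1) + (m2 + 1)) -> R[i]) :
  \sum_i (A (lshift m2 j) i)%:~R * T i = \sum_i (ulsubmx A j i)%:~R * T (l1 i).
Proof.
rewrite big_split_ord /= [X in _ + X]big1 ?addr0.
  by apply: eq_bigr => i _; rewrite !mxE.
move=> i _; have /matrixP/(_ j i) := ur0; rewrite !mxE => ->.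
by rewrite mul0r.
Qed.

Lemma row_sum_r j (T : 'I_((m1 + 1) + (m2 + 1)) -> R[i]) :
  \sum_i (A (rshift m1 j) i)%:~R * T i = \sum_i (drsubmx A j i)%:~R * T (r2 i).
Proof.
rewrite big_split_ord /= [X in X + _]big1 ?add0r.
  by apply: eq_bigr => i _; rewrite !mxE.
move=> i _; have /matrixP/(_ j i) := dl0; rewrite !mxE => ->.
by rewrite mul0r.
Qed.

(** Aligned terms with moduli proportional to the weights are a multiple of the Gale relation. *)
Lemma weighted_row_zero m (C : 'M[int]_(m, m + 1)) (lam phi : 'I_(m + 1) -> R) c a j :
  (forall i, 0 < lam i) -> (forall j, \sum_i lam i * (C j i)%:~R = 0) ->
  (forall i, angle (phi i) = angle a) ->
  \sum_i (C j i)%:~R * polar (ln (lam i) + c) (phi i) = 0 :> R[i].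
Proof.
move=> lam0 lamC ang.
have tE i : (C j i)%:~R * polar (ln (lam i) + c) (phi i) =
    (lam i * (C j i)%:~R)%:C%C * polar c a.
  have /eqP/angleP[k aE] := ang i.
  have -> : polar (ln (lam i) + c) (phi i) = polar (ln (lam i) + c) (0 + a).
    by rewrite add0r aE polar_turn.
  rewrite polarD rmorphM rmorph_int /=.
  have -> : polar (ln (lam i)) 0 = (lam i)%:C%C.
    by rewrite /polar lnK ?posrE// cos0 sin0 mulr1 mulr0.
  by rewrite !mulrA; congr (_ * _); rewrite mulrC.
under eq_bigr => i _ do rewrite tE.
by rewrite -mulr_suml -rmorph_sum /= lamC mul0r.
Qed.

Lemma critical_args :
  [set Arg z | z in critical_points A (f_of gam alp)] =
  [set wrap th | th in aligned A alp].
Proof.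
apply/seteqP; split=> [_ [z [hz crit] <-]|_ [th [[c1 h1] [c2 h2]] <-]].
  have [x [th zE]] := algebraic_torus_polar hz; subst z.
  rewrite Arg_polar; exists th => //.
  have crit' j : \sum_i (A j i)%:~R * polar (term_log A gam i x) (term_arg A alp i th) = 0.
    have := crit j; rewrite (partial_polar A (fun i => erefl (f_of gam alp i))) => /eqP.
    by rewrite mulf_eq0 invr_eq0 (negbTE (polar_neq0 _ _)) /= => /eqP.
  split.
    exists (angle (term_arg A alp (l1 (rshift m1 0)) th)) => i.
    apply: (@kernel_same_arg R m1 (ulsubmx A) lam1 special1 lam1_gt0 lam1_ker
      (fun i => term_log A gam (l1 i) x) (fun i => term_arg A alp (l1 i) th)) => j.
    by rewrite -[RHS](crit' (lshift m2 j)) row_sum_l.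
  exists (angle (term_arg A alp (r2 (rshift m2 0)) th)) => i.
  apply: (@kernel_same_arg R m2 (drsubmx A) lam2 special2 lam2_gt0 lam2_ker
    (fun i => term_log A gam (r2 i) x) (fun i => term_arg A alp (r2 i) th)) => j.
  by rewrite -[RHS](crit' (rshift m1 j)) row_sum_r.
have [a1 a1E] := angle_surj c1; have [a2 a2E] := angle_surj c2.
(* The factor that gives the moduli lam_i e^k1 the level of the block, so that the linear system is
   solvable. *)
pose k1 := \sum_i lam1 i * (gam (l1 i) - ln (lam1 i)).
pose k2 := \sum_i lam2 i * (gam (r2 i) - ln (lam2 i)).
have [||x [x1 x2 _]] := solve_both special1 special2 ur0 dl0 lam1_gt0 lam2_gt0 lam1_ker lam2_ker
   (y1 := fun i => ln (lam1 i) + k1 - gam (l1 i)) (y2 := fun i => ln (lam2 i) + k2 - gam (r2 i)).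
- transitivity (\sum_i (lam1 i * k1 - lam1 i * (gam (l1 i) - ln (lam1 i)))).
    by apply: eq_bigr => i _; ring.
  by rewrite sumrB -mulr_suml lam1_sum mul1r subrr.
- transitivity (\sum_i (lam2 i * k2 - lam2 i * (gam (r2 i) - ln (lam2 i)))).
    by apply: eq_bigr => i _; ring.
  by rewrite sumrB -mulr_suml lam2_sum mul1r subrr.
exists (polar_point x th); last exact: Arg_polar.
split; first exact: polar_point_torus.
move=> j; rewrite (partial_polar A (fun i => erefl (f_of gam alp i))).
suff -> : \sum_i (A j i)%:~R * polar (term_log A gam i x) (term_arg A alp i th) = 0 by rewrite mulr0.
rewrite -(splitK j); case: (fintype.split j) => k /=.
  rewrite row_sum_l -[RHS](@weighted_row_zero m1 (ulsubmx A) lam1 (fun i => term_arg A alp (l1 i) th) k1 a1 k)//.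
    by apply: eq_bigr => i _; rewrite /term_log x1; congr (_ * polar _ _); ring.
  by move=> i; rewrite a1E.
rewrite row_sum_r -[RHS](@weighted_row_zero m2 (drsubmx A) lam2 (fun i => term_arg A alp (r2 i) th) k2 a2 k)//.
  by apply: eq_bigr => i _; rewrite /term_log x2; congr (_ * polar _ _); ring.
by move=> i; rewrite a2E.
Qed.

End Critical.

(** * Number of critical arguments *)

Section Counting.
Variables (R : realType) (n : nat).

Definition real_mx m k (D : 'M[int]_(m, k)) : 'M[R]_(m, k) := map_mx intr D.

Lemma real_mxM m k l (D : 'M[int]_(m, k)) (E : 'M[int]_(k, l)) :
  real_mx (D *m E) = real_mx D *m real_mx E.
Proof. exact: map_mxM. Qed.

Lemma wrap_intP (x y : 'cV[R]_n) :
  wrap x = wrap y <-> exists k : 'cV[int]_n, y = x + (2 * pi) *: real_mx k.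
Proof.
split=> [/wrapP[k kE]|[k ->]].
  exists (\col_j k j); apply/colP => j; rewrite kE !mxE; ring.
by apply/wrapP; exists (fun j => k j 0) => j; rewrite !mxE; ring.
Qed.

Lemma absz_det_unit (L : 'M[int]_n) : L \in unitmx -> `|\det L|%N = 1%N.
Proof.
move=> uL; have : `|\det (L *m invmx L)|%N = 1%N by rewrite mulmxV// det1.
by rewrite det_mulmx abszM => /eqP; rewrite muln_eq1 => /andP[/eqP].
Qed.

Lemma card_eq_finType (F : finType) : ([set: F] #= `I_#|F|)%card.
Proof.
have := @inj_card_eq F nat [set: F] (fun x => nat_of_ord (enum_rank x)).
have -> : [set nat_of_ord (enum_rank x) | x in [set: F]] = `I_#|F|.
  apply/seteqP; split=> [_ [x _ <-]|k /= hk]; first exact: ltn_ord.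
  by exists (enum_val (Ordinal hk)) => //; rewrite enum_valK.
rewrite card_eq_sym; apply => x y _ _ /ord_inj; exact: enum_rank_inj.
Qed.

(** Unimodular changes of coordinates preserve the lattice 2 pi Z^n, so the Smith form leaves
    independent congruences d_i y_i = c'_i modulo 2 pi, each with |d_i| solutions modulo 2 pi. *)
Lemma card_congruence_solutions (D : 'M[int]_n) (c : 'cV[R]_n) : \det D != 0 ->
  ([set wrap x | x in [set x : 'cV[R]_n |
     exists k : 'cV[int]_n, real_mx D *m x = c + (2 * pi) *: real_mx k]]
   #= `I_(`|\det D|%N))%card.
Proof.
move=> detD.
have [L uL [Q uQ [d _ DE]]] := int_Smith_normal_form D.
pose e : 'rV[int]_n := \row_i d`_i.
pose S : 'M[int]_n := diag_mx e.
have {}DE : D = L *m S *m Q.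
  rewrite DE /S; congr (_ *m _ *m _); apply/matrixP => i j; rewrite !mxE.
  by [].
have absD : `|\det D|%N = (\prod_i `|(d`_(i : 'I_n))%R|)%N.
  rewrite DE !det_mulmx !abszM (absz_det_unit uL) (absz_det_unit uQ) mul1n muln1 det_diag.
  transitivity (\prod_(i < n) `|e 0%R i|)%N.
    by elim/big_rec2 : _ => // i u v _ <-; rewrite abszM.
  by apply: eq_bigr => i _; rewrite mxE.
have d0 i : d`_(i : 'I_n) != 0.
  apply: contraNneq detD => di; rewrite -absz_eq0 absD.
  by apply/eqP/eqP; rewrite (bigD1 i)//= di.
have p0 : 2 * (pi : R) != 0 by rewrite gt_eqF//; have := pi_gt0 R; lra.
have LK : real_mx (invmx L) *m real_mx L = 1%:M by rewrite -real_mxM mulVmx// /real_mx map_mx1.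
have LK' : real_mx L *m real_mx (invmx L) = 1%:M by rewrite -real_mxM mulmxV// /real_mx map_mx1.
have QK : real_mx (invmx Q) *m real_mx Q = 1%:M by rewrite -real_mxM mulVmx// /real_mx map_mx1.
have QK' : real_mx Q *m real_mx (invmx Q) = 1%:M by rewrite -real_mxM mulmxV// /real_mx map_mx1.
pose c' := real_mx (invmx L) *m c.
pose F := {dffun forall i : 'I_n, 'I_(`|(d`_i)%R|%N)}.
pose y (k : 'I_n -> int) : 'cV[R]_n := \col_i ((c' i 0 + 2 * pi * (k i)%:~R) / (d`_i)%:~R).
pose sol (h : F) := wrap (real_mx (invmx Q) *m y (fun i => (h i : nat)%:Z)).
have dR i : (d`_(i : 'I_n))%:~R != 0 :> R by rewrite intr_eq0.
have Sy k : real_mx S *m y k = c' + (2 * pi) *: (\col_i (k i)%:~R).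
  apply/colP => i; rewrite mxE (bigD1 i)//= big1 => [|j ji].
    by rewrite addr0 !mxE eqxx mulr1n mulrC divfK.
  by rewrite !mxE eq_sym (negbTE ji) mulr0n mul0r.
have solE : [set wrap x | x in [set x : 'cV[R]_n |
     exists k : 'cV[int]_n, real_mx D *m x = c + (2 * pi) *: real_mx k]] = sol @` [set: F].
  apply/seteqP; split=> [_ [x [k xk] <-]|_ [h _ <-]]; last first.
    exists (real_mx (invmx Q) *m y (fun i => (h i : nat)%:Z)) => //.
    exists (L *m \col_i (h i : nat)%:Z).
    rewrite DE !real_mxM mulmxA -[_ *m real_mx Q *m _]mulmxA QK' mulmx1 -mulmxA Sy mulmxDr.
    rewrite /c' mulmxA LK' mul1mx -scalemxAr; congr (_ + _ *: (_ *m _)).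
    by apply/colP => i; rewrite !mxE.
  pose k' := invmx L *m k; pose kk (i : 'I_n) : int := k' i 0.
  have Sx : real_mx S *m (real_mx Q *m x) = c' + (2 * pi) *: real_mx k'.
    have : real_mx (invmx L) *m (real_mx D *m x) = c' + (2 * pi) *: real_mx k'.
      by rewrite xk mulmxDr -scalemxAr -real_mxM.
    by rewrite DE !real_mxM !mulmxA LK mul1mx.
  have xE i : (real_mx Q *m x) i 0 = (c' i 0 + 2 * pi * (kk i)%:~R) / (d`_i)%:~R.
    have /colP/(_ i) := Sx; rewrite mxE (bigD1 i)//= big1 => [|j ji].
      rewrite addr0 [real_mx S i i]mxE [S i i]mxE eqxx mulr1n [e 0 i]mxE => ei.
      have {}ei : (d`_i)%:~R * (real_mx Q *m x) i 0 = c' i 0 + 2 * pi * (kk i)%:~R.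
        by rewrite ei [LHS]mxE; congr (_ + _); rewrite mxE; congr (_ * _); rewrite mxE.
      by rewrite -ei mulrC mulKf.
    by rewrite !mxE eq_sym (negbTE ji) mulr0n mul0r.
  (* The remainder modulo d_i selects the representative; the quotient only adds a multiple of 2
     pi. *)
  have hb i : (`|(kk i %% d`_i)%Z|%N < `|(d`_(i : 'I_n))%R|%N)%N.
    have := ltz_mod (kk i) (d0 i); have := modz_ge0 (kk i) (d0 i); lia.
  pose h : F := [ffun i => Ordinal (hb i)].
  exists h => //; apply/wrap_intP.
  exists (invmx Q *m \col_i (kk i %/ d`_i)%Z).
  rewrite real_mxM scalemxAr -mulmxDr.
  have <- : real_mx Q *m x = y (fun i => (h i : nat)%:Z) + 2 * pi *: real_mx (\col_i (kk i %/ d`_i)%Z).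
    apply/colP => i; rewrite xE !mxE ffunE /=.
    have -> : (`|(kk i %% d`_i)%Z|%N)%:Z = (kk i %% d`_i)%Z by rewrite gez0_abs// modz_ge0.
    rewrite {1}(divz_eq (kk i) d`_i) intrD intrM; field.
    exact: dR.
  by rewrite mulmxA QK mul1mx.
rewrite solE absD.
have -> : (\prod_i `|(d`_(i : 'I_n))%R|)%N = #|F|.
  rewrite card_dep_ffun foldrE big_map big_enum /=.
  by apply: eq_bigr => i _; rewrite card_ord.
apply: card_eq_trans (card_eq_finType F).
apply: inj_card_eq => h1 h2 _ _ /wrap_intP[k].
move=> he; apply/ffunP => i; apply/val_inj => /=.
have : y (fun i => (h2 i : nat)%:Z) = y (fun i => (h1 i : nat)%:Z) + 2 * pi *: real_mx (Q *m k).
  have := congr1 (mulmx (real_mx Q)) he.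
  by rewrite mulmxDr !mulmxA QK' !mul1mx -scalemxAr -real_mxM.
move=> /colP/(_ i); rewrite !mxE; set z := (\sum_j _).
have -> : \sum_j Q i j * k j 0 = (Q *m k) i 0 by rewrite mxE.
move: ((Q *m k) i 0) => q hq.
have : ((h2 i : nat)%:Z - (h1 i : nat)%:Z)%:~R = (q * d`_i)%:~R :> R.
  rewrite intrB intrM; apply: (mulfI p0).
  have dRi := dR i.
  have : (z + 2 * pi * (h2 i : nat)%:Z%:~R) = (z + 2 * pi * (h1 i : nat)%:Z%:~R) + 2 * pi * q%:~R * (d`_i)%:~R.
    rewrite -[LHS](divfK dRi) hq mulrDl divfK//.
  by move=> e2; rewrite mulrBr; lra.
move=> /intr_inj e2.
have b1 := ltn_ord (h1 i); have b2 := ltn_ord (h2 i).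
have q0 : q = 0.
  apply/eqP; rewrite -absz_eq0 -leqn0 -ltnS -(@ltn_pmul2r `|(d`_i)%R|) ?absz_gt0//.
  rewrite -abszM -e2 mul1n; lia.
by move: e2; rewrite q0 mul0r => /eqP; rewrite subr_eq0 => /eqP[->].
Qed.

End Counting.

Section Determinant.
Variable R : realType.

(** The normalized volume of the simplex with vertices -p_i e_i and a. *)
Definition simplex_volume m (p a : 'I_m -> R) : R := (\prod_i p i) * (1 + \sum_i a i / p i).

(** The matrix determinant lemma: the bordered matrix [M] is brought to block triangular form in two
    ways. *)
Lemma det_diag_plus_rank1 m (p a : 'I_m -> R) : (forall i, 0 < p i) ->
  \det (\matrix_(i, j) (p i *+ (i == j) + a j) : 'M[R]_m) = simplex_volume p a.
Proof.
move=> p0; pose P : 'M[R]_m := diag_mx (\row_i p i).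
pose ra : 'rV[R]_m := \row_j a j; pose u : 'cV[R]_m := const_mx 1.
pose M : 'M[R]_(1 + m) := block_mx 1%:M (- ra) u P.
have h1 : M *m block_mx 1%:M ra 0 1%:M = block_mx 1%:M 0 u (\matrix_(i, j) (p i *+ (i == j) + a j)).
  rewrite mulmx_block !mulmx1 !mulmx0 !mul1mx !addr0 addrN; congr block_mx.
  apply/matrixP => i j; rewrite !mxE big_ord1 !mxE mul1r addrC; congr (_ + _).
have h2 : M *m block_mx 1%:M 0 (\col_i - (p i)^-1) 1%:M =
    block_mx (1 + \sum_i a i / p i)%:M (- ra) 0 P.
  rewrite mulmx_block !mulmx1 !mulmx0 !add0r ?addr0; congr block_mx.
    apply/matrixP => i j; rewrite !ord1 !mxE eqxx mulr1n; congr (_ + _).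
    by apply: eq_bigr => k _; rewrite !mxE mulrNN.
  apply/matrixP => i j; rewrite !ord1 !mxE (bigD1 i)//= big1 => [|k ki].
    by rewrite !mxE eqxx mulr1n mulrN mulfV ?gt_eqF// addr0 subrr.
  by rewrite !mxE eq_sym (negbTE ki) mulr0n mul0r.
have := congr1 determinant h1; have := congr1 determinant h2.
rewrite !det_mulmx !det_lblock !det_ublock !det1 !mulr1 !mul1r => -> <-.
rewrite det_scalar1 det_diag mulrC /simplex_volume; congr (_ * _).
by apply: eq_bigr => i _; rewrite mxE.
Qed.

End Determinant.

(** * Alignment as a system of congruences *)

Section CountAligned.
Variables (R : realType) (m1 m2 : nat).
Variables (A : 'M[int]_(m1 + m2, (m1 + 1) + (m2 + 1))).
Variables (alp : 'I_((m1 + 1) + (m2 + 1)) -> R).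
Hypothesis ur0 : ursubmx A = 0.
Hypothesis dl0 : dlsubmx A = 0.
Variables (p1 : 'rV[int]_m1) (p2 : 'rV[int]_m2).
Hypothesis p1E : lsubmx (ulsubmx A) = - diag_mx p1.
Hypothesis p2E : lsubmx (drsubmx A) = - diag_mx p2.
Hypothesis p1_gt0 : forall i, 0 < p1 0 i.
Hypothesis p2_gt0 : forall i, 0 < p2 0 i.

Let n := (m1 + m2)%N.

(** Row i is the edge from the i-th vertex to the last one; alignment means that phase differences
    along all edges are 0 modulo 2 pi. *)
Definition edge_matrix m (C : 'M[int]_(m, m + 1)) : 'M[int]_m :=
  \matrix_(i, j) (C j (rshift m 0) - C j (lshift 1 i)).

Definition edges : 'M[int]_n := block_mx (edge_matrix (ulsubmx A)) 0 0 (edge_matrix (drsubmx A)).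

Lemma edge_row m (C : 'M[int]_(m, m + 1)) i (x : 'cV[R]_m) :
  (real_mx R (edge_matrix C) *m x) i 0 = linear_form C (rshift m 0) x - linear_form C (lshift 1 i) x.
Proof.
rewrite mxE /linear_form -sumrB; apply: eq_bigr => j _.
by rewrite !mxE intrB mulrBl.
Qed.

Lemma det_edge_matrix m (C : 'M[int]_(m, m + 1)) (p : 'rV[int]_m) :
  lsubmx C = - diag_mx p -> (forall i, 0 < p 0 i) ->
  (\det (edge_matrix C))%:~R =
  simplex_volume (fun i => (p 0 i)%:~R) (fun i => (C i (rshift m 0))%:~R) :> R.
Proof.
move=> pE p0; rewrite -det_diag_plus_rank1 => [|i]; last by rewrite ltr0z.
rewrite -det_map_mx; congr (\det _); apply/matrixP => i j; rewrite !mxE.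
have /matrixP/(_ j i) := pE; rewrite !mxE => ->.
by rewrite opprK rmorphD addrC eq_sym rmorphMn /=; case: eqVneq => [->|].
Qed.

Lemma aligned_congruence :
  aligned A alp = [set x : 'cV[R]_n | exists k : 'cV[int]_n, real_mx R edges *m x =
     col_mx (\col_i (alp (lshift _ (lshift 1 i)) - alp (lshift _ (rshift m1 0))))
            (\col_i (alp (rshift _ (lshift 1 i)) - alp (rshift _ (rshift m2 0))))
     + (2 * pi) *: real_mx R k].
Proof.
have rowE x : real_mx R edges *m x =
   col_mx (real_mx R (edge_matrix (ulsubmx A)) *m usubmx x)
          (real_mx R (edge_matrix (drsubmx A)) *m dsubmx x).
  rewrite /edges /real_mx map_block_mx !raddf0 -{1}[x]vsubmxK mul_block_col.
  by rewrite !mul0mx addr0 add0r.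
apply/seteqP; split=> x /=; rewrite rowE.
  move=> [[c1 h1] [c2 h2]].
  have e1 i : exists k : int, term_arg A alp (lshift _ (rshift m1 0)) x =
      term_arg A alp (lshift _ (lshift 1 i)) x + k%:~R * (2 * pi).
    by apply/angleP; rewrite h1 h1.
  have e2 i : exists k : int, term_arg A alp (rshift _ (rshift m2 0)) x =
      term_arg A alp (rshift _ (lshift 1 i)) x + k%:~R * (2 * pi).
    by apply/angleP; rewrite h2 h2.
  exists (col_mx (\col_i projT1 (cid (e1 i))) (\col_i projT1 (cid (e2 i)))).
  rewrite /real_mx map_col_mx scale_col_mx add_col_mx.
  congr col_mx; apply/colP => i.
    rewrite edge_row ![in RHS]mxE -!(linear_form_l dl0).
    have := projT2 (cid (e1 i)); rewrite /term_arg /=; lra.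
  rewrite edge_row ![in RHS]mxE -!(linear_form_r ur0).
  have := projT2 (cid (e2 i)); rewrite /term_arg /=; lra.
move=> [k]; rewrite -[k]vsubmxK /real_mx map_col_mx scale_col_mx add_col_mx.
move=> /eq_col_mx[/colP e1 /colP e2]; split.
  exists (angle (term_arg A alp (lshift _ (rshift m1 0)) x)) => i.
  rewrite -(splitK i); case: (fintype.split i) => j /=; last by rewrite ord1.
  apply/eqP/angleP; exists (usubmx k j 0).
  have := e1 j; rewrite edge_row ![in RHS]mxE -!(linear_form_l dl0) /term_arg.
  rewrite [usubmx k j 0]mxE; lra.
exists (angle (term_arg A alp (rshift _ (rshift m2 0)) x)) => i.
rewrite -(splitK i); case: (fintype.split i) => j /=; last by rewrite ord1.
apply/eqP/angleP; exists (dsubmx k j 0).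
have := e2 j; rewrite edge_row ![in RHS]mxE -!(linear_form_r ur0) /term_arg.
rewrite [dsubmx k j 0]mxE; lra.
Qed.

Lemma det_edges : (\det edges)%:~R =
  simplex_volume (fun i => (p1 0 i)%:~R) (fun i => (ulsubmx A i (rshift m1 0))%:~R) *
  simplex_volume (fun i => (p2 0 i)%:~R) (fun i => (drsubmx A i (rshift m2 0))%:~R) :> R.
Proof.
rewrite /edges det_ublock intrM.
by rewrite (det_edge_matrix p1E p1_gt0) (det_edge_matrix p2E p2_gt0).
Qed.

Lemma card_aligned : \det edges != 0 ->
  ([set wrap x | x in aligned A alp] #= `I_(`|\det edges|%N))%card.
Proof. by move=> h; rewrite aligned_congruence; exact: card_congruence_solutions. Qed.

End CountAligned.

(** * Volume of the Newton polytope *)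

Section PowerIntegrals.
Variable R : realType.
Notation mu := (@lebesgue_measure R).

Lemma factS_neq0 n : (n`!%:R : R) != 0.
Proof. by rewrite pnatr_eq0 -lt0n fact_gt0. Qed.

Lemma integral_affine_power n (a b alpha beta : R) : b != 0 -> alpha <= beta ->
  (\int[mu]_(t in `[alpha, beta]) ((a + b * t) ^+ n / n`!%:R)%:E =
   (((a + b * beta) ^+ n.+1 - (a + b * alpha) ^+ n.+1) / (b * n.+1`!%:R))%:E)%E.
Proof.
move=> b0; rewrite le_eqVlt => /predU1P[->|ab].
  by rewrite set_itv1 integral_set1 subrr mul0r.
pose F t := (a + b * t) ^+ n.+1 / (b * n.+1`!%:R).
have dF (t : R) : is_derive t 1 F ((a + b * t) ^+ n / n`!%:R).
  have d1 : is_derive t 1 (fun t : R => a + b * t) b.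
    have := @is_deriveZ R R R id b t 1 1 (is_derive_id _ _).
    rewrite /GRing.scale /= mulr1 => h.
    by have := is_deriveD (is_derive_cst a t 1) h; rewrite add0r.
  have d2 := @is_deriveX R R (fun t => a + b * t) n.+1 t 1 b d1.
  have := @is_deriveZ R R R _ (b * n.+1`!%:R)^-1 t 1 _ d2.
  rewrite /GRing.scale /=.
  have -> : (b * n.+1`!%:R)^-1 * (n.+1%:R * (a + b * t) ^+ n * b) = (a + b * t) ^+ n / n`!%:R.
    rewrite factS natrM; field.
    by rewrite factS_neq0 b0 nat1r pnatr_eq0.
  by congr is_derive; apply/funext => x; rewrite /F [RHS]mulrC exprfctE.
rewrite (@continuous_FTC2 R _ F)//.
- by rewrite /F -EFinB -mulrBl.
- apply: continuous_subspaceT => t.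
  apply: cvgM; last exact: cvg_cst.
  apply: (@continuous_comp _ _ _ (fun t : R => a + b * t) (fun x : R => x ^+ n)).
    by apply: cvgD; [exact: cvg_cst|apply: cvgM; [exact: cvg_cst|exact: cvg_id]].
  exact: exprn_continuous.
- have cF (t : R) : {for t, continuous F}.
    by apply: differentiable_continuous; apply/derivable1_diffP; have [] := dF t.
  split.
  + by move=> t _; have [] := dF t.
  + by apply: cvg_at_right_filter; exact: cF.
  + by apply: cvg_at_left_filter; exact: cF.
- by move=> t _; rewrite derive1E; apply: derive_val.
Qed.

(** The truncated power x_+^n / n!, which for n = 0 is the indicator of x >= 0. *)
Definition tpow n (x : R) : R := if 0 <= x then x ^+ n / n`!%:R else 0.

Lemma tpow_ge0 n x : 0 <= tpow n x.
Proof. by rewrite /tpow; case: ifPn => // x0; rewrite divr_ge0// exprn_ge0. Qed.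

Definition tent u s p q (t : R) : R := if t <= s then u + (t - s) / p else u - (t - s) * q.

Lemma measurable_affine (a b : R) : measurable_fun setT (fun t : R => a + b * t).
Proof. by apply: measurable_funD => //; apply: measurable_funM. Qed.

Lemma measurable_tent u s p q : measurable_fun setT (tent u s p q).
Proof.
rewrite (_ : tent u s p q =
  fun t => if t <= s then (u - s / p) + p^-1 * t else (u + s * q) + (- q) * t); last first.
  by apply/funext => t; rewrite /tent; case: ifP => _; ring.
apply: measurable_fun_ifT; [|exact: measurable_affine|exact: measurable_affine].
exact: measurable_fun_ler.
Qed.

Lemma measurable_tpow n : measurable_fun setT (tpow n).
Proof.
apply: measurable_fun_ifT => //; first exact: measurable_fun_ler.
by apply: measurable_funM => //; exact: measurable_funX.
Qed.

(** The tent vanishes at [x0] and [x1]. On the two sides of its peak the primitive of the power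
    gives the factors p and 1/q. *)
Lemma integral_tent n u s p q : 0 < p -> 0 < q ->
  (\int[mu]_t (tpow n (tent u s p q t))%:E = ((p + q^-1) * tpow n.+1 u)%:E)%E.
Proof.
move=> p0 q0.
have mf : measurable_fun setT (fun t => (tpow n (tent u s p q t))%:E).
  apply/measurable_EFinP.
  exact: (measurableT_comp (measurable_tpow n) (measurable_tent u s p q)).
have [u0|u0] := ltP u 0.
  have t0 t : tent u s p q t < 0.
    rewrite /tent; case: ifPn => ts.
      have : (t - s) / p <= 0 by rewrite pmulr_lle0 ?invr_gt0// subr_le0.
      by lra.
    have : 0 <= (t - s) * q by apply: mulr_ge0; [rewrite subr_ge0 ltW// ltNge|exact: ltW].
    by lra.
  rewrite {2}/tpow leNgt u0 mulr0.
  under eq_integral => t _ do rewrite /tpow leNgt t0.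
  exact: integral0.
pose x0 := s - u * p; pose x1 := s + u / q.
have x0s : x0 <= s by rewrite gerBl mulr_ge0// ltW.
have sx1 : s <= x1 by rewrite lerDl divr_ge0// ltW.
have outside t : (t < x0) || (x1 < t) -> tpow n (tent u s p q t) = 0.
  move=> /orP[tx|tx]; rewrite /tpow /tent.
    rewrite (le_trans (ltW tx) x0s) leNgt.
    have -> : u + (t - s) / p < 0.
      have -> : u + (t - s) / p = (t - x0) / p by rewrite /x0; field; rewrite gt_eqF.
      by rewrite pmulr_llt0 ?invr_gt0// subr_lt0.
    by [].
  have /negbTE -> : ~~ (t <= s) by rewrite -ltNge (le_lt_trans sx1 tx).
  rewrite leNgt.
  have -> : u - (t - s) * q < 0.
    have -> : u - (t - s) * q = (x1 - t) * q by rewrite /x1; field; rewrite gt_eqF.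
    by rewrite pmulr_llt0// subr_lt0.
  by [].
transitivity (\int[mu]_(t in `[x0, s] `|` `]s, x1]) (tpow n (tent u s p q t))%:E)%E.
  rewrite [RHS]integral_mkcond; apply: eq_integral => t _.
  rewrite patchE; case: ifPn => // /negP tD; rewrite outside//.
  apply/negPn/negP; rewrite negb_or -!leNgt => /andP[a1 a2]; apply: tD.
  rewrite inE /=; have [ts|st] := leP t s; [left|right]; by rewrite /= in_itv /= ?a1 ?ts ?st ?a2.
rewrite ge0_integral_setU//=; last 3 first.
- exact: measurable_funTS.
- by move=> t _; rewrite lee_fin tpow_ge0.
- apply/disj_setPS => t [] /=; rewrite !in_itv /= => /andP[_ ts] /andP[st _].
  by move: (lt_le_trans st ts); rewrite ltxx.
rewrite integral_itv_obnd_cbnd; last exact: measurable_funTS.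
have e1 : (\int[mu]_(t in `[x0, s]) (tpow n (tent u s p q t))%:E =
    \int[mu]_(t in `[x0, s]) (((u - s / p) + p^-1 * t) ^+ n / n`!%:R)%:E)%E.
  apply: eq_integral => t; rewrite inE /= in_itv /= => /andP[xt ts].
  have E : u + (t - s) / p = (u - s / p) + p^-1 * t by ring.
  rewrite /tpow /tent ts E ifT//.
  have -> : (u - s / p) + p^-1 * t = (t - x0) / p by rewrite /x0; field; rewrite gt_eqF.
  by rewrite divr_ge0 ?subr_ge0// ltW.
have e2 : (\int[mu]_(t in `[s, x1]) (tpow n (tent u s p q t))%:E =
    \int[mu]_(t in `[s, x1]) (((u + s * q) + (- q) * t) ^+ n / n`!%:R)%:E)%E.
  apply: eq_integral => t; rewrite inE /= in_itv /= => /andP[st tx].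
  have E : u - (t - s) * q = (u + s * q) + (- q) * t by ring.
  have E0 : 0 <= (u + s * q) + (- q) * t.
    have -> : (u + s * q) + (- q) * t = (x1 - t) * q by rewrite /x1; field; rewrite gt_eqF.
    by rewrite mulr_ge0 ?subr_ge0// ltW.
  rewrite /tpow /tent; case: (leP t s) => ts; last by rewrite E E0.
  have -> : t = s by apply/eqP; rewrite eq_le ts st.
  have -> : u + (s - s) / p = (u + s * q) + (- q) * s by ring.
  by rewrite ifT//; have -> : (u + s * q) + (- q) * s = u by ring.
rewrite e1 e2 !integral_affine_power//; last 2 first.
- by rewrite oppr_eq0 gt_eqF.
- by rewrite invr_eq0 gt_eqF.
rewrite -EFinD /tpow u0; congr (_%:E).
have -> : u - s / p + p^-1 * s = u by ring.
have -> : u - s / p + p^-1 * x0 = 0 by rewrite /x0; field; rewrite gt_eqF.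
have -> : u + s * q + - q * x1 = 0 by rewrite /x1; field; rewrite gt_eqF.
have -> : u + s * q + - q * s = u by ring.
rewrite !expr0n /= subr0 sub0r; field.
by rewrite factS_neq0 !gt_eqF.
Qed.

End PowerIntegrals.

Section StarPolytope.
Variable R : realType.

(* The slices of the join of the two simplices by a coordinate hyperplane are of
   the same kind, except that the coefficients s of the last vertices get a
   larger weight w and a positive lower bound sg. *)
Definition star_polytope n (p a : 'I_n -> R) (fl : 'I_n -> bool) (w sg : bool -> R) (c : R) :
    set 'cV[R]_n :=
  [set x | exists (s : bool -> R) (l : 'I_n -> R),
    [/\ forall b, sg b <= s b, forall i, 0 <= l i,
        forall i, x i 0 = - p i * l i + s (fl i) * a i &
        \sum_b w b * s b + \sum_i l i <= c]].

Definition update (w : bool -> R) (b : bool) (v : R) : bool -> R :=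
  fun b' => if b' == b then v else w b'.

Lemma sum_update (f : bool -> R -> R) (w : bool -> R) b v :
  \sum_b' f b' (update w b v b') = \sum_b' f b' (w b') - f b (w b) + f b v.
Proof.
rewrite (bigD1 b)//= [in RHS](bigD1 b)//= /update eqxx.
have -> : \sum_(i | i != b) f i (if i == b then v else w i) = \sum_(i | i != b) f i (w i).
  by apply: eq_bigr => i /negbTE ->.
ring.
Qed.

(** The first coordinate is solved for l_0 = (s a_0 - t) / p_0. This adds a_0 / p_0 to the weight of
    s and t / p_0 to the bound [c], and l_0 >= 0 becomes the lower bound t / a_0 for s. *)
Lemma star_polytope_slice n (p a : 'I_(1 + n) -> R) fl w sg c t (x : 'cV[R]_n) :
  (forall i, 0 < p i) -> (forall i, 0 < a i) ->
  let i0 := lshift n 0 in let b := fl i0 in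
  star_polytope p a fl w sg c (col_mx (const_mx t) x) <->
  star_polytope (fun i => p (rshift 1 i)) (fun i => a (rshift 1 i)) (fun i => fl (rshift 1 i))
    (update w b (w b + a i0 / p i0)) (update sg b (Num.max (sg b) (t / a i0)))
    (c + t / p i0) x.
Proof.
move=> p0 a0 i0 b.
have wE (s : bool -> R) : \sum_b' update w b (w b + a i0 / p i0) b' * s b' =
    \sum_b' w b' * s b' + a i0 / p i0 * s b.
  by rewrite (sum_update (fun b' v => v * s b')); ring.
split=> [[s [l [hs hl hx hc]]]|[s [l [hs hl hx hc]]]].
  have t0 : t = - p i0 * l i0 + s b * a i0 by rewrite -hx col_mxEu mxE.
  exists s, (fun i => l (rshift 1 i)); split=> //.
  - move=> b'; rewrite /update; case: eqVneq => [->|_]//.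
    rewrite ge_max hs ler_pdivrMr// t0 gerDr mulNr oppr_le0.
    by rewrite mulr_ge0// ltW.
  - by move=> i; rewrite -hx col_mxEd.
  - rewrite wE; move: hc; rewrite big_split_ord /= big_ord1 -/i0.
    have -> : t / p i0 = - l i0 + s b * a i0 / p i0 by rewrite t0; field; rewrite gt_eqF.
    lra.
pose l0 := (s b * a i0 - t) / p i0.
have l00 : 0 <= l0.
  apply: divr_ge0; last exact: ltW.
  have := hs b; rewrite /update eqxx ge_max => /andP[_].
  by rewrite ler_pdivrMr// subr_ge0.
exists s, (fun i => match fintype.split i with inl _ => l0 | inr k => l k end); split.
- move=> b'; have := hs b'; rewrite /update; case: eqVneq => [->|_]//.
  by rewrite ge_max => /andP[].
- by move=> i; case: fintype.split.
- move=> i; rewrite -(splitK i); case: (fintype.split i) => k /=.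
    rewrite col_mxEu mxE (unsplitK (inl k)) (ord1 k) -/i0 -/b /l0; field.
    by rewrite gt_eqF.
  by rewrite col_mxEd hx (unsplitK (inr k)).
- rewrite big_split_ord /= big_ord1 (unsplitK (inl _)).
  have -> : \sum_(i < n) match fintype.split (rshift 1 i) with inl _ => l0 | inr k => l k end = \sum_i l i.
    by apply: eq_bigr => i _; rewrite (unsplitK (inr i)).
  move: hc; rewrite wE /l0.
  have -> : (s b * a i0 - t) / p i0 = a i0 / p i0 * s b - t / p i0 by ring.
  lra.
Qed.

(** Slicing changes the weights, hence the general [w]; for unit weights this is the product of the
    two simplex volumes ([star_volume_product]). *)
Definition star_volume n (p a : 'I_n -> R) (fl : 'I_n -> bool) (w : bool -> R) : R :=
  (\prod_i p i) * \prod_b ((w b + \sum_(i | fl i == b) a i / p i) / w b).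

Lemma star_volumeS n (p a : 'I_(1 + n) -> R) fl w :
  (forall i, 0 < p i) -> (forall i, 0 < a i) -> (forall b, 0 < w b) ->
  let i0 := lshift n 0 in let b := fl i0 in
  star_volume p a fl w = (p i0 + a i0 / w b) *
    star_volume (fun i => p (rshift 1 i)) (fun i => a (rshift 1 i)) (fun i => fl (rshift 1 i))
      (update w b (w b + a i0 / p i0)).
Proof.
move=> p0 a0 w0 i0 b; rewrite /star_volume big_split_ord /= big_ord1 -/i0.
pose T b' := \sum_(i < n | fl (rshift 1 i) == b') a (rshift 1 i) / p (rshift 1 i).
have sE b' : \sum_(i < 1 + n | fl i == b') a i / p i = (if b' == b then a i0 / p i0 else 0) + T b'.
  rewrite big_mkcond big_split_ord /= big_ord1 -/i0 -/b /T [in RHS]big_mkcond.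
  by rewrite [b' == b]eq_sym.
under [X in _ * X = _]eq_bigr => b' _ do rewrite sE.
rewrite (bigD1 b)//= eqxx [in RHS](bigD1 b)//= {1 2}/update eqxx -/(T b).
have -> : \prod_(i | i != b) ((w i + ((if i == b then a i0 / p i0 else 0) + T i)) / w i) =
  \prod_(i | i != b) ((w i + T i) / w i).
  by apply: eq_bigr => i /negbTE ->; rewrite add0r.
have -> : \prod_(i | i != b) ((update w b (w b + a i0 / p i0) i + T i) / update w b (w b + a i0 / p i0) i) =
  \prod_(i | i != b) ((w i + T i) / w i).
  by apply: eq_bigr => i /negbTE ib; rewrite /update ib.
have wb := w0 b.
have h : 0 < w b + a i0 / p i0 by rewrite addr_gt0// divr_gt0.
have h' : w b * p i0 + a i0 != 0 by rewrite gt_eqF// addr_gt0// mulr_gt0.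
field.
by rewrite h' !gt_eqF.
Qed.

Lemma star_volume_ge0 n (p a : 'I_n -> R) fl w :
  (forall i, 0 < p i) -> (forall i, 0 < a i) -> (forall b, 0 < w b) -> 0 <= star_volume p a fl w.
Proof.
move=> p0 a0 w0; apply: mulr_ge0; first by apply: prodr_ge0 => i _; exact: ltW.
apply: prodr_ge0 => b _; apply: divr_ge0; last exact: ltW.
by apply: addr_ge0; [exact: ltW|apply: sumr_ge0 => i _; apply: divr_ge0; exact: ltW].
Qed.

(** By induction the slice at height t has volume a constant times a truncated power of a tent
    function of t. The peak is at t = sg_b a_0, where the two lower bounds for s agree. *)
Lemma lebesgue_volume_star n (p a : 'I_n -> R) fl w sg c :
  (forall i, 0 < p i) -> (forall i, 0 < a i) -> (forall b, 0 < w b) ->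
  lebesgue_volume (star_polytope p a fl w sg c) =
  (star_volume p a fl w * tpow n (c - \sum_b w b * sg b))%:E.
Proof.
elim: n p a fl w sg c => [|n IH] p a fl w sg c p0 a0 w0.
  rewrite /= /star_volume big_ord0 mul1r big1 ?mul1r => [|b _]; last first.
    by rewrite big_ord0 addr0 divff// gt_eqF.
  rewrite /tpow expr0 fact0 divr1; congr (_%:E).
  have -> : (0 <= c - \sum_b w b * sg b) = `[< star_polytope p a fl w sg c 0 >].
    rewrite subr_ge0; apply/idP/asboolP => [h|[s [l [hs _ _]]]].
      exists sg, (fun=> 0); split=> //; last by rewrite big_ord0 addr0.
      by move=> i; have := ltn_ord i; rewrite ltn0.
    rewrite big_ord0 addr0; apply: le_trans; apply: ler_sum => b _.
    by rewrite ler_pM2l.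
  rewrite indicE; case: asboolP => h; first by rewrite mem_set.
  by rewrite memNset.
rewrite /=; set i0 : 'I_(1 + n) := lshift n 0; set b := fl i0.
pose w' := update w b (w b + a i0 / p i0).
pose V' := star_volume (fun i => p (rshift 1 i)) (fun i => a (rshift 1 i)) (fun i => fl (rshift 1 i)) w'.
have w'0 b' : 0 < w' b'.
  by rewrite /w' /update; case: ifP => // _; rewrite addr_gt0// divr_gt0.
have V'0 : 0 <= V' by exact: star_volume_ge0.
have slice t : lebesgue_volume [set x : 'cV[R]_n | star_polytope p a fl w sg c (@col_mx R 1 n 1 (const_mx t) x)] =
    (V'%:E * (tpow n (tent (c - \sum_b w b * sg b) (sg b * a i0) (p i0) (w b / a i0) t))%:E)%E.
  rewrite (_ : [set x | _] = star_polytope (fun i => p (rshift 1 i)) (fun i => a (rshift 1 i))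
     (fun i => fl (rshift 1 i)) w' (update sg b (Num.max (sg b) (t / a i0))) (c + t / p i0)); last first.
    by apply/seteqP; split=> x /=; rewrite star_polytope_slice.
  rewrite IH// -EFinM; congr (_ * tpow n _)%:E.
  rewrite (sum_update (fun b' v => w' b' * v)) /w' (sum_update (fun b' v => v * sg b')).
  rewrite /update eqxx /tent; set W := \sum_b _.
  have <- : (t / a i0 <= sg b) = (t <= sg b * a i0) by rewrite ler_pdivrMr.
  have p00 := p0 i0; have a00 := a0 i0.
  case: ifPn => ts.
    by rewrite (max_idPl ts); field; rewrite gt_eqF.
  rewrite (max_idPr _); last by rewrite ltW// ltNge.
  by field; rewrite !gt_eqF.
under eq_integral => t _ do rewrite slice.
rewrite ge0_integralZl//; last 2 first.
- apply/measurable_EFinP.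
  exact: (measurableT_comp (measurable_tpow n) (measurable_tent _ _ _ _)).
- by move=> t _; rewrite lee_fin tpow_ge0.
rewrite integral_tent//; last by rewrite divr_gt0.
rewrite -EFinM (star_volumeS _ p0 a0 w0) -/i0 -/b -/V'; congr (_%:E).
by rewrite invf_div; ring.
Qed.

Lemma standard_simplexE n : standard_simplex R n =
  [set x : 'cV[R]_n | (forall i, 0 <= x i 0) /\ \sum_i x i 0 <= 1].
Proof.
apply/seteqP; split=> x.
  move=> [l [l0 l1 ->]].
  have E : map_mx intr (row_mx (0 : 'cV[int]_n) 1%:M) *m l = dsubmx (l : 'cV[R]_(1 + n)).
    rewrite -{1}[l]vsubmxK map_row_mx raddf0 map_mx1 mul_row_col mul0mx add0r mul1mx//.
  rewrite E; split=> [i|]; first by rewrite mxE.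
  rewrite -l1 big_split_ord /= big_ord1.
  under eq_bigr => i _ do rewrite mxE.
  by rewrite lerDr.
move=> [x0 x1]; exists (col_mx (const_mx (1 - \sum_i x i 0)) x); split.
- move=> i; rewrite -(splitK i); case: (fintype.split i) => k /=.
    by rewrite col_mxEu mxE subr_ge0.
  by rewrite col_mxEd.
- rewrite big_split_ord /= big_ord1 col_mxEu mxE.
  by under [X in _ + X]eq_bigr => i _ do rewrite col_mxEd; rewrite subrK.
- by rewrite map_row_mx raddf0 map_mx1 mul_row_col mul0mx add0r mul1mx.
Qed.

Lemma lebesgue_volume_corner n (c : R) :
  lebesgue_volume [set x : 'cV[R]_n | (forall i, 0 <= x i 0) /\ \sum_i x i 0 <= c] =
  (tpow n c)%:E.
Proof.
elim: n c => [|n IH] c.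
  rewrite /= indicE /tpow expr0 fact0 divr1; congr (_%:E).
  case: ifPn => c0.
    by rewrite mem_set//=; split; [move=> []|rewrite big_ord0].
  by rewrite memNset//= => -[_]; rewrite big_ord0 (negbTE c0).
rewrite /=.
have slice t : lebesgue_volume [set x : 'cV[R]_n | (forall i : 'I_(1 + n), 0 <= @col_mx R 1 n 1 (const_mx t) x i 0) /\
      \sum_(i < 1 + n) @col_mx R 1 n 1 (const_mx t) x i 0 <= c] = (if 0 <= t then tpow n (c - t) else 0)%:E.
  case: ifPn => t0.
    rewrite -IH; congr lebesgue_volume; apply/seteqP; split=> x /= [h1 h2]; split.
    - by move=> i; have := h1 (rshift 1 i); rewrite col_mxEd.
    - move: h2; rewrite big_split_ord /= big_ord1 col_mxEu mxE.
      by under eq_bigr => i _ do rewrite col_mxEd; lra.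
    - move=> i; rewrite -(splitK i); case: (fintype.split i) => k /=.
        by rewrite col_mxEu mxE.
      by rewrite col_mxEd.
    - rewrite big_split_ord /= big_ord1 col_mxEu mxE.
      by under eq_bigr => i _ do rewrite col_mxEd; lra.
  rewrite (_ : [set x | _] = set0); last first.
    apply/seteqP; split=> x //= [h1 _]; have := h1 (lshift n 0).
    by rewrite col_mxEu mxE (negbTE t0).
  have : (0 : R) > -1 by lra.
  (* The slice is empty; so is the corner of bound -1, whose volume is known by induction. *)
  move=> m1; have <- : lebesgue_volume [set x : 'cV[R]_n | (forall i, 0 <= x i 0) /\ \sum_i x i 0 <= -1] = 0%:E.
    by rewrite IH /tpow leNgt oppr_lt0 ltr01.
  congr lebesgue_volume; apply/seteqP; split=> x //= [h1 h2].
  have : 0 <= \sum_i x i 0 by apply: sumr_ge0.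
  lra.
under eq_integral => t _ do rewrite slice.
have [c0|c0] := ltP c 0.
  rewrite {2}/tpow leNgt c0 /=; transitivity (\int[@lebesgue_measure R]_t (0 : \bar R))%E; last exact: integral0.
  apply: eq_integral => t _; case: ifPn => // t0; rewrite /tpow ifF//.
  by apply/negbTE; rewrite -ltNge; lra.
transitivity (\int[@lebesgue_measure R]_(t in `[0%R, c]) (((c + (-1) * t) ^+ n / n`!%:R)%R)%:E)%E.
  rewrite [RHS]integral_mkcond; apply: eq_integral => t _; rewrite patchE.
  have -> : (t \in `[0%R, c]%classic) = (0 <= t <= c).
    by apply/idP/idP; rewrite inE /= in_itv.
  case: ifPn => //= t0; rewrite /tpow subr_ge0; case: ifPn => // _.
  by rewrite mulN1r.
rewrite integral_affine_power ?oppr_eq0 ?oner_eq0// /tpow c0; congr (_%:E).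
have -> : c + -1 * c = 0 by ring.
rewrite mulr0 addr0 expr0n /= sub0r; field.
exact: factS_neq0.
Qed.

End StarPolytope.

Section NewtonPolytope.
Variables (R : realType) (m1 m2 : nat).
Variables (A : 'M[int]_(m1 + m2, (m1 + 1) + (m2 + 1))).
Hypothesis ur0 : ursubmx A = 0.
Hypothesis dl0 : dlsubmx A = 0.
Variables (p1 : 'rV[int]_m1) (p2 : 'rV[int]_m2).
Hypothesis p1E : lsubmx (ulsubmx A) = - diag_mx p1.
Hypothesis p2E : lsubmx (drsubmx A) = - diag_mx p2.
Hypothesis p1_gt0 : forall i, 0 < p1 0 i.
Hypothesis p2_gt0 : forall i, 0 < p2 0 i.
Variables (lam1 : 'I_(m1 + 1) -> R).
Hypothesis lam1_gt0 : forall i, 0 < lam1 i.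
Hypothesis lam1_sum : \sum_i lam1 i = 1.
Hypothesis lam1_ker : forall j, \sum_i lam1 i * (ulsubmx A j i)%:~R = 0.
Hypothesis a1_gt0 : forall j, 0 < ulsubmx A j (rshift m1 0).
Hypothesis a2_gt0 : forall j, 0 < drsubmx A j (rshift m2 0).

Let n := (m1 + m2)%N.

Definition split_fun (T : Type) (g1 : 'I_m1 -> T) (g2 : 'I_m2 -> T) (i : 'I_n) : T :=
  match fintype.split i with inl j => g1 j | inr j => g2 j end.

Lemma split_fun_l T (g1 : 'I_m1 -> T) g2 j : split_fun g1 g2 (lshift m2 j) = g1 j.
Proof. by rewrite /split_fun (unsplitK (inl j)). Qed.

Lemma split_fun_r T (g1 : 'I_m1 -> T) g2 j : split_fun g1 g2 (rshift m1 j) = g2 j.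
Proof. by rewrite /split_fun (unsplitK (inr j)). Qed.

Definition diagonal : 'I_n -> R :=
  split_fun (fun i => (p1 0 i)%:~R) (fun i => (p2 0 i)%:~R).
Definition last_column : 'I_n -> R :=
  split_fun (fun i => (ulsubmx A i (rshift m1 0))%:~R) (fun i => (drsubmx A i (rshift m2 0))%:~R).
Definition in_fst : 'I_n -> bool := split_fun (fun=> true) (fun=> false).

Lemma special_row_sum m (C : 'M[int]_(m, m + 1)) (p : 'rV[int]_m) (v : 'I_(m + 1) -> R) j :
  lsubmx C = - diag_mx p ->
  \sum_k (C j k)%:~R * v k =
  - (p 0 j)%:~R * v (lshift 1 j) + v (rshift m 0) * (C j (rshift m 0))%:~R.
Proof.
move=> pE; rewrite big_split_ord /= big_ord1 [v (rshift m 0) * _]mulrC; congr (_ + _).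
have E k : C j (lshift 1 k) = - (p 0 j *+ (j == k)).
  by have /matrixP/(_ j k) := pE; rewrite !mxE.
rewrite (bigD1 j)//= big1 => [|k kj].
  by rewrite addr0 E eqxx mulr1n rmorphN.
by rewrite E eq_sym (negbTE kj) mulr0n oppr0 mul0r.
Qed.

Lemma row_l j (v : 'cV[R]_((m1 + 1) + (m2 + 1))) :
  (map_mx intr A *m v) (lshift m2 j) 0 = \sum_k (ulsubmx A j k)%:~R * v (lshift _ k) 0.
Proof.
rewrite mxE big_split_ord /= [X in _ + X]big1 ?addr0.
  by apply: eq_bigr => i _; rewrite !mxE.
move=> i _; have /matrixP/(_ j i) := ur0; rewrite !mxE => ->.
by rewrite mul0r.
Qed.

Lemma row_r j (v : 'cV[R]_((m1 + 1) + (m2 + 1))) :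
  (map_mx intr A *m v) (rshift m1 j) 0 = \sum_k (drsubmx A j k)%:~R * v (rshift _ k) 0.
Proof.
rewrite mxE big_split_ord /= [X in X + _]big1 ?add0r.
  by apply: eq_bigr => i _; rewrite !mxE.
move=> i _; have /matrixP/(_ j i) := dl0; rewrite !mxE => ->.
by rewrite mul0r.
Qed.

(* The weights lam1 represent 0, which absorbs a defect in the total weight. *)
Lemma newton_polytopeE : newton_polytope R A =
  star_polytope diagonal last_column in_fst (fun=> 1) (fun=> 0) 1.
Proof.
apply/seteqP; split=> x.
  move=> [l [l0 l1 ->]].
  exists (fun b : bool => if b then l (lshift _ (rshift m1 0)) 0 else l (rshift _ (rshift m2 0)) 0).
  exists (split_fun (fun i => l (lshift _ (lshift 1 i)) 0) (fun i => l (rshift _ (lshift 1 i)) 0)).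
  split.
  - by case.
  - by move=> i; rewrite /split_fun; case: fintype.split.
  - move=> i; rewrite -(splitK i); case: (fintype.split i) => j /=.
      by rewrite row_l (special_row_sum _ _ p1E) /diagonal /last_column /in_fst !split_fun_l.
    by rewrite row_r (special_row_sum _ _ p2E) /diagonal /last_column /in_fst !split_fun_r.
  - rewrite big_bool /= !mul1r big_split_ord /=.
    under eq_bigr => i _ do rewrite split_fun_l.
    under [X in _ + (_ + X) <= _]eq_bigr => i _ do rewrite split_fun_r.
    rewrite -l1 big_split_ord /= [X in _ <= X + _]big_split_ord [X in _ <= _ + X]big_split_ord /= !big_ord1.
    lra.
move=> [s [l [s0 l0 xE lc]]].
set T := (X in X <= 1) in lc.
pose v : 'cV[R]_((m1 + 1) + (m2 + 1)) := col_mx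
  (\col_k ((match fintype.split k with inl i => l (lshift m2 i) | inr _ => s true end) + (1 - T) * lam1 k))
  (\col_k (match fintype.split k with inl i => l (rshift m1 i) | inr _ => s false end)).
have T1 : 0 <= 1 - T by rewrite subr_ge0.
have vl k : v (lshift _ k) 0 = (match fintype.split k with inl i => l (lshift m2 i) | inr _ => s true end) + (1 - T) * lam1 k.
  by rewrite /v col_mxEu mxE.
have vr k : v (rshift _ k) 0 = (match fintype.split k with inl i => l (rshift m1 i) | inr _ => s false end).
  by rewrite /v col_mxEd mxE.
exists v; split.
- move=> i; rewrite -(splitK i); case: (fintype.split i) => k /=.
    rewrite vl; apply: addr_ge0; first by case: fintype.split => // _; exact: s0.
    by apply: mulr_ge0 => //; exact: ltW.
  by rewrite vr; case: fintype.split => // _; exact: s0.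
- rewrite big_split_ord /=.
  under eq_bigr => k _ do rewrite vl.
  under [X in _ + X]eq_bigr => k _ do rewrite vr.
  rewrite big_split /= -mulr_sumr lam1_sum mulr1.
  rewrite [X in X + _ + _]big_split_ord [X in _ + X]big_split_ord /= !big_ord1.
  rewrite !(unsplitK (inr _)).
  under eq_bigr => k _ do rewrite (unsplitK (inl k)).
  under [X in _ + (X + _)]eq_bigr => k _ do rewrite (unsplitK (inl k)).
  rewrite /T big_bool /= !mul1r big_split_ord /=; ring.
apply/colP => i; rewrite -(splitK i); case: (fintype.split i) => j /=.
  rewrite row_l; under eq_bigr => k _ do rewrite vl mulrDr.
  have z : \sum_k (ulsubmx A j k)%:~R * ((1 - T) * lam1 k) = 0.
    transitivity ((1 - T) * \sum_k lam1 k * (ulsubmx A j k)%:~R); last by rewrite lam1_ker mulr0.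
    by rewrite mulr_sumr; apply: eq_bigr => k _; ring.
  rewrite big_split /= z addr0 (special_row_sum _ _ p1E) (unsplitK (inl _)) (unsplitK (inr _)).
  by rewrite xE /diagonal /last_column /in_fst !split_fun_l.
rewrite row_r; under eq_bigr => k _ do rewrite vr.
rewrite (special_row_sum _ _ p2E) (unsplitK (inl _)) (unsplitK (inr _)).
by rewrite xE /diagonal /last_column /in_fst !split_fun_r.
Qed.

Lemma star_volume_product : star_volume diagonal last_column in_fst (fun=> 1) =
  simplex_volume (fun i => (p1 0 i)%:~R) (fun i => (ulsubmx A i (rshift m1 0))%:~R) *
  simplex_volume (fun i => (p2 0 i)%:~R) (fun i => (drsubmx A i (rshift m2 0))%:~R) :> R.
Proof.
have sT : \sum_(i | in_fst i == true) last_column i / diagonal i =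
    \sum_i (ulsubmx A i (rshift m1 0))%:~R / (p1 0 i)%:~R.
  rewrite big_mkcond big_split_ord /= [X in _ + X]big1 ?addr0.
    by apply: eq_bigr => i _; rewrite /in_fst /last_column /diagonal !split_fun_l eqxx.
  by move=> i _; rewrite /in_fst split_fun_r.
have sF : \sum_(i | in_fst i == false) last_column i / diagonal i =
    \sum_i (drsubmx A i (rshift m2 0))%:~R / (p2 0 i)%:~R.
  rewrite big_mkcond big_split_ord /= [X in X + _]big1 ?add0r.
    by apply: eq_bigr => i _; rewrite /in_fst /last_column /diagonal !split_fun_r eqxx.
  by move=> i _; rewrite /in_fst split_fun_l.
rewrite /star_volume big_bool /= !divr1 sT sF big_split_ord /= /simplex_volume.
have -> : \prod_(i < m1) diagonal (lshift m2 i) = \prod_(i < m1) (p1 0 i)%:~R.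
  by apply: eq_bigr => i _; rewrite /diagonal split_fun_l.
have -> : \prod_(i < m2) diagonal (rshift m1 i) = \prod_(i < m2) (p2 0 i)%:~R.
  by apply: eq_bigr => i _; rewrite /diagonal split_fun_r.
by rewrite -mulrA [X in _ * X]mulrCA !mulrA.
Qed.

Lemma normalized_volumeE : normalized_volume R A =
  simplex_volume (fun i => (p1 0 i)%:~R) (fun i => (ulsubmx A i (rshift m1 0))%:~R) *
  simplex_volume (fun i => (p2 0 i)%:~R) (fun i => (drsubmx A i (rshift m2 0))%:~R).
Proof.
rewrite /normalized_volume newton_polytopeE standard_simplexE lebesgue_volume_corner.
rewrite lebesgue_volume_star; first last.
- by move=> b; exact: ltr01.
- by move=> i; rewrite /last_column /split_fun; case: fintype.split => j; rewrite ltr0z.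
- by move=> i; rewrite /diagonal /split_fun; case: fintype.split => j; rewrite ltr0z.
rewrite big1 ?subr0 => [|b _]; last by rewrite mulr0.
rewrite /= mulfK ?star_volume_product// /tpow ler01 expr1n mul1r.
by rewrite invr_eq0 factS_neq0.
Qed.

End NewtonPolytope.

Lemma block_weights (R : realType) m (C : 'M[int]_(m, m + 1)) (b : 'I_(m + 1) -> int) :
  (forall i, 0 < b i) -> (forall j, \sum_i C j i * b i = 0) ->
  exists lam : 'I_(m + 1) -> R, [/\ forall i, 0 < lam i, \sum_i lam i = 1 &
    forall j, \sum_i lam i * (C j i)%:~R = 0].
Proof.
move=> b0 Cb; pose S : R := \sum_i (b i)%:~R.
have S0 : 0 < S.
  rewrite /S (bigD1 (rshift m 0))//=; apply: ltr_pwDl; first by rewrite ltr0z.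
  by apply: sumr_ge0 => i _; rewrite ler0z ltW.
exists (fun i => (b i)%:~R / S); split=> [i||j].
- by rewrite divr_gt0// ltr0z.
- by rewrite -mulr_suml divff// gt_eqF.
transitivity ((\sum_i C j i * b i)%:~R / S); last by rewrite Cb mul0r.
rewrite rmorph_sum /= mulr_suml; apply: eq_bigr => i _.
by rewrite intrM; ring.
Qed.

(** The Gale relation in row j equates C_j b_last with p_j b_j, a product of positive integers. *)
Lemma last_entry_gt0 m (C : 'M[int]_(m, m + 1)) (p : 'rV[int]_m) (b : 'I_(m + 1) -> int) :
  lsubmx C = - diag_mx p -> (forall i, 0 < p 0 i) -> (forall i, 0 < b i) ->
  (forall j, \sum_i C j i * b i = 0) -> forall j, 0 < C j (rshift m 0).
Proof.
move=> pE p0 b0 Cb j.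
have E k : C j (lshift 1 k) = - (p 0 j *+ (j == k)).
  by have /matrixP/(_ j k) := pE; rewrite !mxE.
have := Cb j; rewrite big_split_ord /= big_ord1 (bigD1 j)//= big1 => [|k kj]; last first.
  by rewrite E eq_sym (negbTE kj) mulr0n oppr0 mul0r.
rewrite addr0 E eqxx mulr1n => e.
have : 0 < C j (rshift m 0) * b (rshift m 0).
  by move: e => /eqP; rewrite mulNr addrC subr_eq0 => /eqP ->; exact: mulr_gt0.
by rewrite pmulr_lgt0.
Qed.

Theorem theorem6p2 (R : realType) (m1 m2 : nat)
    (A : 'M[int]_(m1 + m2, (m1 + 1) + (m2 + 1)))
    (f : 'I_((m1 + 1) + (m2 + 1)) -> R[i]) :
  circuit R A ->
  special_orthogonal_form A ->
  (forall i, f i != 0) ->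
  index_set A f [set Arg z | z in critical_points A f].
Proof.
move=> [_ A_inj _] [[[B [gB B1 B2]] ur0 dl0] special1 special2] f0.
(* In dimension 0 the two columns would be the same point. *)
have size_gt0 : (0 < m1 + m2)%N.
  rewrite lt0n; apply/eqP => n0.
  have : lshift (m2 + 1) (rshift m1 (ord0 : 'I_1)) = rshift (m1 + 1) (rshift m2 (ord0 : 'I_1)).
    by apply: A_inj; apply/colP => -[j hj]; exfalso; move: hj; rewrite n0.
  by move=> /(congr1 val) /=; lia.
have AB j : \sum_i A j i * B i 0 = 0.
  have /(proj2 (gB B)) : exists k : int, B = k *: B by exists 1; rewrite scale1r.
  move=> /colP/(_ (rshift 1 j)); rewrite /homogenize mul_col_mx col_mxEd !mxE //.
(* The zero blocks split the Gale relation into one relation per block; the sign change makes both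
   sets of weights positive. *)
pose b1 i := B (lshift _ i) 0; pose b2 i := - B (rshift _ i) 0.
have b1_gt0 i : 0 < b1 i by have := B1 i; rewrite mxE.
have b2_gt0 i : 0 < b2 i by have := B2 i; rewrite mxE oppr_gt0.
have C1 j : \sum_i ulsubmx A j i * b1 i = 0.
  rewrite -[RHS](AB (lshift _ j)) [RHS]big_split_ord /= [X in _ = _ + X]big1 ?addr0.
    by apply: eq_bigr => i _; rewrite !mxE.
  by move=> i _; have /matrixP/(_ j i) := ur0; rewrite !mxE => ->; rewrite mul0r.
have C2 j : \sum_i drsubmx A j i * b2 i = 0.
  rewrite -[RHS]oppr0 -[in RHS](AB (rshift _ j)) [in RHS]big_split_ord /= [X in _ = - (X + _)]big1 ?add0r.
    by rewrite -sumrN; apply: eq_bigr => i _; rewrite !mxE mulrN.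
  by move=> i _; have /matrixP/(_ j i) := dl0; rewrite !mxE => ->; rewrite mul0r.
have [lam1 [lam1_gt0 lam1_sum lam1_ker]] := block_weights R b1_gt0 C1.
have [lam2 [lam2_gt0 lam2_sum lam2_ker]] := block_weights R b2_gt0 C2.
have [p1 p1_gt0 p1E] := special1; have [p2 p2_gt0 p2E] := special2.
have a1_gt0 := last_entry_gt0 p1E p1_gt0 b1_gt0 C1.
have a2_gt0 := last_entry_gt0 p2E p2_gt0 b2_gt0 C2.
pose gam i := projT1 (cid (polar_exists (f0 i))).
pose alp i := projT1 (cid (projT2 (cid (polar_exists (f0 i))))).
have fE : f = f_of gam alp.
  by apply/funext => i; exact: (projT2 (cid (projT2 (cid (polar_exists (f0 i)))))).
have critE := critical_args gam alp special1 special2 ur0 dl0 lam1_gt0 lam2_gt0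
  lam1_sum lam2_sum lam1_ker lam2_ker.
have volE := normalized_volumeE ur0 dl0 p1E p2E p1_gt0 p2_gt0 lam1_gt0 lam1_sum lam1_ker a1_gt0 a2_gt0.
have detE := det_edges R p1E p2E p1_gt0 p2_gt0.
have simplex_gt0 m (p a : 'I_m -> R) : (forall i, 0 < p i) -> (forall i, 0 < a i) -> 0 < simplex_volume p a.
  move=> p0 a0; apply: mulr_gt0; first by apply: prodr_gt0 => i _.
  by apply: ltr_pwDl => //; apply: sumr_ge0 => i _; apply: divr_ge0; apply: ltW.
have vol_gt0 : 0 < normalized_volume R A.
  by rewrite volE; apply: mulr_gt0; apply: simplex_gt0 => i; rewrite ltr0z.
have det_gt0 : 0 < \det (edges A) by rewrite -(ltr0z R) detE -volE.
(* Critical arguments may lie in the closed coamoeba, so the convention with cardinality equal to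
   the volume is the one to meet. *)
right; rewrite fE critE; split.
  exists `|\det (edges A)|%N; first by apply: card_aligned => //; rewrite gt_eqF.
  by rewrite natr_absz gtr0_norm// detE volE.
have one := @aligned_one_per_component R m1 m2 A gam alp lam1 lam2 special1 special2 ur0 dl0 lam1_gt0 lam2_gt0 lam1_sum lam2_sum lam1_ker lam2_ker size_gt0.
exact: one.
Qed.
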